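(* Let $\mathfrak g$ be a simple Lie algebra of type $\mathsf{ADE}$ with diagram involution $\tau$ as in the context. Let $\mathscr V$ be a finite-dimensional $\mathscr Y$-module, regarded as a ${}^\imath\mathscr Y$-module by restriction along the embedding $\varphi$ described in the context. Then every ${}^\imath\boldsymbol\ell$-weight $\boldsymbol\lambda=(\lambda_i(u))_{i\in\mathbb I}$ of $\mathscr V$ has the form $$\lambda_i(u)=\Big(1+\frac{\wp_i}{4u}\Big)\frac{\Xi_i(u+\tfrac12)\,\Xi_{\tau i}^-(u-\tfrac12)}{\Xi_i(u-\tfrac12)\,\Xi_{\tau i}^-(u+\tfrac12)}\qquad\text{for } i\in\mathbb I,$$ where each $\Xi_i(u)$ ($i\in\mathbb I$) is a monic polynomial in $u$ (and the rational functions are expanded in $u^{-1}$).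
   Context: All algebras are over $\mathbb C$; $\mathbb N=\{0,1,2,\dots\}$; $[x,y]=xy-yx$, $\{x,y\}=xy+yx$. For a monic polynomial $P(u)$ put $P^-(u)=(-1)^{\deg P}P(-u)$. **$^\imath\boldsymbol\ell$-weights.** An $^\imath\boldsymbol\ell$-weight is a tuple $\boldsymbol\lambda=(\lambda_i(u))_{i\in\mathbb I}$ with $\lambda_i(u)=1+\sum_{r\ge0}\lambda_{i,r}u^{-r-1}\in1+u^{-1}\mathbb C[\![u^{-1}]\!]$. For a finite-dimensional ${}^\imath\mathscr Y$-module $M$, set $M_{\boldsymbol\lambda}=\{v\in M:\forall i\in\mathbb I,\ r\ge0,\ \exists p>0\text{ with }(h_{i,r}-\lambda_{i,r})^pv=0\}$; $\boldsymbol\lambda$ is an $^\imath\boldsymbol\ell$-weight of $M$ if $M_{\boldsymbol\lambda}\ne0$. **Lie algebra data.** $\mathfrak g$ is simple with simply-laced Cartan matrix $(c_{ij})_{i,j\in\mathbb I}$, simple roots $\alpha_i$, roots $\Phi$, positive roots $\Phi^+$, and invariant form with $(\alpha_i,\alpha_j)=c_{ij}$. Chevalley generators $x_i^\pm,\xi_i$ satisfy $(x_i^+,x_i^-)=1$, $\xi_i=[x_i^+,x_i^-]$. $\tau$ is a nontrivial involution of the Dynkin diagram (so $\mathfrak g$ is of type $\mathsf A$, $\mathsf D$ or $\mathsf E_6$), except that $\tau=\mathrm{id}$ in type $\mathsf A_1$; it acts on $\Phi$, and on $\mathfrak g$ by $x_i^\pm\mapsto x_{\tau i}^\pm$. Root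 vectors $x_\alpha^\pm\in\mathfrak g_{\pm\alpha}$ ($\alpha\in\Phi^+$) satisfy $x_{\alpha_i}^\pm=x_i^\pm$, $(x_\alpha^+,x_\alpha^-)=1$; put $x_\alpha:=x_\alpha^+$, $x_{-\alpha}:=x_\alpha^-$ and $[x_\alpha,x_\beta]=\eta_{\alpha,\beta}x_{\alpha+\beta}$ when $\alpha,\beta,\alpha+\beta\in\Phi$. If $\mathfrak g$ is not of type $\mathsf A_{2n}$, they are chosen with $\eta_{\alpha,\beta}=\eta_{-\beta,-\alpha}$ for $\alpha,\beta\in\Phi^+$ and $\tau(x_\alpha^\pm)=x_{\tau\alpha}^\pm$. If $\mathfrak g=\mathfrak{sl}_N$, $N=2n+1$ (type $\mathsf A_{2n}$), then $\mathbb I=\{1,\dots,2n\}$, $\tau i=N-i$, $\alpha_i=\varepsilon_i-\varepsilon_{i+1}$, $i'=N+1-i$, $\tau(\varepsilon_i-\varepsilon_j)=\varepsilon_{j'}-\varepsilon_{i'}$, and for $\alpha=\varepsilon_i-\varepsilon_j$, $i<j$: $x_\alpha^+=(\sqrt{-1})^{j-i-1}\mathbf e_{ij}$, $x_\alpha^-=(\sqrt{-1})^{i-j+1}\mathbf e_{ji}$; with $\beta_i:=\varepsilon_i-\varepsilon_{n+1}$ for $1\le i\le n$, $$\Theta_i=\begin{cases}-[x_{\beta_i}^+,x_{\tau\beta_i}^+]+[x_{\beta_{i+1}}^+,x_{\tau\beta_{i+1}}^+],&1\le i<n,\\-[x_{\beta_{\tau i}}^+,x_{\tau\beta_{\tau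 i}}^+]+[x_{\beta_{i'}}^+,x_{\tau\beta_{i'}}^+],&n+1<i<N,\\\tfrac12(\xi_n-\xi_{n+1})-[x_n^+,x_{n+1}^+],&i=n,n+1.\end{cases}$$ $\wp_i$: in type $\mathsf A_{2n}$, $\wp_n=1$, $\wp_{n+1}=-1$, $\wp_i=0$ otherwise; in all other types $\wp_i=0$. **Yangian.** $\mathscr Y$ is generated by $x_{i,r}^\pm,\xi_{i,r}$ ($i\in\mathbb I,r\in\mathbb N$) with relations $[\xi_{i,r},\xi_{j,s}]=0$; $[\xi_{i,0},x_{j,s}^\pm]=\pm(\alpha_i,\alpha_j)x_{j,s}^\pm$; $[x_{i,r}^+,x_{j,s}^-]=\delta_{ij}\xi_{i,r+s}$; $[\xi_{i,r+1},x_{j,s}^\pm]-[\xi_{i,r},x_{j,s+1}^\pm]=\pm\tfrac12(\alpha_i,\alpha_j)\{\xi_{i,r},x_{j,s}^\pm\}$; $[x_{i,r+1}^\pm,x_{j,s}^\pm]-[x_{i,r}^\pm,x_{j,s+1}^\pm]=\pm\tfrac12(\alpha_i,\alpha_j)\{x_{i,r}^\pm,x_{j,s}^\pm\}$; and, for $i\ne j$, $m=1-c_{ij}$, $\sum_{\sigma\in\mathfrak S_m}[x^\pm_{i,r_{\sigma(1)}},[x^\pm_{i,r_{\sigma(2)}},\cdots,[x^\pm_{i,r_{\sigma(m)}},x^\pm_{j,s}]\cdots]]=0$. $\mathrm U(\mathfrak g)\subset\mathscr Y$ via $x_i^\pm=x_{i,0}^\pm$, $\xi_i=\xi_{i,0}$.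 **iYangian.** ${}^\imath\mathscr Y$ is generated by $h_{i,r},b_{i,r}$ ($i\in\mathbb I,r\in\mathbb N$) subject to, for all $i,j,r,s$: $$[h_{i,r},h_{j,s}]=0,\quad h_{\tau i,0}=-h_{i,0},\quad[h_{i,0},b_{j,r}]=(c_{ij}-c_{\tau i,j})b_{j,r},$$ $$[h_{i,1},b_{j,r}]=(c_{ij}+c_{\tau i,j})b_{j,r+1}+\tfrac{c_{ij}-c_{\tau i,j}}2\{h_{i,0},b_{j,r}\},$$ $$[h_{i,r+2},b_{j,s}]-[h_{i,r},b_{j,s+2}]=\tfrac{c_{ij}-c_{\tau i,j}}2\{h_{i,r+1},b_{j,s}\}+\tfrac{c_{ij}+c_{\tau i,j}}2\{h_{i,r},b_{j,s+1}\}+\tfrac{c_{ij}c_{\tau i,j}}4[h_{i,r},b_{j,s}],$$ $$[b_{i,r+1},b_{j,s}]-[b_{i,r},b_{j,s+1}]=\tfrac{c_{ij}}2\{b_{i,r},b_{j,s}\}-2\delta_{\tau i,j}(-1)^rh_{j,r+s+1},$$ and the Serre relations: $[b_{i,0},b_{j,0}]=\delta_{\tau i,j}h_{j,0}$ if $c_{ij}=0$; $[b_{i,0},[b_{i,0},b_{\tau i,0}]]=4b_{i,0}$ if $c_{i,\tau i}=-1$; $[b_{i,0},[b_{i,0},b_{j,0}]]=0$ if $c_{ij}=-1$, $i\ne\tau i\ne j$; $[b_{i,0},[b_{i,0},b_{j,0}]]=-b_{j,0}$ if $c_{ij}=-1$, $i=\tau i$. **Embedding.** ${}^\imath\mathscr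 Y$ (generated by $h_{i,0},h_{i,1},b_{i,0}$, $i\in\mathbb I$) is identified with a subalgebra of $\mathscr Y$ by the injective algebra homomorphism $\varphi$ with $$h_{i,0}\mapsto\xi_i-\xi_{\tau i}+\tfrac14\wp_i,\quad b_{i,0}\mapsto x_i^+-x_{\tau i}^-,\quad h_{i,1}\mapsto\xi_{i,1}+\xi_{\tau i,1}-\xi_i\xi_{\tau i}+\tfrac12\sum_{\alpha\in\Phi^+}(\alpha,\alpha_i)\{x_\alpha^+,x_{\tau\alpha}^+\}+\tfrac12\Theta_i,$$ where $\Theta_i:=0$ if $\mathfrak g$ is not of type $\mathsf A_{2n}$. *)

(* Defs.v *)
From HB Require Import structures.
From mathcomp Require Import all_boot all_order all_algebra all_fingroup.
From mathcomp Require Import generic_quotient ring_quotient boolp.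
From mathcomp Require Import finmap.
From mathcomp.multinomials Require Import monalg.

Set Implicit Arguments.
Unset Strict Implicit.
Unset Printing Implicit Defensive.

Import GRing.Theory Num.Theory.
Local Open Scope ring_scope.
Local Open Scope quotient_scope.

Definition lie (A : pzRingType) (x y : A) : A := x * y - y * x.
Definition anti (A : pzRingType) (x y : A) : A := x * y + y * x.

Notation free_alg K G := ({malg K[{fmonom G}]}).
Notation const_coef p := (mcoeff (mone : fmonom _) p).

Definition fgen (K : fieldType) (G : choiceType) (g : G) : free_alg K G :=
  << fmu g >>.

Fact free_alg_scalerAr (K : fieldType) (G : choiceType) a (p q : free_alg K G) :
  a *: (p * q) = p * (a *: q).
Proof.
apply/malgP=> m; rewrite mcoeffZ.
rewrite (mcoeffMlw m (fsubset_refl (msupp p)) (fsubset_refl (msupp q))).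
rewrite (mcoeffMlw m (fsubset_refl (msupp p)) (msuppZ_le a q)) mulr_sumr.
apply: eq_bigr => k1 _; rewrite mulr_sumr; apply: eq_bigr => k2 _.
by rewrite mcoeffZ mulrnAr mulrCA.
Qed.

Inductive two_sided_ideal (A : pzRingType) (S : A -> Prop) : A -> Prop :=
| ideal0 : two_sided_ideal S 0
| idealD x a r b :
    two_sided_ideal S x -> S r -> two_sided_ideal S (x + a * r * b).

(* A relation [p = q] is recorded by its difference [p - q].  Relations are
   required to have no constant term, so that the quotient is nonzero and hence
   an [algType]. *)
Record presentation (K : fieldType) := Presentation {
  gens : choiceType;
  rels : free_alg K gens -> Prop;
  rels_const0 : forall p, rels p -> const_coef p = 0
}.

Section PresentedAlgebra.
Variables (K : fieldType) (P : presentation K).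
Local Notation F := (free_alg K (gens P)).

Definition pideal : {pred F} := fun p => `[< two_sided_ideal (@rels K P) p >].

Lemma pidealP p : reflect (two_sided_ideal (@rels K P) p) (p \in pideal).
Proof. exact: asboolP. Qed.

Fact pideal_zmod_closed : zmod_closed pideal.
Proof.
split=> [|p q /pidealP Ip /pidealP Iq]; first exact/pidealP/ideal0.
apply/pidealP; elim: Iq p Ip => [|x a r b _ IH rP] p Ip; first by rewrite subr0.
have -> : p - (x + a * r * b) = (p + (- a) * r * b) - x.
  by rewrite opprD !mulNr addrA addrAC.
by apply: IH; apply: idealD.
Qed.
HB.instance Definition _ := GRing.isZmodClosed.Build F pideal pideal_zmod_closed.

Fact pidealMl (a p : F) : p \in pideal -> a * p \in pideal.
Proof.
move=> /pidealP Ip; apply/pidealP.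
elim: Ip => [|x c r b _ IH rP]; first by rewrite mulr0; apply: ideal0.
by rewrite mulrDr !mulrA; apply: idealD.
Qed.

Fact pidealMr (p b : F) : p \in pideal -> p * b \in pideal.
Proof.
move=> /pidealP Ip; apply/pidealP.
elim: Ip => [|x c r d _ IH rP]; first by rewrite mul0r; apply: ideal0.
by rewrite mulrDl -(mulrA (c * r)); apply: idealD.
Qed.

Fact pidealZ k (p : F) : p \in pideal -> k *: p \in pideal.
Proof. by rewrite -mul_malgC; apply: pidealMl. Qed.

Fact pideal_const0 (p : F) : p \in pideal -> const_coef p = 0.
Proof.
move=> /pidealP; elim=> [|x a r b _ IH rP]; first exact: mcoeff0.
by rewrite mcoeffD IH !rmorphM /= (rels_const0 rP) mulr0 mul0r addr0.
Qed.

Definition presented : Type := Quotient.quot pideal.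
HB.instance Definition _ := EqQuotient.on presented.
HB.instance Definition _ := Choice.on presented.
HB.instance Definition _ := GRing.Zmodule.on presented.

Definition ppi (p : F) : presented := \pi_(Quotient.quot pideal) p.

Fact ppiE p q : (ppi p = ppi q) <-> (p - q \in pideal).
Proof. by rewrite Quotient.idealrBE; split=> [/eqP|/eqP]. Qed.

Fact ppi_repr (x : presented) : ppi (repr x) = x.
Proof. exact: reprK. Qed.

Fact repr_ppi p : p - repr (ppi p) \in pideal.
Proof. by apply/(proj1 (ppiE p _)); rewrite ppi_repr. Qed.

Fact ppi_is_zmod_morphism : zmod_morphism ppi.
Proof. by move=> p q; rewrite /ppi !piE. Qed.
HB.instance Definition _ :=
  GRing.isZmodMorphism.Build F presented ppi ppi_is_zmod_morphism.

Definition pone : presented := ppi 1.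
Definition pmul (x y : presented) : presented := ppi (repr x * repr y).
Definition pscale (k : K) (x : presented) : presented := ppi (k *: repr x).

Fact ppiM p q : ppi (p * q) = pmul (ppi p) (ppi q).
Proof.
apply/ppiE.
have -> : p * q - repr (ppi p) * repr (ppi q) =
   (p - repr (ppi p)) * q + repr (ppi p) * (q - repr (ppi q)).
  by rewrite mulrBl mulrBr addrA subrK.
by apply: rpredD; [apply: pidealMr | apply: pidealMl]; apply: repr_ppi.
Qed.

Fact ppiZ k p : ppi (k *: p) = pscale k (ppi p).
Proof.
by apply/ppiE; rewrite -scalerBr; apply: pidealZ; apply: repr_ppi.
Qed.

Local Ltac lift_repr := repeat match goal with x : presented |- _ =>
  rewrite -(ppi_repr x); move: (repr x) => {x} ? end.

Fact pmulA : associative pmul.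
Proof. by move=> x y z; lift_repr; rewrite -!ppiM mulrA. Qed.
Fact pmul1 : left_id pone pmul.
Proof. by move=> x; lift_repr; rewrite -!ppiM mul1r. Qed.
Fact pmulr1 : right_id pone pmul.
Proof. by move=> x; lift_repr; rewrite -!ppiM mulr1. Qed.
Fact pmulDl : left_distributive pmul +%R.
Proof. by move=> x y z; lift_repr; rewrite -raddfD -!ppiM mulrDl raddfD. Qed.
Fact pmulDr : right_distributive pmul +%R.
Proof. by move=> x y z; lift_repr; rewrite -raddfD -!ppiM mulrDr raddfD. Qed.
Fact pone_neq0 : pone != 0.
Proof.
apply/eqP; rewrite -[RHS](raddf0 ppi) => /ppiE; rewrite subr0 => /pideal_const0.
by rewrite rmorph1 => /eqP; rewrite oner_eq0.
Qed.
HB.instance Definition _ := GRing.Zmodule_isNzRing.Build presented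
  pmulA pmul1 pmulr1 pmulDl pmulDr pone_neq0.

Fact pscaleA a b x : pscale a (pscale b x) = pscale (a * b) x.
Proof. by lift_repr; rewrite -!ppiZ scalerA. Qed.
Fact pscale1 : left_id 1 pscale.
Proof. by move=> x; lift_repr; rewrite -ppiZ scale1r. Qed.
Fact pscaleDr : right_distributive pscale +%R.
Proof. by move=> a x y; lift_repr; rewrite -raddfD -!ppiZ scalerDr raddfD. Qed.
Fact pscaleDl x : {morph pscale^~ x : a b / a + b}.
Proof. by move=> a b; lift_repr; rewrite -!ppiZ scalerDl raddfD. Qed.
HB.instance Definition _ := GRing.Zmodule_isLmodule.Build K presented
  pscaleA pscale1 pscaleDr pscaleDl.

Fact pscaleAl (a : K) (x y : presented) : a *: (x * y) = (a *: x) * y.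
Proof.
rewrite /GRing.scale /GRing.mul /=.
by lift_repr; rewrite -!(ppiM, ppiZ) scalerAl.
Qed.
HB.instance Definition _ := GRing.Lmodule_isLalgebra.Build K presented pscaleAl.

Fact pscaleAr (a : K) (x y : presented) : a *: (x * y) = x * (a *: y).
Proof.
rewrite /GRing.scale /GRing.mul /=.
by lift_repr; rewrite -!(ppiM, ppiZ) free_alg_scalerAr.
Qed.
HB.instance Definition _ := GRing.Lalgebra_isAlgebra.Build K presented pscaleAr.

Fact ppi_is_monoid_morphism : monoid_morphism ppi.
Proof. by split; [exact: erefl | exact: ppiM]. Qed.
HB.instance Definition _ :=
  GRing.isMonoidMorphism.Build F presented ppi ppi_is_monoid_morphism.
Fact ppi_is_scalable : scalable ppi.
Proof. by move=> k p; rewrite ppiZ. Qed.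
HB.instance Definition _ :=
  GRing.isScalable.Build K F presented *:%R ppi ppi_is_scalable.

Definition pgen (g : gens P) : presented := ppi (fgen K g).

Lemma ppi_rel p : rels p -> ppi p = 0.
Proof.
move=> rP; rewrite -[RHS](raddf0 ppi); apply/ppiE/pidealP; rewrite subr0.
have := idealD 1 1 (ideal0 (@rels K P)) rP.
by rewrite add0r mul1r mulr1.
Qed.

End PresentedAlgebra.

Inductive ade := TypeA of nat | TypeD of nat | TypeE of nat.

Definition rank (t : ade) : nat :=
  match t with TypeA n | TypeD n | TypeE n => n end.

Definition ade_valid (t : ade) : bool :=
  match t with
  | TypeA n => (1 <= n)%N
  | TypeD n => (4 <= n)%N
  | TypeE n => (6 <= n <= 8)%N
  end.

(* The nodes are numbered as in Bourbaki, but from 0; [ade_edge t i j] lists the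
   edges with [i < j]. *)
Definition ade_edge (t : ade) (i j : nat) : bool :=
  match t with
  | TypeA _ => j == i.+1
  | TypeD n => (j == i.+1) && (j < n.-1)%N || (i == n - 3)%N && (j == n.-1)
  | TypeE _ => [|| (i == 0%N) && (j == 2), (i == 1%N) && (j == 3)
                 | (1 < i)%N && (j == i.+1)]
  end.

Definition cartan (t : ade) (i j : 'I_(rank t)) : int :=
  if i == j then 2 else if ade_edge t i j || ade_edge t j i then -1 else 0.
Arguments cartan : clear implicits.

Definition diagram_involution (t : ade) (tau : 'I_(rank t) -> 'I_(rank t)) :=
  [/\ involutive tau,
      forall i j, cartan t (tau i) (tau j) = cartan t i j &
      if t is TypeA 1 then tau =1 id else exists i, tau i != i].

Definition is_A2n (t : ade) : bool := if t is TypeA m then ~~ odd m else false.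

(* In type A_2n the nodes n and n+1 have indices n-1 and n here. *)
Definition wp (K : fieldType) (t : ade) (i : 'I_(rank t)) : K :=
  if ~~ is_A2n t then 0
  else if i.+1 == (rank t)./2 then 1
  else if i == (rank t)./2 :> nat then -1
  else 0.

(* The signs + and - are encoded by [false] and [true]. *)
Definition pm (K : fieldType) (e : bool) : K := (-1) ^+ e.

Section Yangians.
Variables (K : fieldType) (n : nat) (c : 'I_n -> 'I_n -> int).
Local Notation cK i j := ((c i j)%:~R : K).
Local Notation half := (2^-1 : K).

Definition ygens : choiceType := ((bool * 'I_n * nat) + ('I_n * nat))%type.

Section YangianRel.
Let x e i r : free_alg K ygens := @fgen K ygens (inl (e, i, r)).
Let xi i r : free_alg K ygens := @fgen K ygens (inr (i, r)).
Let m i j : nat := `|1 - c i j|%N.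

Inductive yangian_rel : free_alg K ygens -> Prop :=
| yr_xi_xi i j r s : yangian_rel (lie (xi i r) (xi j s))
| yr_xi0_x i j e s :
    yangian_rel (lie (xi i 0) (x e j s) - (pm K e * cK i j) *: x e j s)
| yr_xp_xm i j r s :
    yangian_rel (lie (x false i r) (x true j s)
                 - (i == j)%:R *: xi i (r + s)%N)
| yr_xi_x i j e r s :
    yangian_rel (lie (xi i r.+1) (x e j s) - lie (xi i r) (x e j s.+1)
                 - (pm K e * half * cK i j) *: anti (xi i r) (x e j s))
| yr_x_x i j e r s :
    yangian_rel (lie (x e i r.+1) (x e j s) - lie (x e i r) (x e j s.+1)
                 - (pm K e * half * cK i j) *: anti (x e i r) (x e j s))
| yr_serre i j e (r : 'I_(m i j) -> nat) s : i != j ->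
    yangian_rel (\sum_(sg : 'S_(m i j))
      foldr (fun k y => lie (x e i (r (sg k))) y) (x e j s) (enum 'I_(m i j))).
End YangianRel.

Fact const_fgen (G : choiceType) (g : G) : const_coef (fgen K g) = 0.
Proof.
rewrite /fgen mcoeffU; case: eqP => //= /(congr1 (@fdeg G)).
by rewrite fdeg1 fdegU.
Qed.

Fact const_lie (G : choiceType) (p q : free_alg K G) :
  const_coef (lie p q) = 0.
Proof. by rewrite mcoeffB !rmorphM /= mulrC subrr. Qed.

Fact const_anti (G : choiceType) (p q : free_alg K G) :
  const_coef q = 0 -> const_coef (anti p q) = 0.
Proof. by move=> q0; rewrite mcoeffD !rmorphM /= q0 mulr0 mul0r addr0. Qed.

Fact const_add (G : choiceType) (p q : free_alg K G) :
  const_coef p = 0 -> const_coef q = 0 -> const_coef (p + q) = 0.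
Proof. by move=> p0 q0; rewrite mcoeffD p0 q0 addr0. Qed.

Fact const_opp (G : choiceType) (p : free_alg K G) :
  const_coef p = 0 -> const_coef (- p) = 0.
Proof. by move=> p0; rewrite mcoeffN p0 oppr0. Qed.

Fact const_scale (G : choiceType) k (p : free_alg K G) :
  const_coef p = 0 -> const_coef (k *: p) = 0.
Proof. by move=> p0; rewrite mcoeffZ p0 mulr0. Qed.

Local Ltac solve_const := repeat lazymatch goal with
  | |- mcoeff _ (lie _ _) = _ => apply: const_lie
  | |- mcoeff _ (anti _ _) = _ => apply: const_anti
  | |- mcoeff _ (_ + _) = _ => apply: const_add
  | |- mcoeff _ (- _) = _ => apply: const_opp
  | |- mcoeff _ (_ *: _) = _ => apply: const_scale
  | |- mcoeff _ (fgen _ _) = _ => apply: const_fgen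
  end.

Fact yangian_rel_const0 p : yangian_rel p -> const_coef p = 0.
Proof.
case=> *; solve_const.
rewrite raddf_sum big1 // => sg _.
by case: (enum _) => [|? ?] /=; solve_const.
Qed.

Definition yangian_pres := Presentation yangian_rel_const0.
Definition yangian : algType K := presented yangian_pres.
Definition yx (e : bool) (i : 'I_n) (r : nat) : yangian :=
  @pgen K yangian_pres (inl (e, i, r)).
Definition yxi (i : 'I_n) (r : nat) : yangian :=
  @pgen K yangian_pres (inr (i, r)).

Variable tau : 'I_n -> 'I_n.

Definition igens : choiceType := (('I_n * nat) + ('I_n * nat))%type.

Section IYangianRel.
Let h i r : free_alg K igens := @fgen K igens (inl (i, r)).
Let b i r : free_alg K igens := @fgen K igens (inr (i, r)).

Inductive iyangian_rel : free_alg K igens -> Prop :=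
| ir_h_h i j r s : iyangian_rel (lie (h i r) (h j s))
| ir_h0 i : iyangian_rel (h (tau i) 0 + h i 0)
| ir_h0_b i j r :
    iyangian_rel (lie (h i 0) (b j r) - (cK i j - cK (tau i) j) *: b j r)
| ir_h1_b i j r :
    iyangian_rel (lie (h i 1) (b j r)
      - ((cK i j + cK (tau i) j) *: b j r.+1
         + ((cK i j - cK (tau i) j) / 2) *: anti (h i 0) (b j r)))
| ir_h_b i j r s :
    iyangian_rel (lie (h i r.+2) (b j s) - lie (h i r) (b j s.+2)
      - (((cK i j - cK (tau i) j) / 2) *: anti (h i r.+1) (b j s)
         + ((cK i j + cK (tau i) j) / 2) *: anti (h i r) (b j s.+1)
         + (cK i j * cK (tau i) j / 4) *: lie (h i r) (b j s)))
| ir_b_b i j r s :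
    iyangian_rel (lie (b i r.+1) (b j s) - lie (b i r) (b j s.+1)
      - ((cK i j / 2) *: anti (b i r) (b j s)
         - (2 * (tau i == j)%:R * (-1) ^+ r) *: h j (r + s).+1))
| ir_serre0 i j : c i j = 0 ->
    iyangian_rel (lie (b i 0) (b j 0) - (tau i == j)%:R *: h j 0)
| ir_serre_tau i : c i (tau i) = -1 ->
    iyangian_rel (lie (b i 0) (lie (b i 0) (b (tau i) 0)) - 4 *: b i 0)
| ir_serre1 i j : c i j = -1 -> i != tau i -> tau i != j ->
    iyangian_rel (lie (b i 0) (lie (b i 0) (b j 0)))
| ir_serre_fix i j : c i j = -1 -> i = tau i ->
    iyangian_rel (lie (b i 0) (lie (b i 0) (b j 0)) + b j 0).
End IYangianRel.

Fact iyangian_rel_const0 p : iyangian_rel p -> const_coef p = 0.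
Proof. by case=> *; solve_const. Qed.

Definition iyangian_pres := Presentation iyangian_rel_const0.
Definition iyangian : algType K := presented iyangian_pres.
Definition ih (i : 'I_n) (r : nat) : iyangian :=
  @pgen K iyangian_pres (inl (i, r)).
Definition ib (i : 'I_n) (r : nat) : iyangian :=
  @pgen K iyangian_pres (inr (i, r)).

End Yangians.
Arguments yx K {n} c e i r.
Arguments yxi K {n} c i r.
Arguments ih K {n} c tau i r.
Arguments ib K {n} c tau i r.

Record lie_algebra (K : fieldType) := LieAlgebra {
  lie_vect :> vectType K;
  lbr : lie_vect -> lie_vect -> lie_vect;
  lbr_linearl : forall y, linear (lbr^~ y);
  lbr_alt : forall x, lbr x x = 0;
  lbr_jacobi : forall x y z,
    lbr x (lbr y z) + lbr y (lbr z x) + lbr z (lbr x y) = 0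
}.

Definition lie_simple (K : fieldType) (g : lie_algebra K) : Prop :=
  (exists x y : g, lbr x y != 0) /\
  forall U : {vspace g},
    (forall x y : g, y \in U -> lbr x y \in U) -> U = 0%VS \/ U = fullv.

Record chevalley_lie (K : fieldType) (t : ade) := ChevalleyLie {
  cl_alg :> lie_algebra K;
  cl_simple : lie_simple cl_alg;
  cx : bool -> 'I_(rank t) -> cl_alg;
  cxi : 'I_(rank t) -> cl_alg := fun i => lbr (cx false i) (cx true i);
  cxi_cxi : forall i j, lbr (cxi i) (cxi j) = 0;
  cxi_cx : forall e i j,
    lbr (cxi i) (cx e j) = (pm K e * (cartan t i j)%:~R) *: cx e j;
  cxp_cxm : forall i j, i != j -> lbr (cx false i) (cx true j) = 0;
  cx_serre : forall e i j, i != j ->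
    iter `|1 - cartan t i j|%N (lbr (cx e i)) (cx e j) = 0;
  cx_generate : forall U : {vspace cl_alg},
    (forall e i, cx e i \in U) ->
    (forall x y, x \in U -> y \in U -> lbr x y \in U) -> U = fullv;
  cform : cl_alg -> cl_alg -> K;
  cform_linearl : forall y, scalar (cform^~ y);
  cform_sym : forall x y, cform x y = cform y x;
  cform_invariant : forall x y z, cform (lbr x y) z = cform x (lbr y z);
  cform_norm : forall i, cform (cx false i) (cx true i) = 1
}.

(* The root lattice, in the basis of simple roots. *)
Notation root_lattice t := {ffun 'I_(rank t) -> int}.

Section Roots.
Variables (K : fieldType) (t : ade) (g : chevalley_lie K t).
Implicit Types a b : root_lattice t.

Definition simple_root (i : 'I_(rank t)) : root_lattice t :=
  [ffun j => (j == i)%:Z].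

Definition root_form a b : int := \sum_i \sum_j a i * b j * cartan t i j.

Definition root_space a (x : g) : Prop :=
  forall i, lbr (cxi g i) x = (root_form a (simple_root i))%:~R *: x.

Definition is_root a : Prop := a != 0 /\ exists2 x : g, x != 0 & root_space a x.

Definition is_pos_root a : Prop := is_root a /\ forall i, 0 <= a i.

Definition tau_root (tau : 'I_(rank t) -> 'I_(rank t)) a : root_lattice t :=
  [ffun j => a (tau j)].

(* In type A, with coordinates eps_0, ..., eps_(rank t), this is the vector
   eps_i - eps_j for i < j. *)
Definition eps_diff (i j : nat) : root_lattice t :=
  [ffun k : 'I_(rank t) => (i <= k < j)%N%:Z].

End Roots.

Section RootVectors.
Variables (K : numClosedFieldType) (t : ade).
Variables (tau : 'I_(rank t) -> 'I_(rank t)) (g : chevalley_lie K t).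

Definition signed_root_vector (ps : seq (root_lattice t))
    (rv : bool -> root_lattice t -> g) (a : root_lattice t) : g :=
  if a \in ps then rv false a else rv true (- a).

(* [rv false a] and [rv true a] are x_a^+ and x_a^-, for a positive root [a];
   the values of [rv e] elsewhere are irrelevant. *)
Record root_vectors := RootVectors {
  posroots : seq (root_lattice t);
  posroots_uniq : uniq posroots;
  posrootsP : forall a : root_lattice t, a \in posroots <-> is_pos_root g a;
  rv : bool -> root_lattice t -> g;
  rv_root_space : forall e a, a \in posroots ->
    root_space (if e then - a else a) (rv e a);
  rv_simple : forall e i, rv e (simple_root i) = cx g e i;
  rv_norm : forall a, a \in posroots -> cform (rv false a) (rv true a) = 1;
  eta : root_lattice t -> root_lattice t -> K;
  etaP : forall a b, is_root g a -> is_root g b -> is_root g (a + b) ->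
    lbr (signed_root_vector posroots rv a) (signed_root_vector posroots rv b) =
      eta a b *: signed_root_vector posroots rv (a + b);
  tau_lie : {linear g -> g};
  tau_lie_br : forall x y, tau_lie (lbr x y) = lbr (tau_lie x) (tau_lie y);
  tau_lie_cx : forall e i, tau_lie (cx g e i) = cx g e (tau i);
  eta_sym : ~~ is_A2n t -> forall a b,
    a \in posroots -> b \in posroots -> a + b \in posroots ->
    eta a b = eta (- b) (- a);
  rv_tau : ~~ is_A2n t -> forall e a, a \in posroots ->
    tau_lie (rv e a) = rv e (tau_root tau a);
  (* In type A_2n, [psi] identifies [g] with sl_N, N = 2n+1. *)
  rv_A2n : is_A2n t -> exists psi : {linear g -> 'M[K]_((rank t).+1)},
    [/\ injective psi,
        forall A, (exists x, psi x = A) <-> \tr A = 0,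
        forall x y, psi (lbr x y) = lie (psi x) (psi y) &
        forall i j : 'I_(rank t).+1, (i < j)%N ->
          psi (rv false (eps_diff t i j))
            = ('i ^ (j%:Z - i%:Z - 1)) *: delta_mx i j /\
          psi (rv true (eps_diff t i j))
            = ('i ^ (i%:Z - j%:Z + 1)) *: delta_mx j i]
}.

Variable X : root_vectors.

(* With n = (rank t)./2 and nodes numbered from 0, beta_(k+1) = eps_k - eps_n.
   For n < i, the nodes tau i and i' of the case n+1 < i < N are 2n-1-i and
   2n-i here. *)
Definition Theta (i : 'I_(rank t)) : g :=
  let n := (rank t)./2 in
  let beta k := eps_diff t k n in
  let T k := lbr (rv X false (beta k)) (rv X false (tau_root tau (beta k))) in
  if ~~ is_A2n t then 0
  else if (i.+1 < n)%N then - T i + T i.+1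
  else if (n < i)%N then - T (n.*2.-1 - i)%N + T (n.*2 - i)%N
  else if i.+1 == n then
    2^-1 *: (cxi g i - cxi g (tau i)) - lbr (cx g false i) (cx g false (tau i))
  else
    2^-1 *: (cxi g (tau i) - cxi g i) - lbr (cx g false (tau i)) (cx g false i).

Local Notation Y := (yangian K (cartan t)).
Local Notation iY := (iyangian K (cartan t) tau).
Local Notation yxi := (yxi K (cartan t)).
Local Notation yx := (yx K (cartan t)).
Local Notation ih := (ih K (cartan t) tau).
Local Notation ib := (ib K (cartan t) tau).

Definition lie_inclusion (iota : {linear g -> Y}) : Prop :=
  [/\ injective iota,
      forall x y, iota (lbr x y) = lie (iota x) (iota y) &
      forall e i, iota (cx g e i) = yx e i 0].

Definition iyangian_embedding (iota : {linear g -> Y}) (phi : {lrmorphism iY -> Y}) :=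
  [/\ injective phi,
      forall i, phi (ih i 0) = yxi i 0 - yxi (tau i) 0 + (wp K i / 4)%:A,
      forall i, phi (ib i 0) = yx false i 0 - yx true (tau i) 0 &
      forall i, phi (ih i 1) =
        yxi i 1 + yxi (tau i) 1 - yxi i 0 * yxi (tau i) 0
        + 2^-1 *: (\sum_(a <- posroots X)
            (root_form a (simple_root i))%:~R *:
              anti (iota (rv X false a)) (iota (rv X false (tau_root tau a))))
        + 2^-1 *: iota (Theta i)].

End RootVectors.

Record fd_module (K : fieldType) (A : algType K) := FdModule {
  fd_space :> vectType K;
  fd_act : {linear A -> 'End(fd_space)};
  fd_act1 : fd_act 1 = \1%VF;
  fd_actM : forall a b, fd_act (a * b) = (fd_act a \o fd_act b)%VF
}.

Section Restriction.
Variables (K : fieldType) (A B : algType K) (f : {lrmorphism A -> B}).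
Variable M : fd_module B.

Fact restrict1 : (fd_act M \o f) 1 = \1%VF.
Proof. by rewrite /= rmorph1 fd_act1. Qed.

Fact restrictM a b :
  (fd_act M \o f) (a * b) = ((fd_act M \o f)%FUN a \o (fd_act M \o f)%FUN b)%VF.
Proof. by rewrite /= rmorphM fd_actM. Qed.

Definition restrict_along : fd_module A :=
  @FdModule K A (fd_space M) (fd_act M \o f) restrict1 restrictM.

End Restriction.

Section LWeights.
Variables (K : fieldType) (n : nat) (c : 'I_n -> 'I_n -> int).
Variables (tau : 'I_n -> 'I_n) (M : fd_module (iyangian K c tau)).

(* An i-l-weight is given by its coefficients: [lam i r] is lambda_(i,r). *)
Definition ilweight_space (lam : 'I_n -> nat -> K) (v : M) : Prop :=
  forall i r, exists2 p : nat, (0 < p)%N &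
    fd_act M ((ih K c tau i r - (lam i r)%:A) ^+ p) v = 0.

Definition is_ilweight (lam : 'I_n -> nat -> K) : Prop :=
  exists2 v : M, v != 0 & ilweight_space lam v.

End LWeights.

Notation "x %:F" := (tofrac x) : ring_scope.

(* The series 1 + sum_r l_r u^(-r-1), as a sequence of coefficients of u^(-m). *)
Definition ilseries (K : fieldType) (l : nat -> K) (m : nat) : K :=
  if m is r.+1 then l r else 1.

(* Coefficients of u^k, for k an integer, of sum_m s_m u^(-m) and of P(u). *)
Definition laurent_coef (K : fieldType) (s : nat -> K) (k : int) : K :=
  if k <= 0 then s `|k|%N else 0.

Definition poly_coef (K : fieldType) (P : {poly K}) (k : int) : K :=
  if 0 <= k then P`_(`|k|%N) else 0.

(* Writing f = P/Q, the series s is the expansion of f iff Q(u) s(u) = P(u)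
   in the field of Laurent series in 1/u. *)
Definition expansion_at_infinity (K : fieldType) (f : {fraction {poly K}})
    (s : nat -> K) : Prop :=
  exists P Q : {poly K},
    [/\ Q != 0, f = P%:F / Q%:F &
        forall k : int,
          \sum_(j < size Q) Q`_j * laurent_coef s (k - j%:Z) = poly_coef P k].

Definition poly_minus (K : fieldType) (P : {poly K}) : {poly K} :=
  (-1) ^+ (size P).-1 *: (P \Po (- 'X)).

Definition poly_shift (K : fieldType) (P : {poly K}) (a : K) : {poly K} :=
  P \Po ('X + a%:P).

(* Main.v *)
Require Import Defs.
From HB Require Import structures.
From mathcomp Require Import all_boot all_order all_algebra all_fingroup boolp.
From mathcomp Require Import zify ring.
From mathcomp Require Import reals complex.
From mathcomp.multinomials Require Import monalg.

(* Grade the Yangian by the adjoint action of the element rho of the Cartan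
   subalgebra, so that x_(i,r)^+ and x_(i,r)^- have degrees 1 and -1.  Commuting
   with a correction of h_(j,1) sends b_(j,r) to a nonzero multiple of b_(j,r+1);
   by induction this gives b_(j,r) up to terms of degree >= 2, and the relation
   between the b's then shows that, up to terms of degree >= 1, h_j(u) equals
   (1 + wp_j / 4u) xi_j(u) xi_(tau j)(-u).  In a finite-dimensional module the
   lowest component of an i-l-weight vector is therefore a generalized
   eigenvector of the products xi_j(u) xi_(tau j)(-u), and it yields a common
   eigenvector of all xi_(i,r), with eigenvalues mu_i(u) for which
   lambda_j(u) = (1 + wp_j / 4u) mu_j(u) mu_(tau j)(-u).
   It remains that an eigenvalue mu(u) of xi(u), on any eigenvector of a
   finite-dimensional module of the Yangian of sl_2, has the form
   f(u + 1/2) / f(u - 1/2) with f a quotient of monic polynomials.  Raising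
   operators reduce this to a highest weight vector v_0.  There one uses a series
   k(u) in the xi_r with k F[p] = F[(1 + 1/(u - X)) p] k, where F[X^r] = x_r^-.  On
   the span of the words in the x_r^- applied to v_0, k is triangular with diagonal
   entries k_0 prod_i (1 + 1/(u - a_i)), where k v_0 = k_0 v_0, while it acts on the
   last nonzero vector (x_0^-)^m v_0 as k_0 mu.  Hence mu = prod_i (1 + 1/(u - a_i)). *)

(** The series k(u) imitates a diagonal Gauss generator of the Yangian of gl_2. Its symbol is (u - X
    + 1)/(u - X), and the product of the symbols at u and at u - 1 is (u - X + 1)/(u - X - 1), the
    inverse of the symbol of xi(u). Using xi(u) itself would only relate its eigenvalues on the
    highest and the lowest vector; the two eigenvalues of k(u) differ by the factor mu, so comparing
    diagonal entries computes mu. The products xi_j(u) xi_(tau j)(-u) do not determine their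
    factors. This is why a common eigenvector of all xi_(i,r) is chosen inside the generalized
    eigenspace of the products, and mu_i is read off there. The factor 1 + wp_j/(4u) comes from
    noncommutativity: the part of b_j(u) of degree 1 is a product of x_j^+(u) and xi_(tau j)(-u),
    and exchanging the two factors changes the result by a multiple of (xi_j(u) xi_(tau j)(-u) -
    1)/u. The order matters only when c_(j, tau j) = -1, that is at the two middle nodes of type
    A_2n, where Theta_j prescribes it. *)

Set Implicit Arguments.
Unset Strict Implicit.
Unset Printing Implicit Defensive.

Import Order.TTheory GRing.Theory Num.Theory.
Local Open Scope ring_scope.

(** * Power series in 1/u *)

(* [a n] is the coefficient of u^-n. *)
Definition pser (A : Type) : Type := nat -> A.

Section PowerSeries.
Variable A : nzRingType.
Implicit Types a b c : pser A.

HB.instance Definition _ := gen_eqMixin (pser A).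
HB.instance Definition _ := gen_choiceMixin (pser A).

Definition psadd a b : pser A := fun n => a n + b n.
Definition psopp a : pser A := fun n => - a n.
Definition psmul a b : pser A := fun n => \sum_(i < n.+1) a i * b (n - i)%N.
Definition psC (x : A) : pser A := fun n => if n is 0 then x else 0.

Fact psaddA : associative psadd.
Proof. by move=> a b c; apply: funext => n; apply: addrA. Qed.
Fact psaddC : commutative psadd.
Proof. by move=> a b; apply: funext => n; apply: addrC. Qed.
Fact psadd0 : left_id (psC 0) psadd.
Proof. by move=> a; apply: funext => -[|n]; apply: add0r. Qed.
Fact psaddN : left_inverse (psC 0) psopp psadd.
Proof. by move=> a; apply: funext => -[|n]; apply: addNr. Qed.
HB.instance Definition _ :=
  GRing.isZmodule.Build (pser A) psaddA psaddC psadd0 psaddN.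

(** Coefficient n of a product depends only on truncations, so associativity is inherited from
    polynomials over [A]. *)
Let trunc n a : {poly A} := \poly_(i < n) a i.

Let coef_trunc n a i : (i < n)%N -> (trunc n a)`_i = a i.
Proof. by move=> lt_in; rewrite coef_poly lt_in. Qed.

Let psmulE n a b : psmul a b n = (trunc n.+1 a * trunc n.+1 b)`_n.
Proof.
by rewrite coefM; apply: eq_bigr => i _; rewrite !coef_trunc // ltnS leq_subr.
Qed.

Let trunc_mul n a b i :
  (i <= n)%N -> (trunc n.+1 (psmul a b))`_i = (trunc n.+1 a * trunc n.+1 b)`_i.
Proof.
move=> le_in; rewrite coef_trunc // /psmul coefM; apply: eq_bigr => j _.
have le_ji : (j <= i)%N by rewrite -ltnS.
by rewrite !coef_trunc // ltnS (leq_trans _ le_in) // leq_subr.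
Qed.

Fact psmulA : associative psmul.
Proof.
move=> a b c; apply: funext => n; rewrite !psmulE.
transitivity (trunc n.+1 a * (trunc n.+1 b * trunc n.+1 c))`_n.
  by rewrite !(coefM (trunc _ a)); apply: eq_bigr => i _; rewrite trunc_mul ?leq_subr.
rewrite mulrA !(coefM _ (trunc _ c)); apply: eq_bigr => i _.
by rewrite trunc_mul // -ltnS.
Qed.

Fact psmul1 : left_id (psC 1) psmul.
Proof.
move=> a; apply: funext => n; rewrite /psmul big_ord_recl subn0 mul1r.
by rewrite big1 /= ?addr0 // => i _; rewrite mul0r.
Qed.
Fact psmulr1 : right_id (psC 1) psmul.
Proof.
move=> a; apply: funext => n; rewrite /psmul big_ord_recr subnn mulr1.
rewrite big1 /= ?add0r // => i _; rewrite /psC.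
case E: (n - _)%N => [|k]; rewrite ?mulr0 //; move/eqP: E.
by rewrite subn_eq0 leqNgt ltn_ord.
Qed.
Fact psmulDl : left_distributive psmul psadd.
Proof.
move=> a b c; apply: funext => n; rewrite /psmul /psadd -big_split.
by apply: eq_bigr => i _; rewrite mulrDl.
Qed.
Fact psmulDr : right_distributive psmul psadd.
Proof.
move=> a b c; apply: funext => n; rewrite /psmul /psadd -big_split.
by apply: eq_bigr => i _; rewrite mulrDr.
Qed.
Fact psC1_neq0 : psC 1 != 0.
Proof. by apply/eqP => /(congr1 (fun a => a 0%N)) /eqP; rewrite oner_eq0. Qed.
HB.instance Definition _ := GRing.Zmodule_isNzRing.Build (pser A)
  psmulA psmul1 psmulr1 psmulDl psmulDr psC1_neq0.

Lemma psD a b n : (a + b) n = a n + b n. Proof. by []. Qed.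
Lemma psN a n : (- a) n = - a n. Proof. by []. Qed.
Lemma psB a b n : (a - b) n = a n - b n. Proof. by []. Qed.
Lemma psM a b n : (a * b) n = \sum_(i < n.+1) a i * b (n - i)%N. Proof. by []. Qed.
Lemma psCE x n : psC x n = x *+ (n == 0%N). Proof. by case: n. Qed.
Lemma ps0 n : (0 : pser A) n = 0. Proof. by case: n. Qed.
Lemma ps1 n : (1 : pser A) n = (n == 0%N)%:R. Proof. by case: n. Qed.
Lemma psMn a k n : (a *+ k) n = a n *+ k.
Proof. by elim: k => [|k IH]; [rewrite !mulr0n ps0 | rewrite !mulrS psD IH]. Qed.

Fact psC_zmod : zmod_morphism psC.
Proof. by move=> x y; apply: funext => -[|n]; rewrite psB //= subr0. Qed.
HB.instance Definition _ := GRing.isZmodMorphism.Build A (pser A) psC psC_zmod.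

Lemma psCMl x a n : (psC x * a) n = x * a n.
Proof.
rewrite psM big_ord_recl subn0 big1 /= ?addr0 // => i _; exact: mul0r.
Qed.
Lemma psCMr x a n : (a * psC x) n = a n * x.
Proof.
rewrite psM big_ord_recr subnn big1 /= ?add0r // => i _.
by rewrite psCE subn_eq0 leqNgt ltn_ord mulr0.
Qed.
Fact psC_mul : monoid_morphism psC.
Proof. by split=> // x y; apply: funext => n; rewrite psCMl !psCE mulrnAr. Qed.
HB.instance Definition _ := GRing.isMonoidMorphism.Build A (pser A) psC psC_mul.

Definition psX : pser A := fun n => (n == 1%N)%:R.

Lemma psXM a n : (psX * a) n = if n is m.+1 then a m else 0.
Proof.
rewrite psM; case: n => [|n]; first by rewrite big_ord1 mul0r.
rewrite big_ord_recl mul0r add0r big_ord_recl mul1r subSS subn0.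
by rewrite big1 /= ?addr0 // => i _; rewrite mul0r.
Qed.
Lemma psXC a : psX * a = a * psX.
Proof.
apply: funext => n; rewrite psXM psM; case: n => [|n].
  by rewrite big_ord1 mulr0.
rewrite big_ord_recr /= subnn mulr0 addr0 big_ord_recr /= subSn // subnn mulr1.
rewrite big1 /= ?add0r // => i _; rewrite /psX.
case: eqP => [E|]; rewrite ?mulr0 //; have := ltn_ord i; lia.
Qed.
End PowerSeries.

Inductive ncexpr := NCvar of nat | NC0 | NC1 | NCadd of ncexpr & ncexpr
  | NCopp of ncexpr | NCmul of ncexpr & ncexpr | NCmuln of ncexpr & nat.

(** * Deciding noncommutative ring identities *)

Section NonCommutativeRing.
Variable A : nzRingType.

(* The atoms of index less than [size cs] are central. A monomial is a sign, its
   central atoms and its remaining word. *)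
Definition ncmon : Type := bool * (seq nat * seq nat).

Fixpoint nceval (env : seq A) e : A :=
  match e with
  | NCvar i => env`_i | NC0 => 0 | NC1 => 1
  | NCadd e1 e2 => nceval env e1 + nceval env e2
  | NCopp e1 => - nceval env e1
  | NCmul e1 e2 => nceval env e1 * nceval env e2
  | NCmuln e1 n => nceval env e1 *+ n
  end.

Definition ncflip : seq ncmon -> seq ncmon := map (fun m => (~~ m.1, m.2)).

Fixpoint ncnorm (k : nat) e : seq ncmon :=
  match e with
  | NCvar i => [:: (false, if (i < k)%N then ([:: i], [::]) else ([::], [:: i]))]
  | NC0 => [::] | NC1 => [:: (false, ([::], [::]))]
  | NCadd e1 e2 => ncnorm k e1 ++ ncnorm k e2
  | NCopp e1 => ncflip (ncnorm k e1)
  | NCmul e1 e2 => let l2 := ncnorm k e2 in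
      flatten [seq [seq (m.1 (+) m'.1, (sort leq (m.2.1 ++ m'.2.1), m.2.2 ++ m'.2.2))
                   | m' <- l2] | m <- ncnorm k e1]
  | NCmuln e1 n => flatten (nseq n (ncnorm k e1))
  end.

Definition ncpart b (l : seq ncmon) := [seq m.2 | m <- l & m.1 == b].
(** Monomials are not collected with coefficients: the difference vanishes once its positive and
    negative monomials agree as multisets. *)
Definition nccheck k e1 e2 :=
  let l := ncnorm k (NCadd e1 (NCopp e2)) in perm_eq (ncpart false l) (ncpart true l).

Variable env : seq A.
Variable k : nat.
Hypothesis env_central : forall i, (i < k)%N -> forall a, env`_i * a = a * env`_i.

Let word (w : seq nat) : A := \prod_(i <- w) env`_i.
Let mon (m : seq nat * seq nat) := word m.1 * word m.2.
Let smon (m : ncmon) := (-1) ^+ m.1 * mon m.2.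
Let lin (l : seq ncmon) := \sum_(m <- l) smon m.
Let wf (l : seq ncmon) := all (fun m => all (fun i => i < k)%N m.2.1) l.

Let word_central w a : all (fun i => i < k)%N w -> word w * a = a * word w.
Proof.
rewrite /word; elim: w => [|i w IH] /=; first by rewrite big_nil mul1r mulr1.
by case/andP=> ltik /IH Hw; rewrite big_cons mulrA -env_central // -!mulrA Hw.
Qed.

Let word_perm w1 w2 : all (fun i => i < k)%N w1 -> perm_eq w1 w2 -> word w1 = word w2.
Proof.
elim: w1 w2 => [|i w1 IH] w2 /= => [_|/andP[ltik kw]].
  by rewrite perm_sym => /perm_nilP ->.
move=> pw; have: i \in w2 by rewrite -(perm_mem pw) mem_head.
move=> iw2; case/splitPr: iw2 pw => p1 p2 pw.
have {}pw : perm_eq w1 (p1 ++ p2).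
  by rewrite -(perm_cons i) (perm_trans pw) // -cat1s perm_catCA.
rewrite {1}/word big_cons -/(word w1) (IH _ kw pw) /word !big_cat big_cons /=.
by rewrite !mulrA env_central.
Qed.

Let wf_norm e : wf (ncnorm k e).
Proof.
rewrite /wf; elim: e => //= [i|e1 IH1 e2 IH2|e IH|e1 IH1 e2 IH2|e IH n].
- by case: ifP => //= ->.
- by rewrite all_cat IH1.
- by rewrite all_map.
- apply/allP => m /flatten_mapP[m1 m1P /mapP[m2 m2P ->]] /=.
  by rewrite all_sort all_cat (allP IH1 _ m1P) (allP IH2 _ m2P).
- by elim: n => //= n IHn; rewrite all_cat IH.
Qed.

Let mon_mul m1 m2 : all (fun i => i < k)%N m1.1 -> all (fun i => i < k)%N m2.1 ->
  mon (sort leq (m1.1 ++ m2.1), m1.2 ++ m2.2) = mon m1 * mon m2.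
Proof.
move=> k1 k2; rewrite /mon /=.
have E : perm_eq (sort leq (m1.1 ++ m2.1)) (m1.1 ++ m2.1) by rewrite perm_sort.
rewrite (word_perm _ E) ?all_sort ?all_cat ?k1 //.
rewrite /word !big_cat /= -!mulrA; congr (_ * _); rewrite !mulrA; congr (_ * _).
exact: word_central.
Qed.

Let ncnormP e : nceval env e = lin (ncnorm k e).
Proof.
rewrite /lin; elim: e => /= [i|||e1 IH1 e2 IH2|e IH|e1 IH1 e2 IH2|e IH n].
- rewrite big_seq1 /smon /mon expr0 mul1r /word.
  by case: ifP => _; rewrite !(big_seq1, big_nil) ?mulr1 ?mul1r.
- by rewrite big_nil.
- by rewrite big_seq1 /smon /mon /word !big_nil !mulr1.
- by rewrite IH1 IH2 big_cat.
- rewrite IH -sumrN big_map; apply: eq_bigr => -[b m] _.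
  by rewrite /smon /= -mulNr; case: b; rewrite ?expr0 ?expr1 ?opprK.
- rewrite IH1 IH2 big_flatten big_map mulr_suml.
  rewrite [LHS]big_seq [RHS]big_seq; apply: eq_bigr => m1 m1P.
  rewrite big_map mulr_sumr [LHS]big_seq [RHS]big_seq; apply: eq_bigr => m2 m2P.
  rewrite /smon /= mon_mul ?(allP (wf_norm e1) _ m1P) ?(allP (wf_norm e2) _ m2P) //.
  move: (mon m1.2) (mon m2.2) => x y; rewrite signr_addb -!mulrA; congr (_ * _).
  have -> : x * ((-1) ^+ m2.1 * y) = x * (-1) ^+ m2.1 * y by rewrite mulrA.
  have -> : x * (-1) ^+ m2.1 = (-1) ^+ m2.1 * x by apply: commr_sign.
  by rewrite !mulrA.
- rewrite IH; elim: n => [|n IHn] /=; first by rewrite big_nil.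
  by rewrite big_cat /= -IHn mulrS.
Qed.

Let lin_part l : lin l = \sum_(m <- ncpart false l) mon m - \sum_(m <- ncpart true l) mon m.
Proof.
rewrite /lin /ncpart; elim: l => [|[b m] l IH] /=; first by rewrite !big_nil subr0.
rewrite big_cons IH /smon /=; case: b => /=; rewrite !big_cons ?expr0 ?expr1 ?mul1r.
  by rewrite mulN1r opprD addrCA addrA.
by rewrite addrA.
Qed.

Lemma nccheckP e1 e2 : nccheck k e1 e2 -> nceval env e1 = nceval env e2.
Proof.
move=> chk; apply/eqP; rewrite -subr_eq0 -[_ - _]/(nceval env (NCadd e1 (NCopp e2))).
by rewrite ncnormP lin_part (perm_big _ chk) subrr.
Qed.
End NonCommutativeRing.

(** Centrality is a nested conjunction so that the tactics can supply it as a term built from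
    [conj]. *)
Lemma ncringP (A : nzRingType) (cs env : seq A) e1 e2 :
  foldr (fun c P => (forall a, c * a = a * c) /\ P) True cs ->
  nccheck (size cs) e1 e2 -> nceval (cs ++ env) e1 = nceval (cs ++ env) e2.
Proof.
move=> csC; apply: nccheckP => i ltik a; rewrite nth_cat ltik.
by elim: cs csC i ltik => [|c cs IH] //= [cC csC] [|i] //=; apply: IH.
Qed.

(* Atoms are compared up to conversion, since equal terms may reach their ring
   structure along different inheritance paths. *)
Ltac nc_head t := lazymatch t with ?g _ => nc_head g | _ => t end.
Ltac nc_same x y :=
  match constr:(Set) with
  | _ => let _ := match constr:(Set) with _ => constr_eq x y end in constr:(true)
  | _ => let hx := nc_head x in let hy := nc_head y in
         let _ := match constr:(Set) with _ => constr_eq hx hy; unify x y end in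
         constr:(true)
  | _ => constr:(false)
  end.
Ltac nc_mem x l := lazymatch l with
  | nil => constr:(false)
  | ?y :: ?l' => let b := nc_same x y in
      lazymatch b with true => constr:(true) | false => nc_mem x l' end
  end.
Ltac nc_rcons x l := lazymatch l with
  | nil => constr:([:: x])
  | ?y :: ?l' => let r := nc_rcons x l' in constr:(y :: r)
  end.
Ltac nc_atoms l t := lazymatch t with
  | 0 => l
  | 1 => l
  | ?a + ?b => let l := nc_atoms l a in nc_atoms l b
  | ?a * ?b => let l := nc_atoms l a in nc_atoms l b
  | - ?a => nc_atoms l a
  | ?a *+ _ => nc_atoms l a
  | _ => let b := nc_mem t l in
         lazymatch b with true => l | false => nc_rcons t l end
  end.
Ltac nc_index x l := lazymatch l with
  | ?y :: ?l' => let b := nc_same x y in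
      lazymatch b with
      | true => constr:(0%N)
      | false => let n := nc_index x l' in constr:(S n)
      end
  end.
Ltac nc_reify l t := lazymatch t with
  | 0 => constr:(NC0)
  | 1 => constr:(NC1)
  | ?a + ?b => let ea := nc_reify l a in let eb := nc_reify l b in constr:(NCadd ea eb)
  | ?a * ?b => let ea := nc_reify l a in let eb := nc_reify l b in constr:(NCmul ea eb)
  | - ?a => let ea := nc_reify l a in constr:(NCopp ea)
  | ?a *+ ?n => let ea := nc_reify l a in constr:(NCmuln ea n)
  | _ => let n := nc_index t l in constr:(NCvar n)
  end.
Ltac nc_drop cs l := lazymatch cs with
  | nil => l
  | _ :: ?cs' => lazymatch l with _ :: ?l' => nc_drop cs' l' end
  end.
(* [ncring_mod cs pf] decides ring identities modulo commutation of the elements of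
   [cs]; [pf] proves that these are central. *)
Ltac ncring_mod cs pf := lazymatch goal with |- ?t1 = ?t2 =>
  let l := nc_atoms cs t1 in let l := nc_atoms l t2 in
  let e1 := nc_reify l t1 in let e2 := nc_reify l t2 in
  let env := nc_drop cs l in
  let H := fresh in
  assert (H := @ncringP _ cs env e1 e2 pf);
  (refine (H _) || fail 1 "reification"); clear H; vm_compute; reflexivity
  end.
Tactic Notation "ncring" := lazymatch goal with |- @eq ?T _ _ =>
  ncring_mod (@nil T) I end.

Lemma in_alg_central (R : pzRingType) (A : algType R) (k : R) (a : A) :
  k%:A * a = a * k%:A.
Proof. by rewrite mulr_algl mulr_algr. Qed.

(* Scalars are treated as central elements; atoms [c] with a hypothesis
   [forall a, c * a = a * c] are central too. *)
Ltac nc_central cs pf := match goal with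
  | H : forall a, ?c * a = a * ?c |- _ =>
      let b := nc_mem c cs in
      lazymatch b with false => nc_central (c :: cs) (conj H pf) end
  | _ => ncring_mod cs pf
  end.
Ltac ncalg :=
  repeat match goal with |- context [?k *: ?x] =>
    lazymatch x with 1 => fail | _ => rewrite -[k *: x]mulr_algl end end;
  repeat match goal with |- context [@GRing.scale ?R ?V ?k 1] =>
    let c := fresh in set c := (@GRing.scale R V k 1);
    let H := fresh in assert (H : forall a, c * a = a * c) by exact: in_alg_central;
    clearbody c end;
  lazymatch goal with |- @eq ?T _ _ => nc_central (@nil T) I end.

Fact pser_mulC (A : comNzRingType) : commutative (@GRing.mul (pser A)).
Proof.
move=> a b; apply: funext => n; rewrite !psM (reindex_inj rev_ord_inj) /=.
by apply: eq_bigr => i _; rewrite mulrC subSS subKn // -ltnS.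
Qed.
HB.instance Definition _ (A : comNzRingType) :=
  GRing.PzRing_hasCommutativeMul.Build (pser A) (@pser_mulC A).

Section PowerSeriesTheory.
Variable A : nzRingType.
Implicit Types a b g : pser A.

Lemma psM0 a b : (a * b) 0%N = a 0%N * b 0%N.
Proof. by rewrite psM big_ord1. Qed.

(** The derivative in the variable z = 1/u. *)
Definition psderiv a : pser A := fun n => a n.+1 *+ n.+1.

Fact psderiv_zmod : zmod_morphism psderiv.
Proof. by move=> a b; apply: funext => n; rewrite /psderiv psB mulrnBl. Qed.
HB.instance Definition _ :=
  GRing.isZmodMorphism.Build (pser A) (pser A) psderiv psderiv_zmod.

Lemma psderivC x : psderiv (psC x) = 0.
Proof. by apply: funext => n; rewrite /psderiv /= ps0 mul0rn. Qed.

Lemma psderivX : psderiv (psX A) = 1.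
Proof.
by apply: funext => -[|n]; rewrite /psderiv /psX //= ?mul0rn.
Qed.

Lemma psderivM a b : psderiv (a * b) = psderiv a * b + a * psderiv b.
Proof.
apply: funext => n; rewrite psD !psM /psderiv psM.
have -> : (\sum_(i < n.+2) a i * b (n.+1 - i)%N) *+ n.+1 =
   \sum_(i < n.+2) (a i *+ i) * b (n.+1 - i)%N +
   \sum_(i < n.+2) a i * (b (n.+1 - i)%N *+ (n.+1 - i)).
  rewrite -big_split -sumrMnl; apply: eq_bigr => i _ /=.
  by rewrite mulrnAl mulrnAr -mulrnDr subnKC // -ltnS.
congr (_ + _); first by rewrite big_ord_recl mul0r add0r.
rewrite big_ord_recr /= subnn mulr0n mulr0 addr0; apply: eq_bigr => i _.
by rewrite subSn // -ltnS.
Qed.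

Definition psshift a : pser A := fun n => a n.+1.

Lemma psshiftE a : a = psC (a 0%N) + psX A * psshift a.
Proof. by apply: funext => -[|n]; rewrite psD psXM ?addr0 ?add0r. Qed.

Lemma psmulI a b : a 0%N = 1 -> b * a = 0 -> b = 0.
Proof.
move=> a0 ba0; apply: funext => n; elim/ltn_ind: n => n IH.
have /(congr1 (fun c => c n)) := ba0; rewrite psM big_ord_recr /= subnn a0 mulr1.
by rewrite big1 ?add0r // => i _; rewrite IH ?mul0r // ps0 mul0r.
Qed.

(** The series of u/(u - x). *)
Definition psgeo (x : A) : pser A := fun n => x ^+ n.

Lemma psgeoE x : psgeo x = 1 + psX A * psC x * psgeo x.
Proof.
apply: funext => -[|n]; rewrite psD -mulrA psXM ps1 ?addr0 ?expr0 //=.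
by rewrite add0r psCMl -exprS.
Qed.
End PowerSeriesTheory.
Arguments psX {A}.

Section Recursion.
Variables (T : Type) (x0 : T) (step : nat -> (nat -> T) -> T).

(** Course-of-values recursion: [recseq n] tabulates the first n values, and [x0] is only the
    default of [nth]. *)
Fixpoint recseq n : seq T :=
  if n is m.+1 then rcons (recseq m) (step m (nth x0 (recseq m))) else [::].
Definition recfun n : T := step n (nth x0 (recseq n)).

Lemma recfunE : (forall n a b, (forall i, (i < n)%N -> a i = b i) -> step n a = step n b) ->
  forall n, recfun n = step n recfun.
Proof.
move=> stepE n; apply: stepE => i; rewrite /recfun.
have sz m : size (recseq m) = m by elim: m => //= m IH; rewrite size_rcons IH.
elim: n i => // n IH i; rewrite ltnS leq_eqVlt /= nth_rcons sz.
by case/orP => [/eqP -> | ltin]; rewrite ?ltnn ?eqxx // ltin IH.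
Qed.
End Recursion.

Section PowerSeriesMap.
Variables (R A : nzRingType) (F : {additive R -> A}).

Definition psmap (P : pser R) : pser A := fun n => F (P n).

Fact psmap_zmod : zmod_morphism psmap.
Proof. by move=> P Q; apply: funext => n; rewrite /psmap !psB raddfB. Qed.
HB.instance Definition _ :=
  GRing.isZmodMorphism.Build (pser R) (pser A) psmap psmap_zmod.

Lemma psmapC x : psmap (psC x) = psC (F x).
Proof. by apply: funext => -[|n]; rewrite /psmap //= raddf0. Qed.
Lemma psmapXM P : psmap (psX * P) = psX * psmap P.
Proof. by apply: funext => -[|n]; rewrite psXM /psmap psXM ?raddf0. Qed.
Lemma psmap_deriv P : psmap (psderiv P) = psderiv (psmap P).
Proof. by apply: funext => n; rewrite /psmap /psderiv raddfMn. Qed.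
End PowerSeriesMap.

(** Since P = p_0 + z P', [T P] equals z [T P'], so every coefficient vanishes by induction.
    Identities in a series of polynomials thus need to be checked on constants only. *)
Lemma psmap_ext (R A : nzRingType) (T : pser R -> pser A) :
  {morph T : P Q / P + Q} -> (forall P, T (psX * P) = psX * T P) ->
  (forall p, T (psC p) = 0) -> forall P, T P = 0.
Proof.
move=> TD TX TC P; apply: funext => n; rewrite ps0; elim: n P => [|n IH] P.
  by rewrite (psshiftE P) TD TC TX add0r psXM.
by rewrite (psshiftE P) TD TC TX add0r psXM IH.
Qed.

Section Linearize.
Variables (K : fieldType) (V : lmodType K) (f : nat -> V).

(** The linear map X^r -> f_r, written F[p] for the lowering current: raising the index r becomes
    multiplication by X, and the generating series of the f_r is F[1/(u - X)]. *)
Definition plin (p : {poly K}) : V := \sum_(i < size p) p`_i *: f i.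

Lemma plin_widen n (p : {poly K}) : (size p <= n)%N -> plin p = \sum_(i < n) p`_i *: f i.
Proof.
move=> le_pn; rewrite /plin (big_ord_widen n (fun i => p`_i *: f i)) // big_mkcond.
apply: eq_bigr => i _; case: ltnP => // le_pi.
by rewrite nth_default ?scale0r.
Qed.

Fact plin_linear : linear plin.
Proof.
move=> a p q; pose n := maxn (size (a *: p + q)) (maxn (size p) (size q)).
rewrite !(@plin_widen n) ?leq_max ?leqnn ?orbT // scaler_sumr -big_split /=.
by apply: eq_bigr => i _; rewrite coefD coefZ scalerDl scalerA.
Qed.
HB.instance Definition _ := GRing.isLinear.Build K {poly K} V *:%R plin plin_linear.

Lemma plinXn n : plin 'X^n = f n.
Proof.
rewrite (@plin_widen n.+1) ?size_polyXn // big_ord_recr /= coefXn eqxx scale1r.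
by rewrite big1 ?add0r // => i _; rewrite coefXn ltn_eqF ?scale0r.
Qed.

Lemma plin_ind (P : {poly K} -> Prop) : P 0 ->
  (forall a p q, P p -> P q -> P (a *: p + q)) -> (forall n, P 'X^n) -> forall p, P p.
Proof.
move=> P0 PD PX p; rewrite -[p]coefK poly_def.
by apply: (big_ind P) => // [q r Pq Pr|i _]; [rewrite -[q]scale1r|rewrite -[_ *: _]addr0];
  apply: PD.
Qed.
End Linearize.

Ltac ncringX := match goal with |- context [@psX ?B] =>
  ncring_mod [:: (@psX B : pser B)] (conj (@psXC B) I) end.

Lemma pnatr_inj (K : numFieldType) (V : lmodType K) (x : V) n : x *+ n.+1 = 0 -> x = 0.
Proof. by rewrite -scaler_nat => /eqP; rewrite scaler_eq0 pnatr_eq0 => /eqP. Qed.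

(** Coefficient n of the equation gives (n+1) L_(n+1) in terms of earlier coefficients, and n + 1 is
    invertible in characteristic 0. *)
Lemma ps_ode_uniq (K : numFieldType) (A : algType K) (g L : pser A) :
  psderiv L = g * L -> L 0%N = 0 -> L = 0.
Proof.
move=> dL L0; apply: funext => n; rewrite ps0; elim/ltn_ind: n => -[|n] IH //.
apply: (@pnatr_inj K _ _ n); have /(congr1 (fun c => c n)) := dL.
rewrite /psderiv psM => ->; apply: big1 => i _.
by rewrite IH ?mulr0 // ltnS leq_subr.
Qed.

(** * The series k(u) *)

Section CartanCurrents.
Variables (K : numFieldType) (A : algType K) (f xi : nat -> A).
Hypothesis xi0_f : forall r, xi 0%N * f r - f r * xi 0%N = - (f r *+ 2).
Hypothesis xi_f : forall r s, xi s.+1 * f r - f r * xi s.+1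
  - (xi s * f r.+1 - f r.+1 * xi s) = - (xi s * f r + f r * xi s).

(* A property closed under the operations of [A], such as preserving the line
   spanned by a given vector of a module. *)
Variable P : A -> Prop.
Hypotheses (P1 : P 1) (PD : forall a b, P a -> P b -> P (a + b))
  (PM : forall a b, P a -> P b -> P (a * b)) (PZ : forall k a, P a -> P (k *: a))
  (Pxi : forall s, P (xi s)).

Let P0 : P 0. Proof. by rewrite -(scale0r (1 : A)); apply: PZ. Qed.
Let PN a : P a -> P (- a). Proof. by rewrite -scaleN1r; apply: PZ. Qed.
Let Psum n (G : 'I_n -> A) : (forall i, P (G i)) -> P (\sum_i G i).
Proof. by move=> PG; apply: big_ind. Qed.

Local Notation F := (plin f).
Local Notation Fs := (psmap (plin f)).

Definition cartan_series : pser A := fun n => if n is m.+1 then xi m else 1.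
Arguments cartan_series : simpl never.
Local Notation Xi := cartan_series.

Let XiS n : Xi n.+1 = xi n. Proof. by []. Qed.
Let Pcs n : P (Xi n). Proof. by case: n. Qed.

Let bet c : pser {poly K} := 1 - psX * psC ('X - c%:P).

(** As [bet c] is (u - X + c)/u, moving xi(u) past F multiplies the symbol by (u - X - 1)/(u - X +
    1). On a constant Q, the coefficients of this identity are [xi0_f] and [xi_f]. *)
Lemma cartan_intertwine (Q : pser {poly K}) :
  Xi * Fs (bet 1 * Q) = Fs (bet (- 1) * Q) * Xi.
Proof.
pose T Q := Xi * Fs (bet 1 * Q) - Fs (bet (- 1) * Q) * Xi.
apply/eqP; rewrite -subr_eq0 -/(T Q); apply/eqP; apply: psmap_ext => {Q} [p q|p|p].
- by rewrite /T !mulrDr !raddfD mulrDl mulrDr /=; ncring.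
- rewrite /T ![_ * (psX * p)]mulrCA !psmapXM.
  ncringX.
have FX (c : K) : Fs (bet c * psC p) = psC (F p) - psX * psC (F ('X * p) - c *: F p).
  rewrite /bet mulrBl mul1r -mulrA -rmorphM /= raddfB /= psmapXM !psmapC.
  by rewrite mulrBl mul_polyC raddfB /= linearZ.
rewrite /T !FX; apply: funext => n; rewrite ps0 !(mulrBl, mulrBr) !mulrA -!(psXC Xi).
rewrite -!mulrA !psB psCMr psCMl; case: n => [|n]; rewrite !psXM; first by rewrite mul1r mulr1;
  ncring.
rewrite scale1r scaleN1r !psCMr !psCMl.
elim/plin_ind: p {FX} => [|a p q IHp IHq|r].
- by rewrite mulr0 !raddf0; ncring.
- have -> : 'X * (a *: p + q) = a *: ('X * p) + 'X * q by rewrite mulrDr scalerAr.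
  rewrite !linearP /=; transitivity (a *: (0 : A) + 0); last by rewrite scaler0 addr0.
  rewrite -{1}IHp -IHq.
  ncalg.
rewrite -exprS !plinXn.
case: n => [|n]; rewrite !XiS.
  by have /eqP := xi0_f r; rewrite -subr_eq0 => /eqP <-; rewrite /cartan_series; ncring.
by have /eqP := xi_f r n; rewrite -subr_eq0 => /eqP <-; ncring.
Qed.

Let X1 (c : K) : {poly K} := 'X - c%:P.

Let bet_geo c : bet c * psgeo (X1 c) = 1.
Proof. by rewrite mulrBl mul1r {1}psgeoE addrK. Qed.

Let deriv_bet c : psderiv (bet c) = - psC (X1 c).
Proof. by rewrite raddfB /= (psderivC (1 : {poly K})) sub0r psderivM psderivC psderivX mul1r
  mulr0 addr0. Qed.

Let deriv_geo c : psderiv (psgeo (X1 c)) = psC (X1 c) * psgeo (X1 c) * psgeo (X1 c).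
Proof.
have /(congr1 (@psderiv _)) := bet_geo c.
rewrite psderivM deriv_bet (psderivC (1 : {poly K})) => /(congr1 (fun x => psgeo (X1 c) * x)) /eqP.
rewrite mulr0 mulrDr addrC mulrA [_ * bet c]mulrC bet_geo mul1r mulNr mulrN subr_eq0.
by move/eqP ->; ring.
Qed.

(* The logarithmic derivative of the Cartan series acts on the current [f] as a
   derivation, multiplying it by the logarithmic derivative of the symbol
   (1 - (X + 1) z) / (1 - (X - 1) z). *)
Let cs : pser A := recfun 0 (fun n a => psderiv Xi n - \sum_(i < n) a i * Xi (n - i)%N).

Let csE : cs * Xi = psderiv Xi.
Proof.
apply: funext => n; rewrite psM big_ord_recr /= subnn mulr1 /cs recfunE; last first.
  by move=> m a b ab; congr (_ - _); apply: eq_bigr => i _; rewrite ab.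
by rewrite addrC subrK.
Qed.

Let Pcsn n : P (cs n).
Proof.
elim/ltn_ind: n => n IH; rewrite /cs recfunE; last first.
  by move=> m a b ab; congr (_ - _); apply: eq_bigr => i _; rewrite ab.
apply: PD; first by rewrite /psderiv -scaler_nat; apply: PZ.
by apply/PN/Psum => i; apply: PM => //; apply: IH.
Qed.

Let cs_comm p n : cs n * F p - F p * cs n = F ((X1 1 ^+ n.+1 - X1 (- 1) ^+ n.+1) * p).
Proof.
pose ga := psgeo (X1 1); pose gb := psgeo (X1 (- 1)).
have ba : bet 1 * ga = 1 by apply: bet_geo.
have bb : bet (- 1) * gb = 1 by apply: bet_geo.
(* This choice makes the right-hand symbol of [cartan_intertwine] the constant p. Differentiating
   that identity, and moving the derivative of the left-hand symbol back across xi(u), leaves xi(u)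
   as a right factor to cancel. *)
pose Q := gb * psC p.
have bQ : bet (- 1) * Q = psC p by rewrite mulrA bb mul1r.
have E : Xi * Fs (bet 1 * Q) = psC (F p) * Xi by rewrite cartan_intertwine bQ psmapC.
have E' : Xi * Fs (psderiv (bet 1 * Q)) =
  Fs ((psC (X1 (- 1)) * gb - psC (X1 1) * ga) * psC p) * Xi.
  have -> : psderiv (bet 1 * Q) = bet 1 * (ga * psderiv (bet 1 * Q)) by rewrite mulrA ba mul1r.
  rewrite cartan_intertwine; congr (Fs _ * _).
  rewrite !psderivM deriv_bet deriv_geo psderivC mulr0 addr0 -/gb /Q.
  have -> : bet (- 1) * (ga * (- psC (X1 1) * (gb * psC p) +
      bet 1 * (psC (X1 (- 1)) * gb * gb * psC p))) =
    (bet (- 1) * gb) * ((bet 1 * ga) * psC (X1 (- 1)) * gb - psC (X1 1) * ga) * psC p by ring.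
  by rewrite ba bb !mul1r.
have : cs * psC (F p) - psC (F p) * cs +
   Fs ((psC (X1 (- 1)) * gb - psC (X1 1) * ga) * psC p) = 0.
  apply: (@psmulI _ Xi) => //; rewrite mulrDl -E' mulrBl -(mulrA cs) -E mulrA csE.
  rewrite -(mulrA _ cs) csE psmap_deriv.
  have /(congr1 (@psderiv _)) := E; rewrite !psderivM psderivC mul0r add0r => <-.
  by ncring.
move/(congr1 (fun a => a n)); rewrite psD psB psCMr psCMl ps0 => /eqP.
rewrite addr_eq0 => /eqP ->; rewrite /psmap psCMr psB !psCMl -!exprS -raddfN /=.
by rewrite -mulNr opprB.
Qed.

Let coef_Xsub (c : K) n : (size (X1 c ^+ n.+1) <= n.+2)%N /\ (X1 c ^+ n.+1)`_n = - c * n.+1%:R.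
Proof.
split; first by rewrite size_exp_XsubC.
elim: n => [|n IH]; first by rewrite expr1 coefB coefX coefC sub0r mulr1.
have lead : (X1 c ^+ n.+1)`_n.+1 = 1.
  have /monicP := monic_exp n.+1 (monicXsubC c).
  by rewrite lead_coefE size_exp_XsubC.
rewrite exprS mulrBl coefB coefXM coefCM /= IH lead [in RHS]mulrSr mulrDr; ring.
Qed.

(** The symbol of [cs n] has degree n and leading coefficient -2(n+1), nonzero in characteristic 0.
    These symbols therefore span all polynomials, and q is reduced one leading term at a time. *)
Lemma cartan_power_sums (q : {poly K}) :
  exists2 D, P D & forall p, D * F p - F p * D = F (q * p).
Proof.
have [n] := ubnP (size q); elim: n q => // n IH q; rewrite ltnS => leqn.
case: n IH leqn => [|n] IH leqn.
  move: leqn; rewrite leqn0 size_poly_eq0 => /eqP ->.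
  by exists 0 => // p; rewrite !mul0r linear0; ncring.
pose w := X1 1 ^+ n.+1 - X1 (- 1) ^+ n.+1.
have [sz1 c1] := coef_Xsub 1 n; have [sz2 c2] := coef_Xsub (- 1) n.
have lead1 (c : K) : (X1 c ^+ n.+1)`_n.+1 = 1.
  have /monicP := monic_exp n.+1 (monicXsubC c).
  by rewrite lead_coefE size_exp_XsubC.
have wn : w`_n = - (2 * n.+1%:R) by rewrite coefB c1 c2; ring.
have szw : (size w <= n.+1)%N.
  apply/leq_sizeP => j; rewrite leq_eqVlt => /predU1P[<-|ltnj].
    by rewrite coefB !lead1 subrr.
  by rewrite nth_default // (leq_trans _ ltnj) // (leq_trans (size_polyD _ _)) // size_polyN
    geq_max sz1 sz2.
have nz : (2 * n.+1%:R : K) != 0 by rewrite mulf_neq0 // pnatr_eq0.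
pose a := - (q`_n / (2 * n.+1%:R)).
have [|D PD' DE] := IH (q - a *: w).
  rewrite ltnS; apply/leq_sizeP => j; rewrite leq_eqVlt => /predU1P[<-|ltnj].
    by rewrite coefB coefZ wn /a mulrNN divfK ?subrr.
  rewrite nth_default // (leq_trans _ ltnj) // (leq_trans (size_polyD _ _)) // size_polyN geq_max
    leqn.
  by rewrite (leq_trans (size_scale_leq _ _)).
exists (D + a *: cs n) => [|p]; first by apply: PD => //; apply: PZ.
have -> : q * p = (q - a *: w) * p + a *: (w * p) by rewrite mulrBl -scalerAl subrK.
have -> r1 r2 : F (r1 + a *: r2) = F r1 + a *: F r2 by rewrite linearD linearZ.
by rewrite -DE -cs_comm; move: (cs n) => x; ncalg.
Qed.

(** The logarithmic derivative of 1 + 1/(u - X) = (1 - (X-1)z)/(1 - Xz) has coefficients X^(n+1) -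
    (X-1)^(n+1). Elements g_n with these symbols exist by [cartan_power_sums], and k is the solution
    of k' = g k with k_0 = 1. The difference of the two sides of the intertwining relation satisfies
    the same equation with constant term 0. *)
Lemma cartan_kseries : exists k : pser A,
  [/\ k 0%N = 1, forall n, P (k n) &
      forall p, k * psC (F p) = Fs ((1 + psX * psgeo 'X) * psC p) * k].
Proof.
have : forall n, exists D, P D /\
    forall p, D * F p - F p * D = F (('X ^+ n.+1 - X1 1 ^+ n.+1) * p).
  by move=> n; have [D PD' DE] := cartan_power_sums ('X ^+ n.+1 - X1 1 ^+ n.+1); exists D.
move/choice => [g gP].
pose k : pser A := recfun 0 (fun n a => if n is m.+1 then
   (m.+1%:R)^-1 *: \sum_(i < m.+1) g i * a (m - i)%N else 1).
have kE n : k n = if n is m.+1 then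
   (m.+1%:R)^-1 *: \sum_(i < m.+1) g i * k (m - i)%N else 1.
  rewrite {1}/k recfunE // => -[|m] a b ab //; congr (_ *: _).
  by apply: eq_bigr => i _; rewrite ab // ltnS leq_subr.
have k0 : k 0%N = 1 by rewrite kE.
have dk : psderiv k = (g : pser A) * k.
  apply: funext => n; rewrite /psderiv kE psM -scaler_nat scalerA mulfV ?scale1r //.
  by rewrite pnatr_eq0.
exists k; split => // [n|p].
  elim/ltn_ind: n => -[|n] IH; rewrite kE //; apply/PZ/Psum => i.
  by apply: PM; [case: (gP i)|apply: IH; rewrite ltnS leq_subr].
pose ga := psgeo (X1 0); pose h := psC (X1 0) * ga - psC (X1 1) * psgeo (X1 1).
have X10 : X1 0 = 'X by rewrite /X1 subr0.
have gcomm Q : (g : pser A) * Fs Q = Fs Q * (g : pser A) + Fs (h * Q).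
  apply/eqP; rewrite -subr_eq0; apply/eqP.
  move: Q; apply: psmap_ext => [Q R|Q|q].
  - by rewrite !mulrDr !raddfD /= !mulrDr !mulrDl; ncring.
  - rewrite [h * _]mulrCA !psmapXM; ncringX.
  apply: funext => n; rewrite psmapC psB psD ps0 psCMr psCMl /psmap psCMr.
  have -> : h n = 'X ^+ n.+1 - X1 1 ^+ n.+1.
    by rewrite /h psB !psCMl -!exprS X10.
  by apply/eqP; rewrite opprD addrA subr_eq0; apply/eqP/(proj2 (gP n)).
have kapE : 1 + psX * psgeo 'X = bet 1 * ga.
  have -> : bet 1 = bet 0 + psX by rewrite /bet subr0 polyC1 rmorphB rmorph1; ring.
  by rewrite mulrDl bet_geo /ga X10.
rewrite kapE; apply/eqP; rewrite -subr_eq0; apply/eqP; apply: (@ps_ode_uniq _ _ g); last first.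
  by rewrite psB !psM0 k0 mul1r mulr1 /psmap psM0 psM0 /bet psB psXM subr0 mulr1 mul1r subrr.
rewrite raddfB /= !psderivM psderivC dk mulrBr mulr0 addr0 -psmap_deriv.
rewrite (mulrA (g : pser A) (Fs _)) gcomm.
have -> : psderiv (bet 1 * ga * psC p) = h * (bet 1 * ga * psC p).
  rewrite !psderivM deriv_bet deriv_geo psderivC mulr0 addr0 -/ga /h.
  transitivity ((bet 1 * psgeo (X1 1)) * (- psC (X1 1)) * ga * psC p + bet 1 * psC (X1 0) * ga *
    ga * psC p).
    by rewrite bet_geo; ring.
  by ring.
by rewrite mulrDl; ncring.
Qed.
End CartanCurrents.
Arguments cartan_series {K A} xi n : simpl never.

Lemma fd_dependent (K : fieldType) (V : vectType K) (x : nat -> V) :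
  exists2 p : {poly K}, p != 0 & plin x p = 0.
Proof.
pose n := \dim {:V}; pose X := [tuple x i | i < n.+1].
have : ~~ free X.
  by rewrite /free neq_ltn size_tuple ltnS dimvS ?subvf.
move/freeP => /existsNP[k] /not_implyP[kX /existsNP[i ki0]].
exists (\poly_(i < n.+1) k (inord i)).
  apply/eqP => /(congr1 (fun p : {poly K} => p`_i)).
  by rewrite coef_poly ltn_ord inord_val coef0.
rewrite (@plin_widen _ _ _ n.+1) ?size_poly // -[RHS]kX; apply: eq_bigr => j _.
by rewrite coef_poly ltn_ord inord_val -tnth_nth tnth_mktuple.
Qed.

Lemma poly_split (K : closedFieldType) (p : {poly K}) : p != 0 ->
  exists c rs, c != 0 /\ p = c *: \prod_(a <- rs) ('X - a%:P).
Proof.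
move=> p0; have [rs ->] := closed_field_poly_normal p.
by exists (lead_coef p), rs; rewrite lead_coef_eq0.
Qed.

(** * Finite-dimensional modules of the Yangian of sl_2 *)

Section Module.
Variables (K : numClosedFieldType) (A : algType K) (M : fd_module A).
Local Notation act := (fd_act M).
Implicit Types (a b : A) (v w : M).

Lemma actM a b v : act (a * b) v = act a (act b v).
Proof. by rewrite fd_actM comp_lfunE. Qed.
Lemma act1 v : act 1 v = v. Proof. by rewrite fd_act1 id_lfunE. Qed.
Lemma actD a b v : act (a + b) v = act a v + act b v.
Proof. by rewrite linearD add_lfunE. Qed.
Lemma actN a v : act (- a) v = - act a v.
Proof. by rewrite linearN opp_lfunE. Qed.
Lemma actB a b v : act (a - b) v = act a v - act b v.
Proof. by rewrite actD actN. Qed.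
Lemma actZ k a v : act (k *: a) v = k *: act a v.
Proof. by rewrite linearZ /= scale_lfunE. Qed.
Lemma act0 v : act 0 v = 0.
Proof. by rewrite linear0 zero_lfunE. Qed.
Lemma actMn a n v : act (a *+ n) v = act a v *+ n.
Proof. by rewrite -!scaler_nat actZ. Qed.
Lemma act_sum I (r : seq I) (P : pred I) (F : I -> A) v :
  act (\sum_(i <- r | P i) F i) v = \sum_(i <- r | P i) act (F i) v.
Proof. exact: (big_morph (fun a => act a v) (fun a b => actD a b v) (act0 v)). Qed.
Lemma act_eq a b v : a = b -> act a v = act b v.
Proof. by move->. Qed.
Lemma act_central k v : act k%:A v = k *: v.
Proof. by rewrite actZ act1. Qed.

Lemma act_poly a (p : {poly K}) v l : act a v = l *: v ->
  act (plin (GRing.exp a) p) v = p.[l] *: v.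
Proof.
move=> av; have avn n : act (a ^+ n) v = l ^+ n *: v.
  by elim: n => [|n IH]; rewrite ?expr0 ?act1 ?scale1r // exprS actM IH linearZ /= av scalerA
    exprSr.
rewrite /plin act_sum horner_coef scaler_suml; apply: eq_bigr => i _.
by rewrite actZ avn scalerA.
Qed.

Lemma act_annihilator (x : nat -> A) :
  exists2 p : {poly K}, p != 0 & act (plin x p) = 0.
Proof.
have [p p0 pE] := fd_dependent (fun n => act (x n)); exists p => //.
by rewrite -[RHS]pE /plin linear_sum; apply: eq_bigr => i _; rewrite linearZ.
Qed.

Lemma act_spectrum a :
  exists rs : seq K, forall l v, v != 0 -> act a v = l *: v -> l \in rs.
Proof.
have [p p0 pE] := act_annihilator (GRing.exp a).
have [c [rs [c0 pr]]] := poly_split p0; exists rs => l v v0 /(act_poly p) /eqP.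
rewrite pE zero_lfunE eq_sym scaler_eq0 (negPf v0) orbF pr hornerZ mulf_eq0 (negPf c0).
by rewrite -/(root _ l) root_prod_XsubC.
Qed.
End Module.

(** Together with [act_spectrum] this stops ladder arguments: an eigenvalue cannot be shifted by d
    indefinitely. *)
Lemma leave_seq (K : numDomainType) (rs : seq K) (l d : K) : d != 0 ->
  exists n0, forall n, (n0 <= n)%N -> l + d *+ n \notin rs.
Proof.
move=> d0; elim: rs => [|a rs [n0 IH]]; first by exists 0%N.
have [[n1 E]|nE] := pselect (exists n1, l + d *+ n1 = a).
  exists (maxn n0 n1.+1) => n; rewrite geq_max inE negb_or => /andP[/IH -> ltn].
  by rewrite -E (inj_eq (addrI l)) -!(mulr_natr d) (inj_eq (mulfI d0)) eqr_nat gtn_eqF.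
exists n0 => n len; rewrite inE negb_or IH // andbT; apply/eqP => E; apply: nE.
by exists n.
Qed.

(* With z = 1/u, the series of (u - a) / u. *)
Definition pslin (K : nzRingType) (a : K) : pser K := 1 - psX * psC a.

(* The series of f(u + 1/2) / f(u - 1/2), for f the quotient of the monic
   polynomials with roots [qs] and [rs]. *)
Definition shift_quotient (K : fieldType) (qs rs : seq K) (mu : pser K) :=
  mu * ((\prod_(a <- qs) pslin (a + 2^-1)) * \prod_(b <- rs) pslin (b - 2^-1)) =
  (\prod_(a <- qs) pslin (a - 2^-1)) * \prod_(b <- rs) pslin (b + 2^-1).

Section SL2.
Variables (K : numClosedFieldType) (A : algType K) (M : fd_module A).
Variables (e f h : A).
Hypothesis hf : h * f - f * h = - (f *+ 2).
Hypothesis ef : e * f - f * e = h.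
Local Notation act := (fd_act M).

Lemma sl2_string (l : K) (v : M) : act h v = l *: v -> act e v = 0 ->
  forall n, act h (act (f ^+ n) v) = (l - n.*2%:R) *: act (f ^+ n) v /\
    act e (act (f ^+ n.+1) v) = (n.+1%:R * (l - n%:R)) *: act (f ^+ n) v.
Proof.
move=> hv ev; have hfv n : act h (act (f ^+ n) v) = (l - n.*2%:R) *: act (f ^+ n) v.
  elim: n => [|n IH]; first by rewrite expr0 act1 subr0.
  have -> : act h (act (f ^+ n.+1) v) = act f (act h (act (f ^+ n) v)) - act (f ^+ n.+1) v *+ 2.
    rewrite -!actM -actMn -actB; apply: act_eq.
    move/eqP: hf; rewrite subr_eq => /eqP hfE; rewrite exprS mulrA hfE.
    ncring.
  rewrite IH linearZ /= -actM -exprS -scaler_nat -scalerBl; congr (_ *: _).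
  by rewrite doubleS -(addn2 n.*2) natrD; ring.
move=> n; split=> //; elim: n => [|n IH].
  rewrite expr1 expr0 act1 -actM; have /eqP := ef; rewrite subr_eq => /eqP ->.
  by rewrite actD actM ev linear0 addr0 hv subr0 mul1r.
have -> : act e (act (f ^+ n.+2) v) = act h (act (f ^+ n.+1) v) + act f (act e (act (f ^+ n.+1) v)).
  rewrite -!actM -actD; apply: act_eq; rewrite [f ^+ n.+2]exprS -ef; ncring.
rewrite IH hfv linearZ /= -actM -exprS -scalerDl; congr (_ *: _).
by rewrite -muln2 natrM [n.+2%:R]mulrS [n.+1%:R]mulrS; ring.
Qed.

Lemma sl2_highest_weight (l : K) (v : M) : v != 0 -> act h v = l *: v -> act e v = 0 ->
  exists m, [/\ l = m%:R, act (f ^+ m) v != 0 & act (f ^+ m.+1) v = 0].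
Proof.
move=> v0 hv ev; have str := sl2_string hv ev.
have [rs rsP] := act_spectrum M h.
have n20 : (-2 : K) != 0 by rewrite oppr_eq0 pnatr_eq0.
have [n0 n0P] := leave_seq rs l n20.
have ex : exists n, act (f ^+ n) v == 0.
  exists n0; apply: contraT => fv0; have := rsP _ _ fv0 (str n0).1.
  have -> : l - n0.*2%:R = l + -2 *+ n0 by rewrite -[-2 *+ n0]mulr_natr -mul2n natrM; ring.
  by rewrite (negPf (n0P _ (leqnn _))).
have [[|m] /eqP fm0 mmin] := ex_minnP ex; first by rewrite expr0 act1 in fm0;
  rewrite fm0 eqxx in v0.
have fm : act (f ^+ m) v != 0 by apply: contraT => /negPn /mmin; rewrite ltnn.
exists m; split => //; have := (str m).2; rewrite fm0 linear0 => /esym /eqP.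
by rewrite scaler_eq0 (negPf fm) orbF mulf_eq0 pnatr_eq0 /= subr_eq0 => /eqP.
Qed.
End SL2.

Section Currents.
Variables (K : numClosedFieldType) (A : algType K) (M : fd_module A).
Local Notation act := (fd_act M).

Lemma plin_shift (x : nat -> A) (D : A) : (forall r, D * x r - x r * D = x r.+1) ->
  forall p, D * plin x p - plin x p * D = plin x ('X * p).
Proof.
move=> Dx p; elim/(plin_ind (K := K)): p => [|a p q IHp IHq|r].
- by rewrite mulr0 !linear0; ncring.
- have -> : 'X * (a *: p + q) = a *: ('X * p) + 'X * q by rewrite mulrDr scalerAr.
  by rewrite !linearP /= -IHp -IHq; ncalg.
- by rewrite -exprS !plinXn.
Qed.

(** Dimension gives one polynomial w for which the operator x[w] vanishes; the bracket with D then
    gives x[Xw] = 0, so all multiples of w annihilate. *)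
Lemma current_annihilator (x : nat -> A) (D : A) :
  (forall r, D * x r - x r * D = x r.+1) ->
  exists rs : seq K, forall q v, act (plin x (q * \prod_(a <- rs) ('X - a%:P))) v = 0.
Proof.
move=> Dx; have [p p0 pE] := act_annihilator M x.
have [c [rs [c0 pr]]] := poly_split p0; exists rs => q.
set w := \prod_(a <- rs) _; have wE v : act (plin x w) v = 0.
  have := congr1 (fun g : 'End(M) => g v) pE; rewrite pr linearZ /= actZ zero_lfunE => /eqP.
  by rewrite scaler_eq0 (negPf c0) => /eqP.
elim/(plin_ind (K := K)): q => [v|a q r IHq IHr v|n].
- by rewrite mul0r linear0 act0.
- by rewrite mulrDl -scalerAl linearP /= actD actZ IHq IHr scaler0 addr0.
elim: n => [|n IH] v; first by rewrite expr0 mul1r.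
by rewrite exprS -mulrA -(plin_shift Dx) actB !actM !IH linear0 subrr.
Qed.

(* The last nonzero vector of the chain X[w_j] v, where w_j runs over the products
   of the first j factors of an annihilating polynomial. *)
Lemma current_eigenvector (x : nat -> A) (D : A) (v : M) :
  (forall r, D * x r - x r * D = x r.+1) -> (exists r, act (x r) v != 0) ->
  exists a p, act (plin x p) v != 0 /\
    act (plin x ('X * p)) v = a *: act (plin x p) v.
Proof.
move=> Dx [r xr]; have [rs rsv] := current_annihilator Dx.
have {rsv} := fun q => rsv q v.
have : exists p, act (plin x p) v != 0 by exists 'X^r; rewrite plinXn.
move=> nz; elim: rs => [|a rs IH] rsP.
  by case: nz => p; have := rsP p; rewrite big_nil mulr1 => ->; rewrite eqxx.
have [[q qP]|none] := pselect (exists q, act (plin x (q * \prod_(a <- rs) ('X - a%:P))) v != 0).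
  exists a, (q * \prod_(a <- rs) ('X - a%:P)); split => //.
  have := rsP q; rewrite big_cons mulrCA mulrBl mul_polyC linearB linearZ /= actB actZ.
  by move/eqP; rewrite subr_eq0 => /eqP.
by apply: IH => q; apply: contrapT => /eqP nq; apply: none; exists q.
Qed.
End Currents.

(** * Flags that triangularize k(u) *)

Section Flags.
Variables (K : numClosedFieldType) (A : algType K) (M : fd_module A).
Variables (f : nat -> A) (D : A) (k : pser A).
Local Notation act := (fd_act M).
Local Notation F := (plin f).
Hypothesis Df : forall p, D * F p - F p * D = F ('X * p).
Hypothesis kf : forall p, k * psC (F p) = psmap F ((1 + psX * psgeo 'X) * psC p) * k.

(* Subspaces triangularized by [D] and the coefficients of [k], the diagonal
   characters of [k] satisfying [C]. *)
Inductive flag (C : pser K -> Prop) : {vspace M} -> Prop :=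
| flag0 : flag C 0%VS
| flagS W v d kap : flag C W -> C kap -> act D v - d *: v \in W ->
    (forall n, act (k n) v - kap n *: v \in W) -> flag C (W + <[v]>)%VS.

Lemma flag_stable C W : flag C W -> forall w, w \in W ->
  act D w \in W /\ forall n, act (k n) w \in W.
Proof.
elim=> [w|{}W v d kap _ IH _ Dv kv w].
  by rewrite memv0 => /eqP ->; split=> [|n]; rewrite linear0 mem0v.
have step x a : act x v - a *: v \in W -> (forall w, w \in W -> act x w \in W) ->
    w \in (W + <[v]>)%VS -> act x w \in (W + <[v]>)%VS.
  move=> xv xW /memv_addP[w1 w1W [_ /vlineP[c ->] ->]]; rewrite linearD linearZ /=.
  rewrite -(subrK (a *: v) (act x v)) scalerDr addrA scalerA memv_add ?memvZ ?memv_line //.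
  by rewrite memvD ?memvZ // xW.
move=> wW; split=> [|n]; first by apply: step Dv _ wW => u /IH[].
by apply: step (kv n) _ wW => u /IH[_ /(_ n)].
Qed.

(** In the last layer where w is nonzero, w is a multiple of v modulo the preceding subspace, and
    there k acts by that layer's character. *)
Lemma flag_char C W w eps : flag C W -> w \in W -> w != 0 ->
  (forall n, act (k n) w = eps n *: w) -> C eps.
Proof.
move=> fW; elim: fW w => [w|{}W v d kap fW IH Ckap Dv kv w].
  by rewrite memv0 => /eqP ->; rewrite eqxx.
case/memv_addP=> w1 w1W [_ /vlineP[c ->] wE] w0 kw.
have [vW|vW] := boolP (c *: v \in W); first by apply: IH kw => //; rewrite wE memvD.
suff -> : eps = kap by [].
apply: funext => n; apply/eqP; rewrite -subr_eq0; apply: contraR vW => nz.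
suff : (eps n - kap n) *: (c *: v) \in W.
  by move/(memvZ (eps n - kap n)^-1); rewrite scalerK.
have := kw n; rewrite wE linearD linearZ /= scalerDr => E.
have -> : (eps n - kap n) *: (c *: v) =
   (act (k n) w1 - eps n *: w1) + c *: (act (k n) v - kap n *: v).
  rewrite scalerBr addrACA E addrACA subrr add0r scalerBl.
  by rewrite [c *: (_ *: _)]scalerA [c * _]mulrC -scalerA.
by rewrite memvD ?memvZ // memvB ?memvZ // (proj2 (flag_stable fW w1W)).
Qed.

Let sym : pser {poly K} := 1 + psX * psgeo 'X.

Let sym_eval a n : (1 + psX * psgeo a : pser K) n = (sym n).[a].
Proof.
rewrite /sym !psD !psXM !ps1; case: n => [|n]; first by rewrite !addr0 hornerE.
by rewrite !add0r hornerXn.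
Qed.

Let kf_coef n p : k n * F p = \sum_(i < n.+1) F (sym i * p) * k (n - i)%N.
Proof.
have /(congr1 (fun s => s n)) := kf p; rewrite psCMr => ->; rewrite psM.
by apply: eq_bigr => i _; rewrite /psmap psCMr.
Qed.

Section Extension.
Variables (C : pser K -> Prop) (W : {vspace M}) (v : M) (d : K) (kap : pser K).
Hypothesis C_step : forall kap a, C kap -> C (kap * (1 + psX * psgeo a)).
Hypotheses (Ckap : C kap) (Dv : act D v - d *: v \in W).
Hypothesis kv : forall n, act (k n) v - kap n *: v \in W.

(** Modulo U, the vector F[qZ]v depends on q only through q(a), so the single vector F[Z]v spans the
    new layer. Moving D and k past F[Z] adds a to the eigenvalue of D and evaluates the symbol of k
    at X = a. *)
Lemma flag_extend U a Z : flag C U -> (forall p w, w \in W -> act (F p) w \in U) ->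
  (forall q, act (F (q * (('X - a%:P) * Z))) v \in U) ->
  flag C (U + <[act (F Z) v]>)%VS /\
  forall q, act (F (q * Z)) v \in (U + <[act (F Z) v]>)%VS.
Proof.
move=> fU WU aU; set u := act (F Z) v.
have qZ q : act (F (q * Z)) v - q.[a] *: u \in U.
  have /factor_theorem[q1 qE] : root (q - q.[a]%:P) a.
    by rewrite rootE hornerD hornerN hornerC subrr.
  have := aU q1; rewrite mulrA -qE mulrBl mul_polyC linearB linearZ /= actB actZ.
  by [].
split; last first.
  by move=> q; rewrite -(subrK (q.[a] *: u) (act _ v)) memv_add ?memvZ ?memv_line.
apply: (@flagS _ _ _ (d + a) (kap * (1 + psX * psgeo a))) => //; first exact: C_step.
  have -> : act D u - (d + a) *: u =
      act (F Z) (act D v - d *: v) + (act (F ('X * Z)) v - 'X.[a] *: u).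
    have duE : act (F Z) (d *: v) = d *: u by rewrite linearZ.
    rewrite hornerX linearB /= duE -Df actB !actM -/u scalerDl.
    by rewrite addrACA; congr (_ + _); rewrite ?opprD // addrC subrK.
  by rewrite memvD ?qZ // WU.
move=> n; rewrite mulrC psM /u -actM kf_coef act_sum scaler_suml -sumrB; apply: memv_suml => i _.
rewrite sym_eval actM.
have -> : act (F (sym i * Z)) (act (k (n - i)%N) v) - ((sym i).[a] * kap (n - i)%N) *: act (F Z) v =
    act (F (sym i * Z)) (act (k (n - i)%N) v - kap (n - i)%N *: v) +
    kap (n - i)%N *: (act (F (sym i * Z)) v - (sym i).[a] *: u).
  have E : act (F (sym i * Z)) (kap (n - i)%N *: v) = kap (n - i)%N *: act (F (sym i * Z)) v.
    by rewrite linearZ.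
  by rewrite linearB /= E scalerBr addrA subrK scalerA [_ * (sym i).[a]]mulrC.
by rewrite memvD ?memvZ ?qZ // WU.
Qed.

(** Z goes from the annihilating product down to 1, losing one root at each use of [flag_extend]. *)
Lemma flag_extend_split U rs : flag C U -> (forall p w, w \in W -> act (F p) w \in U) ->
  (forall q, act (F (q * \prod_(a <- rs) ('X - a%:P))) v \in U) ->
  exists2 U', flag C U' & (U <= U')%VS /\ forall q, act (F q) v \in U'.
Proof.
elim: rs U => [|a rs IH] U fU WU rsU.
  by exists U => //; split=> // q; have := rsU q; rewrite big_nil mulr1.
have [|fU1 ZU1] := @flag_extend U a (\prod_(b <- rs) ('X - b%:P)) fU WU.
  by move=> q; have := rsU q; rewrite big_cons.
have sU := addvSl U <[act (F (\prod_(b <- rs) ('X - b%:P))) v]>%VS.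
have [p w wW|U' fU' [sU' vU']] := IH _ fU1 _ ZU1; first by apply: (subvP sU); apply: WU.
by exists U' => //; split => //; apply: subv_trans sU'.
Qed.
End Extension.

Lemma flag_current C W rs : (forall kap a, C kap -> C (kap * (1 + psX * psgeo a))) ->
  (forall q v, act (F (q * \prod_(a <- rs) ('X - a%:P))) v = 0) -> flag C W ->
  exists2 W', flag C W' & forall p w, w \in W -> act (F p) w \in W'.
Proof.
move=> C_step rsP; elim=> [|{}W v d kap fW [W1 fW1 WW1] Ckap Dv kv].
  by exists 0%VS => [|p w]; [exact: flag0|rewrite memv0 => /eqP ->; rewrite linear0 mem0v].
have [q|W' fW' [sW' vW']] := flag_extend_split C_step Ckap Dv kv fW1 WW1 (rs := rs).
  by rewrite rsP mem0v.
exists W' => // p w /memv_addP[w1 w1W [_ /vlineP[c ->] ->]].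
rewrite linearD linearZ memvD ?memvZ //=; apply: (subvP sW'); exact: WW1.
Qed.
End Flags.

(** * Eigenvalues of xi(u) for the Yangian of sl_2 *)

Section YangianSL2.
Variables (K : numClosedFieldType) (A : algType K) (M : fd_module A).
Variables (e f xi : nat -> A).
Hypothesis ef : forall r s, e r * f s - f s * e r = xi (r + s)%N.
Hypothesis xi0_e : forall r, xi 0%N * e r - e r * xi 0%N = e r *+ 2.
Hypothesis xi_e : forall r s, xi s.+1 * e r - e r * xi s.+1
  - (xi s * e r.+1 - e r.+1 * xi s) = xi s * e r + e r * xi s.
Hypothesis xi0_f : forall r, xi 0%N * f r - f r * xi 0%N = - (f r *+ 2).
Hypothesis xi_f : forall r s, xi s.+1 * f r - f r * xi s.+1
  - (xi s * f r.+1 - f r.+1 * xi s) = - (xi s * f r + f r * xi s).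
Hypothesis ff : forall r s, f r.+1 * f s - f s * f r.+1
  - (f r * f s.+1 - f s.+1 * f r) = - (f r * f s + f s * f r).
Local Notation act := (fd_act M).
Local Notation Xi := (cartan_series xi).

Definition cartan_eigen (mu : pser K) (v : M) : Prop :=
  v != 0 /\ forall n, act (Xi n) v = mu n *: v.

Lemma cartan_eigen0 mu v : cartan_eigen mu v -> mu 0%N = 1.
Proof.
case=> v0 /(_ 0%N) /esym/eqP; rewrite act1 -[X in _ == X]scale1r -subr_eq0 -scalerBl.
by rewrite scaler_eq0 (negPf v0) orbF subr_eq0 => /eqP.
Qed.

Let half_mul (x : A) : 2^-1 *: (x *+ 2) = x.
Proof. by rewrite -scaler_nat scalerA mulVf ?scale1r // pnatr_eq0. Qed.

(** Half the coefficient of u^-2 in log xi(u); its bracket shifts the index of e_r by one. *)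
Let D := 2^-1 *: (xi 1%N - 2^-1 *: (xi 0%N * xi 0%N)).

Let De r : D * e r - e r * D = e r.+1.
Proof.
have E : (xi 0%N * xi 0%N) * e r - e r * (xi 0%N * xi 0%N) =
    (xi 0%N * e r + e r * xi 0%N) *+ 2.
  transitivity (xi 0%N * (xi 0%N * e r - e r * xi 0%N) + (xi 0%N * e r - e r * xi 0%N) * xi 0%N).
    by ncring.
  by rewrite xi0_e; ncring.
rewrite /D -[RHS]half_mul -xi0_e -scalerAl -scalerAr -scalerBr; congr (_ *: _).
have /eqP := xi_e r 0; rewrite 2!subr_eq => /eqP xi1.
rewrite mulrBl mulrBr -scalerAl -scalerAr xi1.
move/eqP: E; rewrite subr_eq => /eqP ->; rewrite scalerDr half_mul; ncalg.
Qed.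

(** On the vector given by [current_eigenvector], X acts as the number a, so the symbol (u - X +
    1)/(u - X - 1) of xi(u) on the raising current is evaluated at X = a. *)
Lemma raise_eigen mu v : cartan_eigen mu v -> (exists r, act (e r) v != 0) ->
  exists a mu' v', [/\ cartan_eigen mu' v', mu' 1%N = mu 1%N + 2 &
    mu' * pslin (a + 1) = mu * pslin (a - 1)].
Proof.
move=> muv /(current_eigenvector De) [a [p [v'0 v'E]]]; have [v0 vE] := muv.
pose mu' := mu * pslin (a - 1) * psgeo (a + 1).
have geo : psgeo (a + 1) * pslin (a + 1) = 1 :> pser K.
  by rewrite mulrC mulrBl mul1r {1}psgeoE addrK.
have mu'E : mu' * pslin (a + 1) = mu * pslin (a - 1) by rewrite -mulrA geo mulr1.
have pslinE x b n : (x * pslin b) n.+1 = x n.+1 - b * x n :> K.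
  by rewrite mulrC mulrBl mul1r psB -mulrA psXM psCMl.
have pslin0 b : pslin b 0%N = 1 :> K by rewrite /pslin psB psXM ps1 subr0.
have mu'0 : mu' 0%N = 1.
  have := congr1 (fun x => x 0%N) mu'E; rewrite !psM0 !pslin0 !mulr1.
  by rewrite (cartan_eigen0 muv).
have mu'S n : mu' n.+1 = (a + 1) * mu' n + mu n.+1 - (a - 1) * mu n.
  have := congr1 (fun x => x n.+1) mu'E; rewrite !pslinE => /eqP.
  by rewrite subr_eq => /eqP ->; ring.
exists a, mu', (act (plin e p) v); split=> //; last first.
  by rewrite mu'S mu'0 (cartan_eigen0 muv); ring.
split=> // n; elim: n => [|n IH]; first by rewrite mu'0 act1 scale1r.
have XE q : Xi n.+1 * plin e q = plin e q * Xi n.+1 + Xi n * plin e ('X * q)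
   - plin e ('X * q) * Xi n + Xi n * plin e q + plin e q * Xi n.
  elim/(plin_ind (K := K)): q => [|c q1 q2 IH1 IH2|r].
  - by rewrite mulr0 linear0; ncring.
  - have -> : 'X * (c *: q1 + q2) = c *: ('X * q1) + 'X * q2 by rewrite mulrDr scalerAr.
    rewrite !linearP /= mulrDr -scalerAr IH1 IH2; ncalg.
  rewrite -exprS !plinXn; case: n {IH} => [|n].
    have /eqP := xi0_e r; rewrite subr_eq => /eqP ->; rewrite /cartan_series; ncring.
  have /eqP := xi_e r n; rewrite 2!subr_eq => /eqP.
  by rewrite /cartan_series => ->; ncring.
rewrite -actM XE !(actD, actN) !actM v'E !vE !linearZ /= IH v'E.
rewrite mu'S !scalerN !scalerA -!scaleNr -!scalerDl; congr (_ *: _); ring.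
Qed.

Local Notation Fs := (psmap (plin f)).
Let c0 := psC (f 0%N).
Let fz : pser A := Fs (psX * psgeo 'X).

Let fzE n : fz n = if n is r.+1 then f r else 0.
Proof. by rewrite /fz psmapXM psXM; case: n => // n; rewrite /psmap /= plinXn. Qed.

(** This is [f(u), f_0] = -f(u)^2 in coefficients. The bracket of case r with D0 gives the sum of
    [f_(r+1), f_0] and [f_r, f_1], and [ff] gives their difference; adding them yields twice case r
    + 1. *)
Let f_f0 (D0 : A) : (forall r, D0 * f r - f r * D0 = f r.+1) ->
  forall r, f r * f 0%N - f 0%N * f r = - \sum_(i < r) f i * f (r.-1 - i)%N.
Proof.
move=> D0f; elim=> [|r IH]; first by rewrite big_ord0; ncring.
have /eqP := congr1 (fun x => D0 * x - x * D0) IH.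
rewrite mulrN mulNr -opprD mulr_sumr mulr_suml -sumrB.
have -> : D0 * (f r * f 0%N - f 0%N * f r) - (f r * f 0%N - f 0%N * f r) * D0 =
   (D0 * f r - f r * D0) * f 0%N + f r * (D0 * f 0%N - f 0%N * D0) -
   (D0 * f 0%N - f 0%N * D0) * f r - f 0%N * (D0 * f r - f r * D0) by ncring.
rewrite !D0f.
have -> : \sum_(i < r) (D0 * (f i * f (r.-1 - i)%N) - f i * f (r.-1 - i)%N * D0) =
   \sum_(i < r) f i.+1 * f (r - i.+1)%N + \sum_(i < r) f i * f (r - i)%N.
  rewrite -big_split; apply: eq_bigr => i _ /=.
  have -> : D0 * (f i * f (r.-1 - i)%N) - f i * f (r.-1 - i)%N * D0 =
    (D0 * f i - f i * D0) * f (r.-1 - i)%N + f i * (D0 * f (r.-1 - i)%N - f (r.-1 - i)%N * D0).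
    by ncring.
  by rewrite !D0f; congr (_ * f _ + _ * f _); have := ltn_ord i; lia.
move=> /eqP E1; have E2 := ff r 0.
have E3 : \sum_(i < r.+1) f i * f (r - i)%N = f 0%N * f r + \sum_(i < r) f i.+1 * f (r - i.+1)%N.
  by rewrite big_ord_recl subn0.
have E4 : \sum_(i < r.+1) f i * f (r - i)%N = \sum_(i < r) f i * f (r - i)%N + f r * f 0%N.
  by rewrite big_ord_recr /= subnn.
rewrite -[LHS]half_mul -[RHS]half_mul; congr (_ *: _).
have -> : (- (\sum_(i < r.+1) f i * f (r - i)%N)) *+ 2 =
    - (f 0%N * f r + \sum_(i < r) f i.+1 * f (r - i.+1)%N)
    - (\sum_(i < r) f i * f (r - i)%N + f r * f 0%N) by rewrite -E3 -E4 mulr2n.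
transitivity ((f r.+1 * f 0%N + f r * f 1%N - f 1%N * f r - f 0%N * f r.+1) +
   (f r.+1 * f 0%N - f 0%N * f r.+1 - (f r * f 1%N - f 1%N * f r))); first by ncring.
rewrite E1 E2; ncring.
Qed.

Lemma highest_weight_shift_quotient mu v :
  cartan_eigen mu v -> (forall r, act (e r) v = 0) ->
  exists qs, shift_quotient qs [::] mu.
Proof.
move=> muv ev; have [v0 vE] := muv; have mu0 := cartan_eigen0 muv.
(* The closure property of [cartan_kseries] is instantiated by having v as an eigenvector, so D0 and
   all coefficients of k act on v by scalars. *)
pose P (a : A) := exists c : K, act a v = c *: v.
have P1 : P 1 by exists 1; rewrite act1 scale1r.
have PD a b : P a -> P b -> P (a + b).
  by move=> [ca aE] [cb bE]; exists (ca + cb); rewrite actD aE bE scalerDl.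
have PM a b : P a -> P b -> P (a * b).
  by move=> [ca aE] [cb bE]; exists (ca * cb); rewrite actM bE linearZ /= aE scalerA mulrC.
have PZ (c : K) a : P a -> P (c *: a).
  by move=> [ca aE]; exists (c * ca); rewrite actZ aE scalerA.
have Pxi s : P (xi s) by exists (mu s.+1); apply: (vE s.+1).
have [k [k0 Pk kF]] := cartan_kseries xi0_f xi_f P1 PD PM PZ Pxi.
have [D0 [d0 dE] D0F] := cartan_power_sums xi0_f xi_f P1 PD PM PZ Pxi 'X.
have D0f r : D0 * f r - f r * D0 = f r.+1 by have := D0F 'X^r; rewrite -exprS !plinXn.
have /choice[kap_ kapE] := Pk; pose kap : pser K := kap_; rewrite -/kap in kapE.
have kap0 : kap 0%N = 1.
  have /eqP := kapE 0%N; rewrite k0 act1 -[X in X == _]scale1r -subr_eq0 -scalerBl.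
  by rewrite scaler_eq0 (negPf v0) orbF subr_eq0 => /eqP.
have [m [mE fm0 fm1]] := sl2_highest_weight (xi0_f 0) (ef 0 0) v0 (vE 1%N) (ev 0%N).
case: m => [|m] in mE fm0 fm1 *.
  exists [::]; rewrite /shift_quotient !big_nil !mulr1; apply: funext => -[//|r].
  rewrite ps1; apply/eqP; have /eqP : mu r.+1 *: v = 0.
    rewrite -vE /cartan_series -[r]addn0 -ef actB !actM ev linear0 subr0.
    by rewrite expr1 in fm1; rewrite fm1 linear0.
  by rewrite scaler_eq0 (negPf v0) orbF.
have m0 : m.+1%:R != 0 :> K by rewrite pnatr_eq0.
(* The vector y is the combination of f_r v and f_0 v killed by e_0. It has weight m - 1, hence
   f_0^m kills it: at the bottom of the string every f_r is a multiple of f_0. *)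
have fr r : act (f 0%N ^+ m) (act (f r) v) = (mu r.+1 / m.+1%:R) *: act (f 0%N ^+ m.+1) v.
  pose y := act (f r) v - (mu r.+1 / m.+1%:R) *: act (f 0%N) v.
  have ey : act (e 0%N) y = 0.
    have efv s : act (e 0%N) (act (f s) v) = mu s.+1 *: v.
      rewrite -vE /cartan_series -[s]add0n -ef actB !actM ev linear0 subr0.
      by rewrite add0n.
    by rewrite linearB linearZ /= !efv mE scalerA divfK ?subrr.
  have hy : act (xi 0%N) y = (m.+1%:R - 2) *: y.
    have hfv s : act (xi 0%N) (act (f s) v) = (m.+1%:R - 2) *: act (f s) v.
      have /eqP := xi0_f s; rewrite subr_eq => /eqP E.
      rewrite -actM E actD actN actMn actM (vE 1%N) linearZ /= mE scalerBl addrC.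
      by rewrite -scaler_nat.
    by rewrite linearB linearZ /= !hfv scalerBr !scalerA mulrC.
  have fy : act (f 0%N ^+ m) y = 0.
    have [->|y0] := eqVneq y 0; first by rewrite linear0.
    have [m' [m'E _ fm']] := sl2_highest_weight (xi0_f 0) (ef 0 0) y0 hy ey.
    suff -> : m = m'.+1 by [].
    have /eqP : m.+1%:R = (m' + 2)%:R :> K by rewrite natrD -m'E subrK.
    by rewrite eqr_nat => /eqP; lia.
  move: fy => /eqP; rewrite linearB linearZ /= subr_eq0 => /eqP ->.
  by rewrite -actM -exprSr.
have fzc : fz * c0 = c0 * fz - fz * fz.
  apply: funext => n; rewrite psB psCMr psCMl psM !fzE; case: n => [|n].
    by rewrite big_ord1 /= !fzE; ncring.
  rewrite big_ord_recl !fzE mul0r add0r big_ord_recr /= subnn !fzE mulr0 addr0.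
  have /eqP := f_f0 D0f n; rewrite subr_eq addrC => /eqP ->; congr (_ - _).
  apply: eq_bigr => i _; rewrite !fzE subSS; congr (_ * _).
  by have := ltn_ord i; case: n i => // n i _; rewrite /= subSn // -ltnS.
have kc : k * c0 = (c0 + fz) * k.
  have := kF 'X^0; rewrite plinXn => ->; rewrite expr0 rmorph1 mulr1 raddfD /=.
  by rewrite /c0 -(plinXn f 0) expr0 -psmapC rmorph1.
(* The induction step uses f(u) f_0 + f(u)^2 = f_0 f(u), which is [fzc]. *)
have kcj j : k * c0 ^+ j.+1 = (c0 ^+ j.+1 + (c0 ^+ j * fz) *+ j.+1) * k.
  elim: j => [|j IH]; first by rewrite expr1 expr0 mul1r kc.
  rewrite exprSr mulrA IH -mulrA kc mulrA; congr (_ * _).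
  have -> : (c0 ^+ j.+1 + (c0 ^+ j * fz) *+ j.+1) * (c0 + fz) =
    c0 ^+ j.+1 * c0 + c0 ^+ j.+1 * fz + (c0 ^+ j * (fz * c0 + fz * fz)) *+ j.+1.
    by rewrite mulrDl mulrnAl !mulrDr !mulrA.
  by rewrite fzc subrK (mulrA (c0 ^+ j)) -(exprSr c0 j) [in RHS]mulrS addrA.
(* The factor m + 1 of [kcj] cancels the denominator in [fr], so the coefficients of mu appear
   exactly. *)
have low n : act (k n) (act (f 0%N ^+ m.+1) v) = (kap * mu) n *: act (f 0%N ^+ m.+1) v.
  have := congr1 (fun s => s n) (kcj m); rewrite /c0 -!rmorphXn psCMr -actM => ->.
  rewrite psM big_ord_recl subn0 mulrC psM big_ord_recl subn0 mu0 mul1r /=.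
  rewrite psD psMn !psCMl fzE mulr0 mul0rn addr0 actD actM kapE linearZ /= scalerDl; congr (_ + _).
  rewrite act_sum scaler_suml; apply: eq_bigr => i _.
  rewrite /bump leq0n add1n psD psMn !psCMl fzE psCE /= mulr0n add0r actM kapE linearZ /= actMn
    actM fr.
  by rewrite -scaler_nat !scalerA; congr (_ *: _); rewrite -mulrA [m.+1%:R * _]mulrC divfK // mulrC.
pose C kap' := exists rs, kap' = kap * \prod_(a <- rs) (1 + psX * psgeo a).
have C_step kap' a : C kap' -> C (kap' * (1 + psX * psgeo a)).
  by move=> [rs ->]; exists (a :: rs); rewrite big_cons mulrCA mulrC.
have [rs rsP] := current_annihilator M D0f.
have : exists2 W, flag D0 k C W & act (f 0%N ^+ m.+1) v \in W.
  elim: m.+1 => [|j [W fW jW]].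
    exists (0 + <[v]>)%VS; last by rewrite expr0 act1 add0v memv_line.
    apply: (@flagS _ _ _ _ _ _ _ _ d0 kap); first exact: flag0.
    - by exists [::]; rewrite big_nil mulr1.
    - by rewrite dE subrr mem0v.
    - by move=> n; rewrite kapE subrr mem0v.
  have [W' fW' WW'] := flag_current D0F kF C_step rsP fW.
  by exists W' => //; rewrite exprS actM; have := WW' 'X^0 _ jW; rewrite plinXn.
case=> W fW fmW; have [as_ E] := flag_char fW fmW fm0 low.
have {}E : mu = \prod_(a <- as_) (1 + psX * psgeo a).
  apply/eqP; rewrite -subr_eq0; apply/eqP/(psmulI kap0).
  by rewrite mulrC mulrBr E subrr.
exists [seq a - 2^-1 | a <- as_]; rewrite /shift_quotient !big_nil !mulr1 !big_map E -big_split.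
apply: eq_bigr => a _ /=; rewrite subrK.
have -> : a - 2^-1 - 2^-1 = a - 1 by rewrite -addrA -opprD -div1r -splitr.
have geo : pslin a * psgeo a = 1 by rewrite mulrBl mul1r {1}psgeoE addrK.
rewrite mulrDl mul1r -mulrA [psgeo a * _]mulrC geo mulr1.
by rewrite /pslin rmorphB rmorph1; ring.
Qed.

Theorem cartan_eigen_shift_quotient mu v : cartan_eigen mu v ->
  exists qs rs, shift_quotient qs rs mu.
Proof.
move=> muv; have [rs0 rsP] := act_spectrum M (xi 0%N).
have [n0] : exists n0, forall n, (n0 <= n)%N -> mu 1%N + 2 *+ n \notin rs0.
  by apply: leave_seq; rewrite pnatr_eq0.
elim: n0 mu v muv => [|n0 IH] mu v muv n0P.
  have [v0 vE] := muv; have := n0P 0%N isT; rewrite mulr0n addr0.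
  by rewrite (rsP _ _ v0 (vE 1%N)).
have [/existsNP hw|nhw] := pselect (~ forall r, act (e r) v = 0); last first.
  have [qs qsP] := highest_weight_shift_quotient muv (contrapT nhw).
  by exists qs, [::].
have [|a [mu' [v' [muv' mu1 muE]]]] := raise_eigen muv.
  by case: hw => r /eqP er; exists r.
have [|qs [rs E]] := IH mu' v' muv'.
  by move=> n len; rewrite mu1 -addrA -mulrS; apply: n0P.
(* Undoing a raising step multiplies by (u - a - 1)/(u - a + 1), the shift quotient of 1/((u - a +
   1/2)(u - a - 1/2)); the common factor u - a cancels. *)
exists qs, [:: a - 2^-1, a + 2^-1 & rs]; move: E; rewrite /shift_quotient !big_cons.
have -> : a - 2^-1 - 2^-1 = a - 1 by rewrite -addrA -opprD -div1r -splitr.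
have -> : a + 2^-1 + 2^-1 = a + 1 by rewrite -addrA -div1r -splitr.
rewrite subrK addrK; set Q1 := \prod_(_ <- qs) _; set Q2 := \prod_(_ <- qs) _.
set R1 := \prod_(_ <- rs) _; set R2 := \prod_(_ <- rs) _ => E.
transitivity (mu * pslin (a - 1) * (pslin a * (Q1 * R1))); first by ring.
rewrite -muE; transitivity ((mu' * (Q1 * R1)) * (pslin (a + 1) * pslin a)); first by ring.
by rewrite E; ring.
Qed.
End YangianSL2.

(** * Ring identities for the leading term of h_j(u) *)

Section DegreeZero.
Variables (R : nzRingType) (z q : R).
Hypotheses (zC : forall a, z * a = a * z) (qC : forall a, q * a = a * q).
Variables (e e1 a b f f1 g x0 E N M p : R).
Hypothesis r1 : E * f - f * E - (N - 1) = 0.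
Hypothesis r2 : z * (E * f1 - f1 * E) - (N - 1 - z * a) = 0.
Hypothesis r3 : e * p - p * e - (M - 1) = 0.
Hypothesis r4 : z * (e1 * p - p * e1) + (M - 1 + z * b) = 0.
Hypothesis r5 : a * p - p * a + q * p *+ 2 = 0.
Hypothesis r6 : z * (M * f1 - f1 * M) + (M * f - f * M) - q * z * (M * f + f * M) = 0.
Hypothesis rg : e * g - g * e - b = 0.
Hypothesis rx : x0 * f - f * x0 - a = 0.
Hypothesis rNM : N * M - M * N = 0.

Let central := conj zC (conj qC I).

(** In the application y = tau j, z = 1/u, q = c_(y,j)/2, E = x_j^+(u), N = xi_j(u), M = xi_y(-u), p
    = x_y^-(-u). The letters e, e1, g, b stand for x_(y,0)^+, x_(y,1)^+, x_(y,0)^-, xi_(y,0), and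
    x0, f, f1, a for x_(j,0)^+, x_(j,0)^-, x_(j,1)^-, xi_(j,0). The order M E gives the last term
    -qz(NM - 1), the order E M in [degree0_right] the opposite sign: this is the source of wp_j. *)
Lemma degree0_left :
  z * q * ((e * p + p * e) - (f * (M * E) + M * E * f))
  - z * (((e1 - e * a) * p - p * (e1 - e * a)) + (f1 * (M * E) - M * E * f1))
  + ((e * (p + z * g) - (p + z * g) * e) - (f * (M * E - z * x0) - (M * E - z * x0) * f))
  = (N * M - 1) *+ 2 - z * (a - b) *+ 2 - q * z * (N * M - 1).
Proof.
have /eqP := rNM; rewrite subr_eq0 => /eqP ->.
transitivity ((M * N - 1) *+ 2 - z * (a - b) *+ 2 - q * z * (M * N - 1)
  - (z * (e1 * p - p * e1) + (M - 1 + z * b))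
  + z * e * (a * p - p * a + q * p *+ 2)
  + z * (e * p - p * e - (M - 1)) * a
  + (z * (M * f1 - f1 * M) + (M * f - f * M) - q * z * (M * f + f * M)) * E
  + M * (z * (E * f1 - f1 * E) - (N - 1 - z * a))
  + (e * p - p * e - (M - 1)) + z * (e * g - g * e - b)
  + M * (E * f - f * E - (N - 1)) - z * (x0 * f - f * x0 - a)
  - q * z * (e * p - p * e - (M - 1)) - q * z * M * (E * f - f * E - (N - 1))).
  by ncring_mod [:: z; q] central.
by rewrite r1 r2 r3 r4 r5 r6 rg rx !(mulr0, mul0r, addr0, subr0).
Qed.

Lemma degree0_right :
  z * q * ((e * p + p * e) - (f * (E * M) + E * M * f))
  - z * (((e1 - a * e) * p - p * (e1 - a * e)) + (f1 * (E * M) - E * M * f1))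
  + ((e * (p + z * g) - (p + z * g) * e) - (f * (E * M - z * x0) - (E * M - z * x0) * f))
  = (N * M - 1) *+ 2 - z * (a - b) *+ 2 + q * z * (N * M - 1).
Proof.
transitivity ((N * M - 1) *+ 2 - z * (a - b) *+ 2 + q * z * (N * M - 1)
  - (z * (e1 * p - p * e1) + (M - 1 + z * b))
  + z * (a * p - p * a + q * p *+ 2) * e
  + z * a * (e * p - p * e - (M - 1))
  + E * (z * (M * f1 - f1 * M) + (M * f - f * M) - q * z * (M * f + f * M))
  + (z * (E * f1 - f1 * E) - (N - 1 - z * a)) * M
  + (e * p - p * e - (M - 1)) + z * (e * g - g * e - b)
  + (E * f - f * E - (N - 1)) * M - z * (x0 * f - f * x0 - a)
  + q * z * (e * p - p * e - (M - 1)) + q * z * (E * f - f * E - (N - 1)) * M).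
  by ncring_mod [:: z; q] central.
by rewrite r1 r2 r3 r4 r5 r6 rg rx !(mulr0, mul0r, addr0, subr0).
Qed.
End DegreeZero.

(** The case tau j = j, where q = 1. The correction is the mean of E M and M E, for which the two
    opposite terms in qz cancel; the identity is doubled to clear the 1/2. *)
Lemma degree0_self (R : nzRingType) (z : R) (zC : forall a, z * a = a * z)
    (e e1 a f f1 E N M p : R)
    (r1 : E * f - f * E - (N - 1) = 0)
    (r2 : z * (E * f1 - f1 * E) - (N - 1 - z * a) = 0)
    (r3 : e * p - p * e - (M - 1) = 0)
    (r4 : z * (e1 * p - p * e1) + (M - 1 + z * a) = 0)
    (r5 : a * p - p * a + p *+ 2 = 0)
    (r6 : z * (M * f1 - f1 * M) + (M * f - f * M) - z * (M * f + f * M) = 0)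
    (rNM : N * M - M * N = 0) :
  z * ((e * p + p * e) *+ 2 - (f * (E * M + M * E) + (E * M + M * E) * f))
  - z * ((e1 * p - p * e1) *+ 2 - ((e * a + a * e) * p - p * (e * a + a * e))
         + (f1 * (E * M + M * E) - (E * M + M * E) * f1))
  + ((e * (p + z * f) - (p + z * f) * e) *+ 2
     - (f * (E * M + M * E - z * e *+ 2) - (E * M + M * E - z * e *+ 2) * f))
  = (N * M - 1) *+ 4.
Proof.
transitivity ((N * M - 1) *+ 4
  - (z * (e1 * p - p * e1) + (M - 1 + z * a)) *+ 2
  + z * (e * (a * p - p * a + p *+ 2) + (e * p - p * e - (M - 1)) * a
         + a * (e * p - p * e - (M - 1)) + (a * p - p * a + p *+ 2) * e)
  + (z * (E * f1 - f1 * E) - (N - 1 - z * a)) * M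
  + E * (z * (M * f1 - f1 * M) + (M * f - f * M) - z * (M * f + f * M))
  + (z * (M * f1 - f1 * M) + (M * f - f * M) - z * (M * f + f * M)) * E
  + M * (z * (E * f1 - f1 * E) - (N - 1 - z * a))
  + (E * f - f * E - (N - 1)) * M + M * (E * f - f * E - (N - 1))
  + (e * p - p * e - (M - 1)) *+ 2
  + z * ((E * f - f * E - (N - 1)) * M - M * (E * f - f * E - (N - 1)))
  - (N * M - M * N) *+ 2 + z * (N * M - M * N)).
  by ncring_mod [:: z] (conj zC I).
by rewrite r1 r2 r3 r4 r5 r6 rNM !(mulr0, mul0r, addr0, subr0, mul0rn).
Qed.

(** * The grading by rho *)

Section Grading.
Variables (K : fieldType) (A : algType K) (rho : A).
Implicit Types (a b : A) (j k : int).

Definition homog k a : Prop := rho * a - a * rho = k%:~R *: a.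

Lemma homog0 k : homog k 0.
Proof. by rewrite /homog scaler0; ncring. Qed.
Lemma homogD k a b : homog k a -> homog k b -> homog k (a + b).
Proof. by rewrite /homog scalerDr => <- <-; ncring. Qed.
Lemma homogZ k s a : homog k a -> homog k (s *: a).
Proof. by rewrite /homog scalerA mulrC -scalerA => <-; ncalg. Qed.
Lemma homogN k a : homog k a -> homog k (- a).
Proof. by rewrite -scaleN1r; apply: homogZ. Qed.
Lemma homogM j k a b : homog j a -> homog k b -> homog (j + k) (a * b).
Proof.
rewrite /homog => Ea Eb; rewrite intrD scalerDl scalerAl scalerAr -Ea -Eb; ncring.
Qed.

(** The span of the homogeneous elements of degree at least k, as an inductive sum: closure under
    products and the effect on module vectors follow by induction on the summands. *)
Inductive ge_degree k : A -> Prop :=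
| ge_degree0 : ge_degree k 0
| ge_degreeS j a b : k <= j -> homog j a -> ge_degree k b -> ge_degree k (a + b).

Lemma ge_homog j k a : k <= j -> homog j a -> ge_degree k a.
Proof. by move=> kj ha; rewrite -(addr0 a); apply: ge_degreeS kj ha (ge_degree0 k). Qed.

Lemma ge_degreeD k a b : ge_degree k a -> ge_degree k b -> ge_degree k (a + b).
Proof.
elim=> [|j {}a a' kj ha _ IH] gb; first by rewrite add0r.
by rewrite -addrA; apply: ge_degreeS kj ha (IH gb).
Qed.
Lemma ge_degreeZ k s a : ge_degree k a -> ge_degree k (s *: a).
Proof.
elim=> [|j {}a b kj ha _ IH]; first by rewrite scaler0; apply: ge_degree0.
by rewrite scalerDr; apply: ge_degreeS kj _ IH; apply: homogZ.
Qed.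
Lemma ge_degreeN k a : ge_degree k a -> ge_degree k (- a).
Proof. by rewrite -scaleN1r; apply: ge_degreeZ. Qed.
Lemma ge_degreeB k a b : ge_degree k a -> ge_degree k b -> ge_degree k (a - b).
Proof. by move=> ga gb; apply: ge_degreeD ga (ge_degreeN gb). Qed.
Lemma ge_degreeW j k a : k <= j -> ge_degree j a -> ge_degree k a.
Proof.
move=> kj; elim=> [|i {}a b ji ha _ IH]; first exact: ge_degree0.
by apply: ge_degreeS (le_trans kj ji) ha IH.
Qed.
Lemma ge_degreeM j k a b : ge_degree j a -> ge_degree k b -> ge_degree (j + k) (a * b).
Proof.
move=> ga gb; elim: ga => [|i {}a a' ji ha _ IHa]; first by rewrite mul0r; apply: ge_degree0.
rewrite mulrDl; apply: ge_degreeD IHa.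
elim: gb => [|l {}b b' kl hb _ IHb]; first by rewrite mulr0; apply: ge_degree0.
by rewrite mulrDr; apply: ge_degreeS (lerD ji kl) (homogM ha hb) IHb.
Qed.
Lemma ge_degree_sum k I (r : seq I) (P : pred I) (F : I -> A) :
  (forall i, P i -> ge_degree k (F i)) -> ge_degree k (\sum_(i <- r | P i) F i).
Proof. by move=> hF; apply: big_ind => //; [exact: ge_degree0|exact: ge_degreeD]. Qed.

Lemma ge_degree_mul j k l a b : ge_degree j a -> ge_degree k b -> l <= j + k ->
  ge_degree l (a * b).
Proof. by move=> ga gb /ge_degreeW; apply; apply: ge_degreeM. Qed.
Lemma ge_degree_comm j k l a b : ge_degree j a -> ge_degree k b -> l <= j + k ->
  ge_degree l (a * b - b * a).
Proof.
move=> ga gb ljk; apply: ge_degreeB; first exact: ge_degree_mul ga gb ljk.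
by apply: ge_degree_mul gb ga _; rewrite addrC.
Qed.

Definition psge_degree k (s : pser A) : Prop := forall n, ge_degree k (s n).

Lemma psge_degreeD k s t : psge_degree k s -> psge_degree k t -> psge_degree k (s + t).
Proof. by move=> gs gt n; rewrite psD; apply: ge_degreeD. Qed.
Lemma psge_degreeN k s : psge_degree k s -> psge_degree k (- s).
Proof. by move=> gs n; rewrite psN; apply: ge_degreeN. Qed.
Lemma psge_degreeB k s t : psge_degree k s -> psge_degree k t -> psge_degree k (s - t).
Proof. by move=> gs gt; apply: psge_degreeD => //; apply: psge_degreeN. Qed.
Lemma psge_degreeX k s : psge_degree k s -> psge_degree k (psX * s).
Proof. by move=> gs [|n]; rewrite psXM //; apply: ge_degree0. Qed.
Lemma psge_degreeC k a : ge_degree k a -> psge_degree k (psC a).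
Proof. by move=> ga [|n] //; apply: ge_degree0. Qed.
Lemma psge_degreeM j k l s t : psge_degree j s -> psge_degree k t -> l <= j + k ->
  psge_degree l (s * t).
Proof.
move=> gs gt ljk n; rewrite psM; apply: ge_degree_sum => i _.
exact: ge_degree_mul (gs _) (gt _) ljk.
Qed.
End Grading.

Section PsFlip.
Variables (K : fieldType) (A : algType K).

(* The substitution u -> - u. *)
Definition psflip (a : pser A) : pser A := fun n => (-1) ^+ n *: a n.

Fact psflip_zmod : zmod_morphism psflip.
Proof. by move=> a b; apply: funext => n; rewrite /psflip !psB scalerBr. Qed.
HB.instance Definition _ := GRing.isZmodMorphism.Build (pser A) (pser A) psflip psflip_zmod.

Fact psflip_mul : monoid_morphism psflip.
Proof.
split=> [|a b]; apply: funext => n; rewrite /psflip.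
  by rewrite ps1; case: n => [|n] /=; rewrite ?expr0 ?scale1r ?scaler0.
rewrite !psM scaler_sumr; apply: eq_bigr => i _; rewrite -scalerAl -scalerAr scalerA.
by rewrite -exprD subnKC // -ltnS.
Qed.
HB.instance Definition _ :=
  GRing.isMonoidMorphism.Build (pser A) (pser A) psflip psflip_mul.
End PsFlip.

Lemma half_double (K : numFieldType) (V : lmodType K) (s : K) (v : V) :
  s *: v = ((s / 2) *: v) *+ 2.
Proof. by rewrite -scaler_nat scalerA mulrC divfK // pnatr_eq0. Qed.

Section YangianRepresentation.
Variables (K : numFieldType) (n : nat) (c : 'I_n -> 'I_n -> int) (A : algType K).
Variables (x : bool -> 'I_n -> nat -> A) (xi : 'I_n -> nat -> A).

Record yangian_rep : Prop := YangianRep {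
  yr_comm : forall i j r s, lie (xi i r) (xi j s) = 0;
  yr_weight : forall e i j s,
    lie (xi i 0%N) (x e j s) = (pm K e * (c i j)%:~R) *: x e j s;
  yr_ef : forall i j r s,
    lie (x false i r) (x true j s) = (i == j)%:R *: xi i (r + s)%N;
  yr_cartan : forall e i j r s,
    lie (xi i r.+1) (x e j s) - lie (xi i r) (x e j s.+1) =
    (pm K e * 2^-1 * (c i j)%:~R) *: anti (xi i r) (x e j s);
  yr_current : forall e i j r s,
    lie (x e i r.+1) (x e j s) - lie (x e i r) (x e j s.+1) =
    (pm K e * 2^-1 * (c i j)%:~R) *: anti (x e i r) (x e j s)
}.
Hypothesis rep : yangian_rep.

(* x_i^+(u), x_i^-(-u) and xi_i(-u), where x(u) = sum_r x_r u^(-r-1). *)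
Definition raising_series i : pser A := fun k => if k is r.+1 then x false i r else 0.
Definition lowering_flip i : pser A :=
  fun k => if k is r.+1 then (-1) ^+ r.+1 *: x true i r else 0.
Definition cartan_flip i : pser A := psflip (cartan_series (xi i)).
Local Notation E := raising_series.
Local Notation N i := (cartan_series (xi i)).
Local Notation Ph := lowering_flip.
Local Notation Mf := cartan_flip.
Local Notation z := (@psX A).
Local Notation C := (@psC A).
Local Notation q i j := (psC (((c i j)%:~R / 2)%:A : A)).

Let NS i k : N i k.+1 = xi i k. Proof. by []. Qed.
Let N0 i : N i 0%N = 1. Proof. by []. Qed.
Let MfS i k : Mf i k.+1 = (-1) ^+ k.+1 *: xi i k. Proof. by []. Qed.
Let Mf0 i : Mf i 0%N = 1. Proof. by rewrite /cartan_flip /psflip expr0 scale1r. Qed.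
Let ES i k : E i k.+1 = x false i k. Proof. by []. Qed.
Let PhS i k : Ph i k.+1 = (-1) ^+ k.+1 *: x true i k. Proof. by []. Qed.
Let E0 i : E i 0%N = 0. Proof. by []. Qed.
Let Ph0 i : Ph i 0%N = 0. Proof. by []. Qed.
Let ps1S k : (1 : pser A) k.+1 = 0. Proof. by []. Qed.
Let ps10 : (1 : pser A) 0%N = 1. Proof. by []. Qed.
Let psCS a k : psC a k.+1 = 0 :> A. Proof. by []. Qed.
Let psC0 a : psC a 0%N = a :> A. Proof. by []. Qed.
Let coefE := (psD, psN, psMn, ps10, ps1S, psC0, psCS, psXM, ps0, psCMr, psCMl, NS, N0, MfS, Mf0,
  ES, PhS, E0, Ph0).

Lemma ef_series i : E i * C (x true i 0) - C (x true i 0) * E i - (N i - 1) = 0.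
Proof.
apply: funext => -[|r]; rewrite !coefE; first by ncring.
have := yr_ef rep i i r 0; rewrite eqxx scale1r addn0 => <-; rewrite /lie; ncring.
Qed.

Lemma ef1_series i : z * (E i * C (x true i 1) - C (x true i 1) * E i)
  - (N i - 1 - z * C (xi i 0)) = 0.
Proof.
apply: funext => -[|[|r]]; rewrite !coefE; first by ncring.
  by ncring.
have := yr_ef rep i i r 1; rewrite eqxx scale1r addn1 => <-; rewrite /lie; ncring.
Qed.

Lemma e_lowering i : C (x false i 0) * Ph i - Ph i * C (x false i 0) - (Mf i - 1) = 0.
Proof.
apply: funext => -[|r]; rewrite !coefE; first by ncring.
have := yr_ef rep i i 0 r; rewrite eqxx scale1r add0n => <-; rewrite /lie; ncalg.
Qed.

Lemma e1_lowering i : z * (C (x false i 1) * Ph i - Ph i * C (x false i 1))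
  + (Mf i - 1 + z * C (xi i 0)) = 0.
Proof.
apply: funext => -[|[|r]]; rewrite !coefE; first by ncring.
  by rewrite expr1 scaleN1r; ncring.
have := yr_ef rep i i 1 r; rewrite eqxx scale1r add1n => <-; rewrite /lie.
by rewrite [(-1) ^+ r.+2]exprS mulN1r scaleNr; ncalg.
Qed.

Lemma cartan_lowering i j :
  C (xi i 0) * Ph j - Ph j * C (xi i 0) + q i j * Ph j *+ 2 = 0.
Proof.
apply: funext => -[|r]; rewrite !coefE; first by ncring.
have := yr_weight rep true i j r; rewrite /lie /pm expr1 mulN1r scaleNr (half_double _).
move/eqP; rewrite subr_eq => /eqP w; rewrite -!scalerAr -scalerAl w mulr_algl.
by set y := x true j r; rewrite -[RHS](scaler0 _ ((-1) ^+ r.+1)) -(subrr (y * xi i 0)); ncalg.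
Qed.

(* With M(u) = xi_i(-u): u [M(u), f_0] + [M(u), f_1] = (c_ij / 2) {M(u), f_0}. *)
Lemma cartan_flip_lowering i j :
  z * (Mf i * C (x true j 1) - C (x true j 1) * Mf i)
  + (Mf i * C (x true j 0) - C (x true j 0) * Mf i)
  - q i j * z * (Mf i * C (x true j 0) + C (x true j 0) * Mf i) = 0.
Proof.
rewrite -(mulrA (q i j)).
apply: funext => -[|[|r]]; rewrite !coefE.
- by ncring.
- have := yr_weight rep true i j 0; rewrite /lie /pm expr1 mulN1r scaleNr (half_double _).
  by move/eqP; rewrite subr_eq => /eqP w; rewrite ?expr1 !scaleN1r mulrN mulNr w; ncalg.
have := yr_cartan rep true i j r 0; rewrite /lie /anti /pm expr1 mulN1r mulNr scaleNr.
rewrite [2^-1 * _]mulrC => /eqP; rewrite 2!subr_eq => /eqP w.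
rewrite !(exprS _ r.+1) mulN1r !scaleNr -!scalerAl -!scalerAr mulNr mulrN opprK -scalerAl -scalerAr.
by rewrite w; ncalg.
Qed.

(** Adding z x_(j,0)^- to [Ph j] removes its u^-1 term, which is not of the form x_(j,r+1)^-. *)
Lemma lowering_lowering i j :
  z * (C (x true i 1) * Ph j - Ph j * C (x true i 1))
  + q i j * z * (C (x true i 0) * Ph j + Ph j * C (x true i 0))
  + (C (x true i 0) * (Ph j + z * C (x true j 0)) - (Ph j + z * C (x true j 0)) * C (x true i 0))
    = 0.
Proof.
rewrite -(mulrA (q i j)).
apply: funext => -[|[|r]]; rewrite !coefE.
- by ncring.
- by rewrite expr1 scaleN1r; ncring.
have := yr_current rep true i j 0 r; rewrite /lie /anti /pm expr1 mulN1r mulNr scaleNr.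
rewrite [2^-1 * _]mulrC => /eqP; rewrite 2!subr_eq => /eqP w.
rewrite !(exprS _ r.+1) mulN1r !scaleNr -!scalerAl -!scalerAr ?mulNr ?mulrN -?scalerAl -?scalerAr.
by rewrite w; ncalg.
Qed.

Lemma cartan_cartan_flip i j : N i * Mf j - Mf j * N i = 0.
Proof.
apply/eqP; rewrite subr_eq0; apply/eqP; apply: funext => k; rewrite !psM (reindex_inj
  rev_ord_inj) /=.
have com a b : N i a * Mf j b = Mf j b * N i a.
  case: a => [|a]; first by rewrite N0 mul1r mulr1.
  case: b => [|b]; first by rewrite Mf0 mul1r mulr1.
  rewrite NS MfS -scalerAl -scalerAr; congr (_ *: _); apply/eqP.
  by rewrite -subr_eq0; apply/eqP/(yr_comm rep).
by apply: eq_bigr => a _; rewrite subSS subKn ?com // -ltnS.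
Qed.

(** The coefficient of u^-2 in log xi_i(u). *)
Definition cartan_t i : A := xi i 1 - 2^-1 *: (xi i 0 * xi i 0).

Lemma cartan_tP e i j r : cartan_t i * x e j r - x e j r * cartan_t i =
  (pm K e * (c i j)%:~R) *: x e j r.+1.
Proof.
have := yr_weight rep e i j r.+1; have := yr_weight rep e i j r.
have := yr_cartan rep e i j 0 r; rewrite /lie /anti mulrAC.
move: (pm K e * _) => s /eqP; rewrite 2!subr_eq => /eqP w1.
move/eqP; rewrite subr_eq => /eqP w0 w0'; rewrite w0' in w1.
rewrite /cartan_t mulrBl mulrBr -scalerAl -scalerAr w1 -(mulrA (xi i 0)) w0.
rewrite mulrDr (mulrA (xi i 0) (x e j r)) -scalerAr w0 mulrDl -scalerAl.
have -> : s / 2 = 2^-1 * s by rewrite mulrC.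
rewrite -scalerA; ncalg.
Qed.
End YangianRepresentation.

(** * Leading terms of the generators of the twisted Yangian *)

Section CoidealCurrents.
Variables (K : numFieldType) (n : nat) (c : 'I_n -> 'I_n -> int) (A : algType K).
Variables (x : bool -> 'I_n -> nat -> A) (xi : 'I_n -> nat -> A).
Hypothesis rep : yangian_rep c x xi.
Hypotheses (cdiag : forall i, c i i = 2) (csym : forall i j, c i j = c j i).
Variable rho : A.
Hypotheses (rho_x : forall e i r, homog rho (if e then -1 else 1) (x e i r))
  (rho_xi : forall i r, homog rho 0 (xi i r)).

Local Notation E i := (raising_series x i).
Local Notation N i := (cartan_series (xi i)).
Local Notation Ph i := (lowering_flip x i).
Local Notation Mf i := (cartan_flip xi i).
Local Notation z := (@psX A).
Local Notation C := (@psC A).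
Local Notation ge := (ge_degree rho).
Local Notation psge := (psge_degree rho).

Let ge_x e i r : ge (if e then -1 else 1) (x e i r).
Proof. exact: ge_homog (rho_x e i r). Qed.
Let ge_xi i r : ge 0 (xi i r). Proof. exact: ge_homog (rho_xi i r). Qed.
Let ge_1 : ge 0 1.
Proof. by apply: (@ge_homog _ _ _ 0) => //; rewrite /homog scale0r; ncring. Qed.
Let ge_Ph i : psge (-1) (Ph i).
Proof. by move=> [|r]; [exact: ge_degree0|apply/ge_degreeZ/(ge_x true)]. Qed.
Let ge_E i : psge 1 (E i).
Proof. by move=> [|r]; [exact: ge_degree0|apply: (ge_x false)]. Qed.
Let ge_N i : psge 0 (N i).
Proof. by move=> [|r]; [exact: ge_1|apply: ge_xi]. Qed.
Let ge_Mf i : psge 0 (Mf i).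
Proof. by move=> r; apply/ge_degreeZ/ge_N. Qed.

Section Node.
Variables (k k' : 'I_n).
Let s : K := (c k k + c k' k)%:~R.
Hypothesis s0 : s != 0.
Definition theta : A := cartan_t xi k + cartan_t xi k'.

Let theta_E : z * (C theta * E k - E k * C theta) = C s%:A * (E k - z * C (x false k 0)).
Proof.
apply: funext => -[|[|r]]; rewrite !(psXM, psCMl, psB, psCMr, psN) /=.
- by rewrite subr0 mulr0.
- by ncring.
have := cartan_tP rep false k k r; have := cartan_tP rep false k' k r.
rewrite /pm expr0 !mul1r => w' w; rewrite subr0 mulr_algl /s intrD scalerDl -w -w'.
by rewrite /theta; ncring.
Qed.

Let theta_Ph r : theta * Ph k' r.+1 - Ph k' r.+1 * theta = s *: Ph k' r.+2.
Proof.
have := cartan_tP rep true k k' r; have := cartan_tP rep true k' k' r.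
rewrite /pm expr1 !mulN1r !scaleNr => w' w.
rewrite /lowering_flip -scalerAl -scalerAr -scalerBr (exprS _ r.+1) mulN1r scaleNr.
have -> : theta * x true k' r - x true k' r * theta =
  (cartan_t xi k * x true k' r - x true k' r * cartan_t xi k)
   + (cartan_t xi k' * x true k' r - x true k' r * cartan_t xi k').
  by rewrite /theta; ncring.
rewrite w w' -opprD -scalerDl -intrD scalerN !scalerN !scalerA [_ * (-1) ^+ _]mulrC.
by congr (- (_ * _%:~R *: _)); rewrite !cdiag [c k' k]csym addrC.
Qed.

Let xi_comm i j r t : xi i r * xi j t = xi j t * xi i r.
Proof. by apply/eqP; rewrite -subr_eq0; apply/eqP/(yr_comm rep). Qed.

Let theta_xi i r : theta * xi i r = xi i r * theta.
Proof.
have t_xi j : cartan_t xi j * xi i r = xi i r * cartan_t xi j.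
  rewrite /cartan_t mulrBl mulrBr -scalerAl -scalerAr (xi_comm j i); congr (_ - _ *: _).
  by rewrite -mulrA (xi_comm j i) mulrA (xi_comm j i) mulrA.
by rewrite /theta mulrDl mulrDr !t_xi.
Qed.

Let theta_Mf i : C theta * Mf i = Mf i * C theta.
Proof.
apply: funext => r; rewrite psCMl psCMr /cartan_flip /psflip -scalerAl -scalerAr; congr (_ *: _).
by case: r => [|r]; rewrite ?mulr1 ?mul1r // theta_xi.
Qed.

Let ge_theta : ge 0 theta.
Proof.
by apply: ge_degreeD; apply: ge_degreeB => //; apply/ge_degreeZ/(ge_degree_mul (ge_xi _ _) (ge_xi
  _ _)).
Qed.

Section Step.
Variables (b : nat -> A) (H G Rm : A) (Bp : pser A).
Hypotheses (b0 : b 0%N = x false k 0 - x true k' 0)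
  (b_rec : forall r, s *: b r.+1 = H * b r - b r * H) (HE : H = theta + s *: G + Rm)
  (geR : ge 2 Rm) (R_x : forall r, ge 2 (Rm * x true k' r - x true k' r * Rm))
  (geG : ge 2 G) (geBp : psge 1 Bp) (Bp1 : Bp 1%N = x false k 0).
Hypothesis Bp_step : forall r, s *: Bp r.+2 - (theta * Bp r.+1 - Bp r.+1 * theta) =
  s *: (G * Ph k' r.+1 - Ph k' r.+1 * G).

(** Compare degrees in s b_(r+1) = [H, b_r]. In degree -1, [theta] shifts the index of [Ph]; degree
    1 is [Bp_step], with a contribution of G acting on [Ph]. A remainder of degree 2 could also
    reach degree 1 by acting on [Ph], and [R_x] excludes this. *)
Lemma coideal_current_step r : ge 2 (b r - (Ph k' + Bp) r.+1).
Proof.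
elim: r => [|r IH].
  by rewrite psD Bp1 b0 /lowering_flip expr1 scaleN1r [- _ + _]addrC subrr; apply: ge_degree0.
rewrite -[X in ge 2 X]scale1r -(mulVf s0) -scalerA; apply: ge_degreeZ.
rewrite scalerBr b_rec psD scalerDr.
have -> : H * b r - b r * H - (s *: Ph k' r.+2 + s *: Bp r.+2) =
  (H * (b r - (Ph k' + Bp) r.+1) - (b r - (Ph k' + Bp) r.+1) * H)
  + (s *: (G * Bp r.+1 - Bp r.+1 * G) + (Rm * Ph k' r.+1 - Ph k' r.+1 * Rm)
     + (Rm * Bp r.+1 - Bp r.+1 * Rm)).
  move: (Bp_step r) (theta_Ph r) => /eqP; rewrite subr_eq => /eqP -> <-.
  by rewrite HE psD; ncalg.
have geH : ge 0 H.
  rewrite HE; apply: ge_degreeD; last exact: ge_degreeW geR.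
  by apply: ge_degreeD => //; apply/ge_degreeZ/(ge_degreeW _ geG).
apply: ge_degreeD; first by apply: ge_degree_comm geH IH _.
apply: ge_degreeD; last exact: ge_degree_comm geR (geBp _) _.
apply: ge_degreeD; first by apply/ge_degreeZ/(ge_degree_comm geG (geBp _)).
by rewrite -scalerAl -scalerAr -scalerBr; apply: ge_degreeZ.
Qed.
End Step.

Let theta_EM r : theta * (E k * Mf k') r.+1 - (E k * Mf k') r.+1 * theta =
  s *: ((E k * Mf k') r.+2 - x false k 0 * Mf k' r.+1).
Proof.
have := congr1 (fun t => (t * Mf k') r.+2) theta_E.
have -> : z * (C theta * E k - E k * C theta) * Mf k' =
   z * (C theta * (E k * Mf k') - E k * Mf k' * C theta).
  by rewrite -[E k * _ * C theta]mulrA -theta_Mf; ncring.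
rewrite psXM psB psCMl psCMr => ->; rewrite -mulrA psCMl mulr_algl mulrBl psB.
by rewrite -mulrA psXM psCMl.
Qed.

Let theta_ME r : theta * (Mf k' * E k) r.+1 - (Mf k' * E k) r.+1 * theta =
  s *: ((Mf k' * E k) r.+2 - Mf k' r.+1 * x false k 0).
Proof.
have := congr1 (fun t => (Mf k' * t) r.+2) theta_E.
have -> : Mf k' * (z * (C theta * E k - E k * C theta)) =
   z * (C theta * (Mf k' * E k) - Mf k' * E k * C theta).
  by rewrite (mulrA (C theta)) theta_Mf; ncringX.
have -> : Mf k' * (C s%:A * (E k - z * C (x false k 0))) =
   C s%:A * (Mf k' * E k - z * (Mf k' * C (x false k 0))).
  have sM : C s%:A * Mf k' = Mf k' * C s%:A.
    by apply: funext => j; rewrite psCMl psCMr in_alg_central.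
  rewrite mulrA -sM -mulrA; congr (_ * _); ncringX.
by rewrite psXM psB psCMl psCMr => ->; rewrite psCMl mulr_algl psB psXM psCMr.
Qed.

Let e_Ph r : x false k' 0 * Ph k' r.+1 - Ph k' r.+1 * x false k' 0 = Mf k' r.+1.
Proof.
have /(congr1 (fun t => t r.+1)) := e_lowering rep k'.
by rewrite !psB psCMl psCMr ps0 ps1 subr0 => /eqP; rewrite subr_eq0 => /eqP.
Qed.

Let e_Ph_neq r : k != k' -> x false k 0 * Ph k' r.+1 - Ph k' r.+1 * x false k 0 = 0.
Proof.
move=> nk; have := yr_ef rep k k' 0 r; rewrite (negPf nk) scale0r /lie => w.
by rewrite /lowering_flip -scalerAl -scalerAr -scalerBr w scaler0.
Qed.

(** [theta] shifts the index of M E up to the defect s M_(r+1) x_(k,0)^+. Now M_(r+1) is the bracket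
    of x_(k',0)^+ with [Ph], and x_(k,0)^+ commutes with [Ph k'], so the defect is s times the
    bracket of x_(k',0)^+ x_(k,0)^+ with [Ph]. The order of this product thus decides the order of M
    and E. *)
Lemma step_left r : k != k' ->
  s *: (Mf k' * E k) r.+2 - (theta * (Mf k' * E k) r.+1 - (Mf k' * E k) r.+1 * theta) =
  s *: (x false k' 0 * x false k 0 * Ph k' r.+1 - Ph k' r.+1 * (x false k' 0 * x false k 0)).
Proof.
move=> nk; rewrite theta_ME -scalerBr; congr (_ *: _); rewrite opprB addrC subrK -e_Ph.
have /eqP := e_Ph_neq r nk; rewrite subr_eq0 => /eqP w.
by rewrite -(mulrA _ _ (Ph _ _)) w; ncring.
Qed.

Lemma step_right r : k != k' ->
  s *: (E k * Mf k') r.+2 - (theta * (E k * Mf k') r.+1 - (E k * Mf k') r.+1 * theta) =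
  s *: (x false k 0 * x false k' 0 * Ph k' r.+1 - Ph k' r.+1 * (x false k 0 * x false k' 0)).
Proof.
move=> nk; rewrite theta_EM -scalerBr; congr (_ *: _); rewrite opprB addrC subrK -e_Ph.
have /eqP := e_Ph_neq r nk; rewrite subr_eq0 => /eqP w.
by rewrite (mulrA (Ph _ _)) -w; ncring.
Qed.

(** For k = k' the bracket of x^2/2 with [Ph] produces M on both sides of x, which forces the
    symmetrized product. *)
Lemma step_self r : k = k' ->
  s *: (2^-1 *: (E k * Mf k' + Mf k' * E k) r.+2)
  - (theta * (2^-1 *: (E k * Mf k' + Mf k' * E k) r.+1)
     - (2^-1 *: (E k * Mf k' + Mf k' * E k) r.+1) * theta) =
  s *: ((2^-1 *: (x false k 0 * x false k 0)) * Ph k' r.+1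
    - Ph k' r.+1 * (2^-1 *: (x false k 0 * x false k 0))).
Proof.
move=> kk; have := e_Ph r; move: (Ph k' r.+1) => P eP.
transitivity (2^-1 *: (s *: ((E k * Mf k') r.+2 + (Mf k' * E k) r.+2)
  - ((theta * (E k * Mf k') r.+1 - (E k * Mf k') r.+1 * theta)
     + (theta * (Mf k' * E k) r.+1 - (Mf k' * E k) r.+1 * theta)))).
  by rewrite !psD; ncalg.
by rewrite theta_EM theta_ME -eP -{}kk; ncalg.
Qed.
End Node.
End CoidealCurrents.

Section CoidealCartan.
Variables (K : numFieldType) (n : nat) (c : 'I_n -> 'I_n -> int) (A : algType K).
Variables (x : bool -> 'I_n -> nat -> A) (xi : 'I_n -> nat -> A).
Hypothesis rep : yangian_rep c x xi.
Hypotheses (cdiag : forall i, c i i = 2) (csym : forall i j, c i j = c j i).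
Variable rho : A.
Hypotheses (rho_x : forall e i r, homog rho (if e then -1 else 1) (x e i r))
  (rho_xi : forall i r, homog rho 0 (xi i r)).

Local Notation E i := (raising_series x i).
Local Notation N i := (cartan_series (xi i)).
Local Notation Ph i := (lowering_flip x i).
Local Notation Mf i := (cartan_flip xi i).
Local Notation z := (@psX A).
Local Notation C := (@psC A).
Local Notation ge := (ge_degree rho).
Local Notation psge := (psge_degree rho).
Local Notation q i j := (C ((c i j)%:~R / 2)%:A).

Let ge_x e i r : ge (if e then -1 else 1) (x e i r).
Proof. exact: ge_homog (rho_x e i r). Qed.
Let ge_xi i r : ge 0 (xi i r). Proof. exact: ge_homog (rho_xi i r). Qed.
Let ge_scal k : ge 0 k%:A.
Proof.
apply/ge_degreeZ/(@ge_homog _ _ _ 0) => //.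
by rewrite /homog scale0r; ncring.
Qed.
Let ge_Ph i : psge (-1) (Ph i).
Proof. by move=> [|r]; [exact: ge_degree0|apply/ge_degreeZ/(ge_x true)]. Qed.
Let ge_E i : psge 1 (E i).
Proof. by move=> [|r]; [exact: ge_degree0|apply: (ge_x false)]. Qed.
Let ge_N i : psge 0 (N i).
Proof. by move=> [|r]; [rewrite -[N i 0%N]scale1r; apply: ge_scal|apply: ge_xi]. Qed.
Let ge_Mf i : psge 0 (Mf i).
Proof. by move=> r; apply/ge_degreeZ/ge_N. Qed.

Variables j y : 'I_n.

Section Reduction.
Variables (bj by_ h : nat -> A) (Pj Py : pser A).
Hypotheses (bjE : forall r, ge 2 (bj r - (Ph y + Pj) r.+1))
  (byE : forall r, ge 2 (by_ r - (Ph j + Py) r.+1)).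
Hypotheses (gePj : psge 1 Pj) (gePy : psge 1 Py).
Hypothesis bb : forall s, 2 *: h s.+1 =
  ((c y j)%:~R / 2) *: (by_ 0%N * bj s + bj s * by_ 0%N)
  - (by_ 1%N * bj s - bj s * by_ 1%N) + (by_ 0%N * bj s.+1 - bj s.+1 * by_ 0%N).

Lemma coideal_cartan_reduce s : ge 1 (2 *: h s.+1
  - (z * q y j * ((C (Py 1%N) * Ph y + Ph y * C (Py 1%N))
                  - (C (x true j 0) * Pj + Pj * C (x true j 0)))
     - z * ((C (Py 2) * Ph y - Ph y * C (Py 2))
            + (C (x true j 1) * Pj - Pj * C (x true j 1)))
     + ((C (Py 1%N) * (Ph y + z * C (x true y 0)) - (Ph y + z * C (x true y 0)) * C (Py 1%N))
        - (C (x true j 0) * (Pj - z * C (Pj 1%N)) - (Pj - z * C (Pj 1%N)) * C (x true j 0)))) s.+2).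
Proof.
set S0 := (_ - _ + _ : pser A).
have zC := @psXC A; have qC a : q y j * a = a * q y j.
  by apply: funext => k; rewrite psCMl psCMr in_alg_central.
have central := conj zC (conj qC I).
pose Bj := Ph y + Pj; pose b0 := C (Py 1%N) - C (x true j 0); pose b1 := C (Py 2) + C (x true j 1).
(* The right-hand side of [bb] as one series. [Bj s.+1] approximates b_(j,s), and the factor z moves
   it to coefficient s + 2. The subtracted terms cancel the u^-1 coefficient of [Bj], as
   [lowering_lowering] requires, and do not affect coefficient s + 2. *)
pose S := z * q y j * (b0 * Bj + Bj * b0) - z * (b1 * Bj - Bj * b1)
  + (b0 * (Bj - z * (C (Pj 1%N) - C (x true y 0)))
     - (Bj - z * (C (Pj 1%N) - C (x true y 0))) * b0).
have geS : psge 1 (S - S0).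
  pose Sp := z * q y j * (C (Py 1%N) * Pj + Pj * C (Py 1%N)) - z * (C (Py 2) * Pj - Pj * C (Py 2))
    + (C (Py 1%N) * (Pj - z * C (Pj 1%N)) - (Pj - z * C (Pj 1%N)) * C (Py 1%N)).
  have -> : S - S0 = Sp -
    (z * (C (x true j 1) * Ph y - Ph y * C (x true j 1))
     + q y j * z * (C (x true j 0) * Ph y + Ph y * C (x true j 0))
     + (C (x true j 0) * (Ph y + z * C (x true y 0))
        - (Ph y + z * C (x true y 0)) * C (x true j 0))).
    by rewrite /S /S0 /Sp /b0 /b1 /Bj; ncring_mod [:: z; q y j] central.
  have := lowering_lowering rep j y; rewrite (csym j y) => ->; rewrite subr0.
  have geq : psge 0 (q y j) by apply/psge_degreeC/ge_scal.
  have geP i : psge 1 (C (Py i)) by apply: psge_degreeC.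
  have comm s1 s2 : psge 1 s1 -> psge 1 s2 -> psge 1 (s1 * s2 - s2 * s1).
    by move=> g1 g2; apply: psge_degreeB; [apply: psge_degreeM g1 g2 _|apply: psge_degreeM g2 g1 _].
  apply: psge_degreeD; first apply: psge_degreeB.
  - rewrite -mulrA; apply/psge_degreeX/(@psge_degreeM _ _ _ 0 1) => //.
    by apply: psge_degreeD; [apply: psge_degreeM (geP _) gePj _|apply: psge_degreeM gePj (geP _) _].
  - by apply/psge_degreeX/comm.
  by apply: comm => //; apply: psge_degreeB => //; apply/psge_degreeX/psge_degreeC.
rewrite -(subrK (S s.+2) (2 *: _)) -addrA; apply: ge_degreeD; last exact: (geS s.+2).
have b0E : b0 = C ((Ph j + Py) 1%N).
  by rewrite psD rmorphD /= /lowering_flip expr1 scaleN1r rmorphN addrC.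
have b1E : b1 = C ((Ph j + Py) 2).
  by rewrite psD rmorphD /= /lowering_flip expr2 mulrNN mulr1 scale1r addrC.
have Bj1 : C (Pj 1%N) - C (x true y 0) = C (Bj 1%N).
  by rewrite /Bj psD rmorphD /= /lowering_flip expr1 scaleN1r rmorphN addrC.
pose B0 := (Ph j + Py) 1%N; pose B1 := (Ph j + Py) 2.
have SE : S s.+2 = ((c y j)%:~R / 2) *: (B0 * Bj s.+1 + Bj s.+1 * B0)
    - (B1 * Bj s.+1 - Bj s.+1 * B1) + (B0 * Bj s.+2 - Bj s.+2 * B0).
  rewrite /S b0E b1E Bj1 -/B0 -/B1 -mulrA; move: Bj B0 B1 {S geS b0E b1E Bj1 b0 b1} => Bj B0 B1.
  by rewrite !(psD, psN, psXM, psCMl, psCMr) mulr_algl subr0.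
rewrite bb SE.
have dB i : ge (-1) ((Ph j + Py) i).
  by rewrite psD; apply: ge_degreeD (ge_Ph j i) (ge_degreeW _ (gePy i)).
have dBj i : ge (-1) (Bj i).
  by rewrite /Bj psD; apply: ge_degreeD (ge_Ph y i) (ge_degreeW _ (gePj i)).
have diff (u v u' v' : A) : ge 2 (u - u') -> ge 2 (v - v') -> ge (-1) u' -> ge (-1) v' ->
    ge 1 (u * v - u' * v').
  move=> gu gv gu' gv'.
  have -> : u * v - u' * v' = (u - u') * (v - v') + ((u - u') * v' + u' * (v - v')) by ncring.
  apply: ge_degreeD; first exact: ge_degree_mul gu gv _.
  by apply: ge_degreeD; [apply: ge_degree_mul gu gv' _|apply: ge_degree_mul gu' gv _].
have swap (a b d a' b' d' : A) k : ge 1 (a - a') -> ge 1 (b - b') -> ge 1 (d - d') ->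
    ge 1 (k *: a - b + d - (k *: a' - b' + d')).
  move=> ga gb gd; have -> : k *: a - b + d - (k *: a' - b' + d') = k *: (a - a') - (b - b') + (d
    - d').
    by ncalg.
  by apply: ge_degreeD => //; apply: ge_degreeB => //; apply: ge_degreeZ.
have com (u v u' v' : A) : ge 2 (u - u') -> ge 2 (v - v') -> ge (-1) u' -> ge (-1) v' ->
    ge 1 (u * v - v * u - (u' * v' - v' * u')).
  move=> gu gv gu' gv'; have -> : u * v - v * u - (u' * v' - v' * u') =
    (u * v - u' * v') - (v * u - v' * u') by ncring.
  by apply: ge_degreeB; apply: diff.
apply: swap; last first.
- by apply: com; [exact: byE|exact: bjE|exact: dB|exact: dBj].
- by apply: com; [exact: byE|exact: bjE|exact: dB|exact: dBj].
set u := by_ 0%N; set v := bj s; set u' := B0; set v' := Bj s.+1.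
have -> : u * v + v * u - (u' * v' + v' * u') = (u * v - u' * v') + (v * u - v' * u') by ncring.
apply: ge_degreeD; apply: diff; by [exact: byE|exact: bjE|exact: dB|exact: dBj].
Qed.
End Reduction.

(* (1 + w/u) xi_j(u) xi_y(-u). *)
Definition coideal_cartan_series (w : K) : pser A := (1 + z * C w%:A) * (N j * Mf y).

Let NM0 : (N j * Mf y) 0%N = 1.
Proof. by rewrite psM0 /cartan_flip /psflip expr0 scale1r mulr1. Qed.
Let NM1 : (N j * Mf y) 1%N = xi j 0 - xi y 0.
Proof.
rewrite psM !big_ord_recl big_ord0 addr0 /cartan_flip /psflip expr0 expr1 scale1r scaleN1r.
by rewrite mul1r mulr1 addrC.
Qed.

(** For t = -2w, half of S0 has the coefficients of (1 + wz) N M from u^-2 on, since the term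
    z(xi_(j,0) - xi_(y,0)) lives in u^-1. The coefficient of u^-1 is checked separately with
    [h0]. *)
Let finish (h : nat -> A) (S0 : pser A) (t w : K) :
  S0 = (N j * Mf y - 1) *+ 2 - z * (C (xi j 0) - C (xi y 0)) *+ 2
       - C t%:A * z * (N j * Mf y - 1) ->
  t = - (w *+ 2) -> h 0%N = xi j 0 - xi y 0 + w%:A ->
  (forall s, ge 1 (2 *: h s.+1 - S0 s.+2)) ->
  forall r, ge 1 (h r - coideal_cartan_series w r.+1).
Proof.
move=> S0E tE h0 geh [|r]; rewrite /coideal_cartan_series mulrDl mul1r psD -mulrA psXM psCMl.
  by rewrite h0 NM0 NM1 mulr1 subrr; apply: ge_degree0.
have -> : h r.+1 - ((N j * Mf y) r.+2 + w%:A * (N j * Mf y) r.+1) =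
    2^-1 *: (2 *: h r.+1 - S0 r.+2); last exact/ge_degreeZ.
rewrite S0E tE -[C _ * z * _]mulrA.
have p1 m : (1 : pser A) m.+1 = 0 by [].
have pC a m : psC a m.+1 = 0 :> A by [].
set NM := N j * Mf y; rewrite !(psD, psN, psXM, psCMl, psMn, p1, pC).
have two : 2 != 0 :> K by rewrite pnatr_eq0.
rewrite !subr0; apply: (scalerI two); rewrite [RHS]scalerA mulfV // scale1r.
by rewrite !scaler_nat !mulr_algl scaleNr -scalerMnl mul0rn subr0; ncring.
Qed.

Section Cases.
Variables (bj by_ h : nat -> A) (w : K).
Hypothesis bb : forall s, 2 *: h s.+1 =
  ((c y j)%:~R / 2) *: (by_ 0%N * bj s + bj s * by_ 0%N)
  - (by_ 1%N * bj s - bj s * by_ 1%N) + (by_ 0%N * bj s.+1 - bj s.+1 * by_ 0%N).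
Hypothesis h0 : h 0%N = xi j 0 - xi y 0 + w%:A.

Let geEM i k : psge 1 (E i * Mf k). Proof. exact: psge_degreeM (ge_E i) (ge_Mf k) _. Qed.
Let geME i k : psge 1 (Mf k * E i). Proof. exact: psge_degreeM (ge_Mf k) (ge_E i) _. Qed.

Let EM1 i k : (E i * Mf k) 1%N = x false i 0.
Proof.
rewrite psM !big_ord_recl big_ord0 addr0 mul0r add0r /cartan_flip /psflip.
by rewrite expr0 scale1r mulr1.
Qed.
Let ME1 i k : (Mf k * E i) 1%N = x false i 0.
Proof.
rewrite psM !big_ord_recl big_ord0 addr0 mulr0 addr0 /cartan_flip /psflip.
by rewrite expr0 scale1r mul1r.
Qed.
Let EM2 i k : (E i * Mf k) 2 = x false i 1 - x false i 0 * xi k 0.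
Proof.
rewrite psM !big_ord_recl big_ord0 addr0 mul0r add0r /cartan_flip /psflip.
by rewrite expr0 expr1 scale1r mulr1 scaleN1r mulrN addrC.
Qed.
Let ME2 i k : (Mf k * E i) 2 = x false i 1 - xi k 0 * x false i 0.
Proof.
rewrite psM !big_ord_recl big_ord0 addr0 mulr0 addr0 /cartan_flip /psflip.
by rewrite expr0 expr1 scale1r mul1r scaleN1r mulNr.
Qed.

Let qC a : q y j * a = a * q y j.
Proof. by apply: funext => k; rewrite psCMl psCMr in_alg_central. Qed.

Let e_g : C (x false y 0) * C (x true y 0) - C (x true y 0) * C (x false y 0) - C (xi y 0) = 0.
Proof.
have := yr_ef rep y y 0 0; rewrite eqxx scale1r /lie addn0 => <-.
by rewrite rmorphB !rmorphM subrr.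
Qed.
Let x_f : C (x false j 0) * C (x true j 0) - C (x true j 0) * C (x false j 0) - C (xi j 0) = 0.
Proof.
have := yr_ef rep j j 0 0; rewrite eqxx scale1r /lie addn0 => <-.
by rewrite rmorphB !rmorphM subrr.
Qed.

(** The corrections at j and at y have opposite orders, M E and E M; only the order at j enters the
    sign of w. *)
Lemma coideal_cartan_left : w = - (c y j)%:~R / 4 ->
  (forall r, ge 2 (bj r - (Ph y + Mf y * E j) r.+1)) ->
  (forall r, ge 2 (by_ r - (Ph j + E y * Mf j) r.+1)) ->
  forall r, ge 1 (h r - coideal_cartan_series w r.+1).
Proof.
move=> wE bjE byE; have red := coideal_cartan_reduce bjE byE (geME j y) (geEM y j) bb.
apply: (finish (t := (c y j)%:~R / 2) _ _ h0) red; last first.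
  by rewrite wE; field.
rewrite ME1 EM1 EM2 rmorphB rmorphM /=.
apply: (degree0_left (@psXC A) qC); last exact: cartan_cartan_flip rep j y.
- exact: ef_series rep j.
- exact: ef1_series rep j.
- exact: e_lowering rep y.
- exact: e1_lowering rep y.
- have := cartan_lowering rep j y; rewrite csym; exact.
- exact: cartan_flip_lowering rep y j.
- exact: e_g.
- exact: x_f.
Qed.

Lemma coideal_cartan_right : w = (c y j)%:~R / 4 ->
  (forall r, ge 2 (bj r - (Ph y + E j * Mf y) r.+1)) ->
  (forall r, ge 2 (by_ r - (Ph j + Mf j * E y) r.+1)) ->
  forall r, ge 1 (h r - coideal_cartan_series w r.+1).
Proof.
move=> wE bjE byE; have red := coideal_cartan_reduce bjE byE (geEM j y) (geME y j) bb.
apply: (finish (t := - ((c y j)%:~R / 2)) _ _ h0) red; last first.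
  by rewrite wE; field.
rewrite ME2 ME1 EM1 rmorphB rmorphM /= scaleNr rmorphN !mulNr opprK.
apply: (degree0_right (@psXC A) qC).
- exact: ef_series rep j.
- exact: ef1_series rep j.
- exact: e_lowering rep y.
- exact: e1_lowering rep y.
- have := cartan_lowering rep j y; rewrite csym; exact.
- exact: cartan_flip_lowering rep y j.
- exact: e_g.
- exact: x_f.
Qed.

Lemma coideal_cartan_self : j = y -> w = 0 ->
  (forall r, ge 2 (bj r - (Ph y + C (2^-1)%:A * (E j * Mf y + Mf y * E j)) r.+1)) ->
  (forall r, ge 2 (by_ r - (Ph j + C (2^-1)%:A * (E y * Mf j + Mf j * E y)) r.+1)) ->
  forall r, ge 1 (h r - coideal_cartan_series w r.+1).
Proof.
move=> jy w0 bjE byE.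
have geP i k : psge 1 (C (2^-1)%:A * (E i * Mf k + Mf k * E i)).
  apply: (@psge_degreeM _ _ _ 0 1) => //; first exact/psge_degreeC/ge_scal.
  exact: psge_degreeD.
have red := coideal_cartan_reduce bjE byE (geP j y) (geP y j) bb.
apply: (finish (t := 0) _ _ h0) red; last by rewrite w0 mul0rn oppr0.
have hC a : C (2^-1)%:A * a = a * C (2^-1)%:A :> pser A.
  by apply: funext => k; rewrite psCMl psCMr in_alg_central.
have h2 : C (2^-1)%:A *+ 2 = 1 :> pser A.
  by rewrite -rmorphMn /= -scaler_nat scalerA mulfV ?pnatr_eq0 // scale1r rmorph1.
rewrite -jy cdiag divff ?pnatr_eq0 // !scale1r scale0r rmorph1 rmorph0 mulr1 mul0r mul0r !subr0.
set W := E j * Mf j + Mf j * E j; set V := C (x false j 0) * C (xi j 0) + C (xi j 0) * C (x false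
  j 0).
have P1 : C ((C (2^-1)%:A * W) 1%N) = C (x false j 0).
  by rewrite psCMl /W psD EM1 ME1 -mulr2n mulr_algl -scaler_nat scalerA mulVf ?pnatr_eq0 ?scale1r.
have P2 : C ((C (2^-1)%:A * W) 2) = C (x false j 1) - C (2^-1)%:A * V.
  rewrite psCMl /W /V psD EM2 ME2 rmorphM rmorphD !rmorphB /= !rmorphM /= -[X in _ = X - _]mul1r
    -h2.
  by ncring_mod [:: C (2^-1)%:A : pser A] (conj hC I).
have dbl (u v : pser A) : u *+ 2 = v *+ 2 -> u = v.
  by move=> uv; rewrite -[u]mul1r -[v]mul1r -h2 !mulrnAl -!mulrnAr uv.
have r5 := cartan_lowering rep j j; have r6 := cartan_flip_lowering rep j j.
rewrite cdiag divff ?pnatr_eq0 // scale1r rmorph1 !mul1r in r5 r6.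
have := degree0_self (@psXC A) (ef_series rep j) (ef1_series rep j)
  (e_lowering rep j) (e1_lowering rep j) r5 r6 (cartan_cartan_flip rep j j).
have WE : W = (C (2^-1)%:A * W) *+ 2 by rewrite -mulrnAl h2 mul1r.
have VE : V = (C (2^-1)%:A * V) *+ 2 by rewrite -mulrnAl h2 mul1r.
rewrite -/W -/V {1 2 3 4 5 6}WE VE P1 P2.
move: (C (2^-1)%:A * W) (C (2^-1)%:A * V) => hW hV E0.
apply: dbl; rewrite subrr mulr0 mul0rn subr0 -mulrnA -[RHS]E0; ncringX.
Qed.
End Cases.
End CoidealCartan.

(** * Lowest components of l-weight vectors *)

Section LowestComponent.
Variables (K : numClosedFieldType) (A : algType K) (M : fd_module A) (rho : A).
Local Notation act := (fd_act M).
Local Notation ev := (horner_alg rho).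
Local Notation ge := (ge_degree rho).

Lemma plin_horner_alg (a : A) (p : {poly K}) : plin (GRing.exp a) p = horner_alg a p.
Proof.
elim/(plin_ind (K := K)): p => [|k p q IHp IHq|r].
- by rewrite linear0 rmorph0.
- by rewrite linearP /= IHp IHq linearP /= mulr_algl.
- by rewrite plinXn rmorphXn /= horner_algX.
Qed.

Let act_evM p q v : act (ev (p * q)) v = act (ev p) (act (ev q) v).
Proof. by rewrite rmorphM actM. Qed.

Let ev_comm (k : int) a p : homog rho k a ->
  ev p * a = a * ev (p \Po ('X + (k%:~R)%:P)).
Proof.
move=> ha; have ra : rho * a = a * (rho + k%:~R%:A).
  by move/eqP: ha; rewrite subr_eq => /eqP ->; ncalg.
elim/poly_ind: p => [|p c IH]; first by rewrite comp_poly0 !rmorph0 mul0r mulr0.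
rewrite comp_polyD comp_polyM comp_polyX comp_polyC !rmorphD !rmorphM /= rmorphD /=.
by rewrite !horner_algX !horner_algC mulrDl mulrDr -mulrA ra mulrA IH; ncalg.
Qed.

(** The vectors without component for the generalized rho-eigenvalues l, l - 1, l - 2, ... They are
    stable under degree at least 0, and elements of degree at least 1 send the generalized
    eigenspace of l into them. *)
Let Gset (l : K) (v : M) :=
  exists2 r : {poly K}, (forall k : nat, r.[l - k%:R] != 0) & act (ev r) v = 0.

Let GsetD l v w : Gset l v -> Gset l w -> Gset l (v + w).
Proof.
move=> [r rl rv] [r' r'l r'w]; exists (r * r') => [k|]; first by rewrite hornerM mulf_neq0.
rewrite linearD /= [X in _ + X](_ : _ = 0) ?addr0; last by rewrite act_evM r'w linear0.
by rewrite (mulrC r r') act_evM rv linear0.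
Qed.

Let GsetN l v : Gset l v -> Gset l (- v).
Proof. by move=> [r rl rv]; exists r => //; rewrite linearN /= rv oppr0. Qed.

Let Gset0 l : Gset l 0.
Proof. by exists 1 => [k|]; rewrite ?hornerE ?oner_eq0 // linear0. Qed.

Let Gset_ge l a v : ge 0 a -> Gset l v -> Gset l (act a v).
Proof.
elim=> [|j {}a b j0 ha _ IH] Gv; first by rewrite act0; apply: Gset0.
rewrite actD; apply: GsetD (IH Gv); case: Gv => r rl rv.
case: j j0 ha => // j _ ha; exists (r \Po ('X - j%:R%:P)) => [k|].
  by rewrite horner_comp !hornerE -addrA -opprD -natrD.
rewrite -actM (ev_comm _ ha) -comp_polyA comp_polyB comp_polyX comp_polyC.
by rewrite addrK comp_polyXr actM rv linear0.
Qed.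

Let Gset_gt l a v e : ge 1 a -> act (ev (('X - l%:P) ^+ e)) v = 0 -> Gset l (act a v).
Proof.
elim=> [|j {}a b j1 ha _ IH] v0; first by rewrite act0; apply: Gset0.
rewrite actD; apply: GsetD (IH v0); case: j j1 ha => // j j1 ha.
exists (('X - (l + j%:R)%:P) ^+ e) => [k|].
  rewrite !hornerE expf_neq0 // opprD addrACA subrr add0r -opprD oppr_eq0 -natrD pnatr_eq0.
  by case: j j1 {ha} => // j _; rewrite addnS.
rewrite -actM (ev_comm _ ha) rmorphXn /= comp_polyB comp_polyX comp_polyC rmorphD /=.
by rewrite opprD addrACA subrr addr0 actM v0 linear0.
Qed.

Let Gset_disjoint l e v : Gset l v -> act (ev (('X - l%:P) ^+ e)) v = 0 -> v = 0.
Proof.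
move=> [r rl rv] ve; have := rl 0%N; rewrite subr0 => rl0.
have cop : coprimep (('X - l%:P) ^+ e) r.
  by rewrite coprimep_expl // coprimep_sym coprimep_XsubC /root.
have [[u1 u2] /= u12] := Bezout_eq1_coprimepP _ _ cop.
by rewrite -[v]act1 -(rmorph1 ev) -u12 rmorphD actD !act_evM ve rv !linear0 addr0.
Qed.

Section LowestPart.
Variables (T : Type) (H H0 : T -> A) (lam : T -> K).
Hypotheses (H0_deg : forall t, homog rho 0 (H0 t)) (H_deg : forall t, ge 1 (H t - H0 t)).

(** Let w be the component of v for a lowest eigenvalue l of rho, and v' = v - w. A power of H - lam
    killing v differs from the same power of H0 - lam in degree at least 1 only, so the latter sends
    w into [Gset l]. As that power has degree 0, it also keeps w in the generalized eigenspace of l,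
    which meets [Gset l] in 0. *)
Lemma lowest_component (v : M) : v != 0 ->
  (forall t, exists p, act ((H t - (lam t)%:A) ^+ p) v = 0) ->
  exists2 w, w != 0 & forall t, exists p, act ((H0 t - (lam t)%:A) ^+ p) w = 0.
Proof.
move=> v0 Hv.
(* Minimal size of p ensures w != 0 below: otherwise the smaller cofactor q would kill v. *)
have : exists n, `[< exists2 p : {poly K}, p != 0 & size p = n /\ act (ev p) v = 0 >].
  have [p p0 pE] := act_annihilator M (GRing.exp rho).
  by exists (size p); apply/asboolP; exists p => //; rewrite -plin_horner_alg pE zero_lfunE.
case/ex_minnP => n /asboolP[p p0 [pn pv]] nmin.
have [c [rs [c0 prs]]] := poly_split p0.
have root_p a : root p a = (a \in rs).
  by rewrite prs rootZ // root_prod_XsubC.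
have [l0 l0P] : exists l0, l0 \in rs.
  case: rs prs root_p => [|a rs] prs _; last by exists a; rewrite mem_head.
  move: pv; rewrite prs big_nil alg_polyC horner_algC act_central => /eqP.
  by rewrite scaler_eq0 (negPf c0) (negPf v0).
have N10 : (-1 : K) != 0 by rewrite oppr_eq0 oner_eq0.
have [n0 n0P] := leave_seq rs l0 N10.
(* Going down from l0 by integers as far as roots of p occur gives an l below which no l - k is a
   root. *)
have [|i lt_i|k kP kmax] := @ex_maxnP (fun k => l0 - k%:R \in rs) n0.
- by exists 0%N; rewrite subr0.
- by rewrite leqNgt; apply/negP => /ltnW /n0P; rewrite mulNrn lt_i.
pose l := l0 - k%:R; have lmin (k' : nat) : (0 < k')%N -> l - k'%:R \notin rs.
  move=> k'0; apply/negP; rewrite /l -addrA -opprD -natrD => /kmax.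
  by rewrite -[X in (_ <= X)%N]addn0 leq_add2l leqNgt k'0.
have [m [q]] := multiplicity_XsubC p l; rewrite p0 /= => ql pq.
have m0 : (0 < m)%N.
  by case: m pq => // pq; move: ql; rewrite -[q]mulr1 -(expr0 ('X - l%:P)) -pq root_p kP.
have q0 : q != 0 by apply: contraNneq ql => ->; rewrite root0.
have qmin (k' : nat) : q.[l - k'%:R] != 0.
  case: k' => [|k']; first by rewrite subr0.
  have := lmin k'.+1 isT; rewrite -root_p pq rootM negb_or => /andP[].
  by rewrite /root.
have cop : coprimep (('X - l%:P) ^+ m) q.
  by rewrite coprimep_expl // coprimep_sym coprimep_XsubC.
have [[u1 u2] /= u12] := Bezout_eq1_coprimepP _ _ cop.
pose w := act (ev (u2 * q)) v; pose v' := act (ev (u1 * ('X - l%:P) ^+ m)) v.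
have vE : v = w + v' by rewrite /w /v' -actD -rmorphD addrC u12 rmorph1 act1.
have wl : act (ev (('X - l%:P) ^+ m)) w = 0.
  by rewrite -act_evM mulrCA [_ * q]mulrC -pq act_evM pv linear0.
have v'G : Gset l v'.
  by exists q => //; rewrite -act_evM mulrCA -pq act_evM pv linear0.
have w0 : w != 0.
  apply/eqP => w0; have /nmin : `[< exists2 r : {poly K}, r != 0 & size r = size q /\ act (ev r)
    v = 0 >].
    apply/asboolP; exists q => //; split => //.
    by rewrite vE w0 add0r -act_evM mulrCA -pq act_evM pv linear0.
  rewrite -pn pq size_Mmonic ?monic_exp ?monicXsubC // size_exp_XsubC.
  by rewrite addnS /= -[X in (_ <= X)%N]addn0 leq_add2l leqNgt m0.
exists w => // t; have [P HP] := Hv t; exists P.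
pose h := H t - (lam t)%:A; pose h0 := H0 t - (lam t)%:A.
have h0_deg j : homog rho 0 (h0 ^+ j).
  have h1 : homog rho 0 1 by rewrite /homog scale0r; ncring.
  elim: j => [|j IH]; first by rewrite expr0.
  rewrite exprS -(addr0 0); apply: homogM => //; apply: homogD => //.
  by apply: homogN; apply: homogZ.
have h_deg j : ge 1 (h ^+ j - h0 ^+ j).
  have hh : ge 1 (h - h0).
    by rewrite /h /h0 opprB addrA subrK.
  elim: j => [|j IH]; first by rewrite !expr0 subrr; apply: ge_degree0.
  have -> : h ^+ j.+1 - h0 ^+ j.+1 = (h - h0) * (h ^+ j - h0 ^+ j) +
     ((h - h0) * h0 ^+ j + h0 * (h ^+ j - h0 ^+ j)) by rewrite !exprS; ncring.
  apply: ge_degreeD; first exact: ge_degree_mul hh IH _.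
  apply: ge_degreeD; first exact: ge_degree_mul hh (ge_homog (lexx 0) (h0_deg j)) _.
  have h01 : ge 0 h0 by have := ge_homog (lexx 0) (h0_deg 1%N); rewrite expr1.
  exact: ge_degree_mul h01 IH _.
apply: (@Gset_disjoint l m); last first.
  by rewrite -actM (ev_comm _ (h0_deg P)) addr0 comp_polyXr actM wl linear0.
have -> : act (h0 ^+ P) w = - (act (h ^+ P - h0 ^+ P) w + act (h ^+ P) v').
  rewrite actB addrAC -linearD /= -vE [X in X - _]HP sub0r opprK //.
apply/GsetN/GsetD; first exact: Gset_gt (h_deg P) wl.
apply: Gset_ge v'G; rewrite -(subrK (h0 ^+ P) (h ^+ P)); apply: ge_degreeD.
  exact: ge_degreeW (h_deg P).
exact: ge_homog (lexx 0) (h0_deg P).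
Qed.
End LowestPart.
End LowestComponent.

Section CommonEigenvector.
Variables (K : numClosedFieldType) (A : algType K) (M : fd_module A).
Local Notation act := (fd_act M).
Variables (T : Type) (X : T -> A) (Q : M -> Prop).
Hypothesis XC : forall s t, X s * X t = X t * X s.
Hypotheses (QD : forall v w, Q v -> Q w -> Q (v + w)) (QZ : forall c v, Q v -> Q (c *: v))
  (QX : forall t v, Q v -> Q (act (X t) v)).

Let eigenvector_in (U : {vspace M}) t v :
  (forall u, u \in U -> act (X t) u \in U) -> v != 0 -> v \in U -> Q v ->
  exists a w, [/\ w != 0, w \in U, Q w & act (X t) w = a *: w].
Proof.
move=> XU v0 vU Qv; have [p p0 pE] := act_annihilator M (GRing.exp (X t)).
have [c [rs [c0 prs]]] := poly_split p0.
have : act (horner_alg (X t) (\prod_(a <- rs) ('X - a%:P))) v = 0.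
  have /eqP : act (plin (GRing.exp (X t)) p) v = 0 by rewrite pE zero_lfunE.
  rewrite plin_horner_alg prs -mul_polyC rmorphM /= horner_algC actM act_central scaler_eq0.
  by rewrite (negPf c0) => /eqP.
elim: rs v v0 vU Qv {p p0 pE prs c c0} => [|a rs IH] v v0 vU Qv.
  by rewrite big_nil rmorph1 act1 => v00; rewrite v00 eqxx in v0.
have Xa : act (horner_alg (X t) ('X - a%:P)) v = act (X t) v - a *: v.
  by rewrite rmorphB /= horner_algX horner_algC actB act_central.
have [E|nz] := eqVneq (act (X t) v - a *: v) 0.
  by move=> _; exists a, v; split=> //; apply/eqP; rewrite -subr_eq0 E.
rewrite big_cons mulrC rmorphM actM Xa; apply: IH => //.
  by rewrite memvB ?memvZ ?XU.
by rewrite -scaleNr; apply: QD; [apply: QX|apply: QZ].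
Qed.

(** The family may be infinite, so the induction is on the dimension of an invariant subspace U. If
    some X_t is not scalar on U, one of its eigenspaces in U is smaller, contains a nonzero vector
    of Q, and is invariant by commutativity. *)
Lemma common_eigenvector v : v != 0 -> Q v ->
  exists w, [/\ w != 0, Q w & forall t, exists a, act (X t) w = a *: w].
Proof.
suff gen d (U : {vspace M}) : (\dim U <= d)%N ->
    (forall t u, u \in U -> act (X t) u \in U) ->
    forall v, v != 0 -> v \in U -> Q v ->
    exists w, [/\ w != 0, Q w & forall t, exists a, act (X t) w = a *: w].
  by move=> v0 Qv; apply: (gen _ fullv (leqnn _)) Qv => // *; apply: memvf.
elim: d U => [|d IH] U dimU XU {}v v0 vU Qv.
  by move: dimU vU; rewrite leqn0 dimv_eq0 => /eqP ->; rewrite memv0 (negPf v0).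
have [sc|/existsNP[t nsc]] := pselect (forall t, exists a, forall u, u \in U -> act (X t) u = a
  *: u).
  by exists v; split=> // t; have [a aE] := sc t; exists a; apply: aE.
have [a [w [w0 wU Qw wE]]] := eigenvector_in (XU t) v0 vU Qv.
pose U' := (U :&: lker (act (X t - a%:A)))%VS.
have U'P u : (u \in U') = (u \in U) && (act (X t) u == a *: u).
  by rewrite memv_cap memv_ker actB act_central subr_eq0.
apply: (IH U') w0 _ Qw => [|s u|]; last by rewrite U'P wU wE eqxx.
  rewrite -ltnS (leq_trans _ dimU) // ltnNge; apply/negP => dimle.
  case: nsc; exists a => u uU.
  have /eqP U'U : U' == U by rewrite eqEdim capvSl.
  by move: uU; rewrite -U'U U'P => /andP[_ /eqP].
rewrite !U'P => /andP[uU /eqP uE]; rewrite XU //=.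
by rewrite -actM XC actM uE linearZ.
Qed.
End CommonEigenvector.

Definition psneg (R : nzRingType) (a : pser R) : pser R := fun n => (-1) ^+ n * a n.

(** * From generalized eigenvectors of the products to eigenvalues of xi(u) *)

Section TriangularCartan.
Variables (K : numClosedFieldType) (n : nat) (c : 'I_n -> 'I_n -> int) (A : algType K).
Variables (x : bool -> 'I_n -> nat -> A) (xi : 'I_n -> nat -> A).
Hypothesis rep : yangian_rep c x xi.
Hypothesis cdiag : forall i, c i i = 2.
Variables (rho : A) (M : fd_module A).
Hypothesis rho_xi : forall i r, homog rho 0 (xi i r).
Local Notation act := (fd_act M).
Local Notation N i := (cartan_series (xi i)).

Lemma yangian_rep_shift_quotient i mu (v : M) : cartan_eigen (xi i) mu v ->
  exists qs rs, shift_quotient qs rs mu.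
Proof.
have scal2 e (s : A) : (pm K e * (2%:Z)%:~R) *: s = (-1) ^+ e *: (s *+ 2).
  by rewrite -scalerA -[(2%:Z)%:~R]/(2%:R) scaler_nat.
have scal1 e (s : A) : (pm K e * 2^-1 * (2%:Z)%:~R) *: s = (-1) ^+ e *: s.
  by rewrite -[(2%:Z)%:~R]/(2%:R) divfK // pnatr_eq0.
apply: (@cartan_eigen_shift_quotient _ _ _ (x false i) (x true i)).
- by move=> r s; have := yr_ef rep i i r s; rewrite eqxx scale1r.
- by move=> r; have := yr_weight rep false i i r; rewrite cdiag scal2 expr0 scale1r.
- by move=> r s; have := yr_cartan rep false i i s r; rewrite cdiag scal1 expr0 scale1r.
- by move=> r; have := yr_weight rep true i i r; rewrite cdiag scal2 expr1 scaleN1r.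
- by move=> r s; have := yr_cartan rep true i i s r; rewrite cdiag scal1 expr1 scaleN1r.
- by move=> r s; have := yr_current rep true i i r s; rewrite cdiag scal1 expr1 scaleN1r.
Qed.

Variables (tau : 'I_n -> 'I_n) (w : 'I_n -> K) (h : 'I_n -> nat -> A).
Let H0 (t : 'I_n * nat) : A := coideal_cartan_series xi t.1 (tau t.1) (w t.1) t.2.+1.
Hypothesis hE : forall j r, ge_degree rho 1 (h j r - H0 (j, r)).

Let xiC i j r s : xi i r * xi j s = xi j s * xi i r.
Proof. by apply/eqP; rewrite -subr_eq0; apply/eqP/(yr_comm rep). Qed.

Let H0_ind (P : A -> Prop) : P 0 -> P 1 -> (forall a b, P a -> P b -> P (a + b)) ->
  (forall a b, P a -> P b -> P (a * b)) -> (forall k a, P a -> P (k *: a)) ->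
  (forall i r, P (xi i r)) -> forall t, P (H0 t).
Proof.
move=> P0 P1 PD PM PZ Pxi [j r]; rewrite /H0 /coideal_cartan_series /=.
have PN i k : P (N i k) by case: k => [|k]; [exact: P1|exact: Pxi].
have PNM k : P ((N j * cartan_flip xi (tau j)) k).
  by rewrite psM; apply: big_ind => // i _; apply: PM => //; apply: PZ.
by rewrite mulrDl mul1r psD -mulrA psXM psCMl mulr_algl; apply: PD => //; apply: PZ.
Qed.

Let H0_xi t i r : H0 t * xi i r = xi i r * H0 t.
Proof.
apply: (H0_ind (P := fun a => a * xi i r = xi i r * a)) => [||a b aE bE|a b aE bE|k a aE|j s].
- by rewrite mul0r mulr0.
- by rewrite mul1r mulr1.
- by rewrite mulrDl mulrDr aE bE.
- by rewrite -mulrA bE !mulrA aE.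
- by rewrite -scalerAl -scalerAr aE.
- exact: xiC.
Qed.

(** The xi_(i,r) commute with the leading terms H0 and so preserve their generalized eigenspace,
    where a common eigenvector u is found. On u each H0 is a scalar, and nilpotency of H0 - lam
    makes this scalar lam. *)
Lemma triangular_cartan_eigenvalues (lam : 'I_n -> nat -> K) (v : M) : v != 0 ->
  (forall j r, exists p, act ((h j r - (lam j r)%:A) ^+ p) v = 0) ->
  exists mu : 'I_n -> pser K,
    (forall i, exists qs rs, shift_quotient qs rs (mu i)) /\
    forall j, (ilseries (lam j) : pser K) =
      (1 + psX * psC (w j)) * (mu j * psneg (mu (tau j))).
Proof.
move=> v0 Hv; pose lam' t := lam t.1 t.2.
have H0_deg t : homog rho 0 (H0 t).
  apply: (H0_ind (P := homog rho 0)) => [||||k a|//].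
  - exact: homog0.
  - by rewrite /homog scale0r; ncring.
  - exact: homogD.
  - by move=> a b ha hb; rewrite -(addr0 0); apply: homogM.
  - exact: homogZ.
have [v1 v10 v1P] := @lowest_component K A M rho _ (fun t => h t.1 t.2) H0 lam' H0_deg
  (fun t => let: (j, r) := t in hE j r) v v0 (fun t => Hv t.1 t.2).
pose Q (u : M) := forall t, exists p, act ((H0 t - (lam' t)%:A) ^+ p) u = 0.
have QD u1 u2 : Q u1 -> Q u2 -> Q (u1 + u2).
  move=> Q1 Q2 t; have [p1 E1] := Q1 t; have [p2 E2] := Q2 t; exists (p1 + p2)%N.
  by rewrite linearD /= {1}addnC !exprD !actM E1 E2 !linear0 addr0.
have QZ k u : Q u -> Q (k *: u).
  by move=> Qu t; have [p E] := Qu t; exists p; rewrite linearZ /= E scaler0.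
have QX t u : Q u -> Q (act (xi t.1 t.2) u).
  move=> Qu s; have [p E] := Qu s; exists p; rewrite -actM.
  suff -> : (H0 s - (lam' s)%:A) ^+ p * xi t.1 t.2 = xi t.1 t.2 * (H0 s - (lam' s)%:A) ^+ p.
    by rewrite actM E linear0.
  elim: (p) => [|k IH]; first by rewrite expr0 mul1r mulr1.
  rewrite exprS -mulrA IH mulrA mulrBl H0_xi in_alg_central -mulrBr mulrA //.
have [u [u0 Qu uE]] := common_eigenvector (fun s t : 'I_n * nat => xiC s.1 t.1 s.2 t.2) QD QZ QX
  v10 v1P.
have /choice[ev evE] := uE.
pose mu i : pser K := fun k => if k is r.+1 then ev (i, r) else 1.
have Nu i k : act (N i k) u = mu i k *: u.
  by case: k => [|r]; [rewrite act1 scale1r | apply: (evE (i, r))].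
exists mu; split => [i|j].
  by apply: (@yangian_rep_shift_quotient i _ u).
have NMu k : act ((N j * cartan_flip xi (tau j)) k) u = (mu j * psneg (mu (tau j))) k *: u.
  rewrite !psM act_sum scaler_suml; apply: eq_bigr => i _.
  by rewrite actM actZ Nu linearZ /= linearZ /= Nu !scalerA mulrC.
have munm : (mu j * psneg (mu (tau j))) 0%N = 1 by rewrite psM0 /psneg expr0 !mulr1.
apply: funext => -[|r].
  by rewrite psM0 munm mulr1 psD psXM addr0.
rewrite mulrDl mul1r psD -mulrA psXM psCMl.
set b := (_ + _ : K); have H0u : act (H0 (j, r)) u = b *: u.
  rewrite /H0 /coideal_cartan_series mulrDl mul1r psD -mulrA psXM psCMl mulr_algl.
  by rewrite actD actZ !NMu scalerA -scalerDl.
have [p] := Qu (j, r); have -> q : act ((H0 (j, r) - (lam' (j, r))%:A) ^+ q) u = (b - lam j r) ^+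
  q *: u.
  elim: q => [|q IH]; first by rewrite !expr0 act1 scale1r.
  by rewrite exprS actM IH linearZ /= actB act_central H0u -scalerBl scalerA -exprSr.
move/eqP; rewrite scaler_eq0 (negPf u0) orbF expf_eq0 => /andP[_].
by rewrite subr_eq0 => /eqP ->.
Qed.
End TriangularCartan.

(** * Diagram involutions *)

Section Diagrams.
Implicit Type t : ade.

Lemma cartan_diag t i : cartan t i i = 2.
Proof. by rewrite /cartan eqxx. Qed.

Lemma cartan_sym t i j : cartan t i j = cartan t j i.
Proof. by rewrite /cartan eq_sym orbC. Qed.

Definition adjacent t (i j : 'I_(rank t)) : bool :=
  (i != j) && (ade_edge t i j || ade_edge t j i).

Lemma cartan_adjacent t i j : (cartan t i j == -1) = adjacent i j.
Proof. by rewrite /cartan /adjacent; case: (i == j) => //=; case: (_ || _). Qed.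

Lemma cartan_cases t i j : [\/ i = j /\ cartan t i j = 2, cartan t i j = 0 | cartan t i j = -1].
Proof.
rewrite /cartan; have [->|_] := eqVneq i j; first by constructor 1.
by case: (_ || _); [constructor 3|constructor 2].
Qed.

Let sum_delta n (F : nat -> int) k :
  \sum_(i < n) F i * ((i : nat) == k)%:Z = F k * (k < n)%N%:Z.
Proof.
case: (ltnP k n) => [lt_kn|le_nk].
  rewrite (bigD1 (Ordinal lt_kn)) //= eqxx big1 ?addr0 // => i.
  by rewrite -val_eqE /= => /negPf ->; rewrite mulr0.
rewrite mulr0 big1 // => i _; case: eqP => [E|_]; last by rewrite mulr0.
by have := ltn_ord i; rewrite E ltnNge le_nk.
Qed.

(** A Cartan column as a combination of indicators in i, the shape that [sum_delta] can sum. *)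
Lemma typeD_edges (n i j : nat) : (4 <= n)%N -> (i < n)%N -> (j < n)%N ->
  (if i == j then 2 else if ((j == i.+1) && (j < n.-1)%N || (i == n - 3)%N && (j == n.-1)) ||
     ((i == j.+1) && (i < n.-1)%N || (j == n - 3)%N && (i == n.-1)) then -1 else 0 : int) =
   (i == j)%:Z * 2 - (i == j.-1)%:Z * ((0 < j) && (j < n.-1))%N%:Z
   - (i == (n - 3)%N)%:Z * (j == n.-1)%:Z - (i == j.+1)%:Z * (j.+1 < n.-1)%N%:Z - (i == n.-1)%:Z
     * (j == (n - 3)%N)%:Z.
Proof.
move=> nv ltin ltjn.
case: (i =P j) => ?; case: (j =P i.+1) => ?; case: (i =P j.+1) => ?; case: (i =P (n - 3)%N) => ?;
  case: (j =P (n-3)%N) => ?;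
case: (i =P n.-1) => ?; case: (j =P n.-1) => ?; try lia;
case: (i =P j.-1) => ?; case: (ltnP 0 j) => ?; case: (ltnP j n.-1) => ?;
  case: (ltnP j.+1 n.-1) => ?; case: (ltnP i n.-1) => ?; try lia; done.
Qed.

(* The coefficients of 2 rho in the basis of simple roots. *)
Definition two_rho t (i : nat) : int :=
  match t with
  | TypeA n => (i.+1 * (n - i))%N%:Z
  | TypeD n => (if (i < n - 2)%N then i.+1 * (n.*2 - i - 2) else (n * n.-1)./2)%N%:Z
  | TypeE n => (nth 0%N (if n == 6 then [:: 16; 22; 30; 42; 30; 16]
      else if n == 7 then [:: 34; 49; 66; 96; 75; 52; 27]
      else [:: 92; 136; 182; 270; 220; 168; 114; 58]) i)%N%:Z
  end.

Lemma typeD_sum n j : (4 <= n)%N -> (j < n)%N ->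
  two_rho (TypeD n) j * (j < n)%N%:Z * 2 - two_rho (TypeD n) j.-1 * (j.-1 < n)%N%:Z * ((0 < j) &&
    (j < n.-1))%N%:Z
   - two_rho (TypeD n) (n - 3)%N * (n - 3 < n)%N%:Z * (j == n.-1)%:Z - two_rho (TypeD n) j.+1 *
     (j.+1 < n)%N%:Z * (j.+1 < n.-1)%N%:Z
   - two_rho (TypeD n) n.-1 * (n.-1 < n)%N%:Z * (j == (n - 3)%N)%:Z = 2.
Proof.
move=> nv ltjn; rewrite /two_rho.
have [m En] : exists m, n = m.+4 by exists (n - 4)%N; lia.
have dn : (n * n.-1 = (n * n.-1)./2.*2)%N by rewrite -[LHS]odd_double_half oddM; lia.
move: (_./2) dn => s; rewrite {n}En /= ?subSS ?subn0 in nv ltjn * => dn.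
have [lt1|ge1] := ltnP j m.+1.
  have [k ->] : exists k, m = (j + k)%N by exists (m - j)%N; lia.
  have -> : (j < (j + k).+2)%N by lia.
  have -> : (j.-1 < (j + k).+2)%N by lia.
  have -> : (j.+1 < (j + k).+2)%N by lia.
  have -> : (j == (j + k).+1) = false by lia.
  have -> : (j == (j + k).+3) = false by lia.
  have -> : ((j+k).+4.*2 - j - 2 = j + k.*2 + 6)%N by lia.
  have -> : ((j+k).+4.*2 - j.+1 - 2 = j + k.*2 + 5)%N by lia.
  have -> : (j.+1 < (j + k).+3)%N by lia.
  have -> : (j < (j + k).+3)%N by lia.
  have -> : (j.+1 < (j + k).+4)%N by lia.
  have -> : (j < (j + k).+4)%N by lia.
  have -> : (j.-1 < (j + k).+4)%N by lia.
  by case: j {lt1 ltjn} => [|j] /=; lia.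
have : (j == m.+1) || (j == m.+2) || (j == m.+3) by lia.
case/orP => [/orP[]|] /eqP -> /=; rewrite ?ltnn ?eqxx ?ltnSn /=.
- have -> : (m < m.+2)%N by lia.
  have -> : (m < m.+4)%N by lia.
  have -> : (m.+1 < m.+4)%N by lia.
  have -> : (m.+2 < m.+4)%N by lia.
  have -> : (m.+1 < m.+3)%N by lia.
  have -> : (m.+1 == m.+3) = false by lia.
  have -> : (m.+3 < m.+2)%N = false by lia.
  have -> : (m.+4.*2 - m.+1 - 2 = m + 5)%N by lia.
  have -> : (m.+4.*2 - m - 2 = m + 6)%N by lia.
  lia.
- have -> : (m.+1 < m.+4)%N by lia.
  have -> : (m.+2 < m.+4)%N by lia.
  have -> : (m.+2 == m.+1) = false by lia.
  have -> : (m.+2 == m.+3) = false by lia.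
  have -> : (m.+4.*2 - m.+1 - 2 = m + 5)%N by lia.
  lia.
- have -> : (m.+1 < m.+4)%N by lia.
  have -> : (m.+2 < m.+4)%N by lia.
  have -> : (m.+3 < m.+2)%N = false by lia.
  have -> : (m.+3 == m.+1) = false by lia.
  have -> : (m.+4.*2 - m.+1 - 2 = m + 5)%N by lia.
  lia.
Qed.

Lemma typeE_sum n (j : 'I_n) : (6 <= n <= 8)%N ->
  \sum_(i < n) two_rho (TypeE n) i * cartan (TypeE n) i j = 2.
Proof.
move=> nv; have : n \in [:: 6; 7; 8] by rewrite !inE; lia.
rewrite /cartan !inE => /or3P[] /eqP En; subst n; case: j => j ltj;
do 8 ?[case: j ltj => [|j] ltj]; rewrite ?big_ord_recl ?big_ord0 //.
Qed.

(** After the sum over i has collapsed, types A and D are polynomial identities in the node; type E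
    is a finite check. The value 2 gives every x_i^+ degree 1. *)
Lemma two_rhoP t (j : 'I_(rank t)) : ade_valid t ->
  \sum_(i < rank t) two_rho t i * cartan t i j = 2.
Proof.
case: t j => n j /= nv.
- have E (i : 'I_n) : two_rho (TypeA n) i * cartan (TypeA n) i j =
      two_rho (TypeA n) i * ((i : nat) == j)%:Z * 2
      - two_rho (TypeA n) i * ((i : nat) == j.-1)%:Z * (0 < j)%N%:Z
      - two_rho (TypeA n) i * ((i : nat) == j.+1)%:Z.
    rewrite -!mulrA -!mulrBr; congr (_ * _); rewrite /cartan -val_eqE /=.
    by case: ifP => ?; [|case: ifP => ?]; lia.
  rewrite (eq_bigr _ (fun i _ => E i)) !sumrB -!mulr_suml !sum_delta /=.
  case: j {E} => j /= ltj; have [m En] : exists m, n = (j.+1 + m)%N by exists (n - j.+1)%N; lia.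
  have -> : (j < n)%N = true by [].
  have -> : (j.-1 < n)%N = true by lia.
  have -> : (n - j = m.+1)%N by lia.
  have -> : (n - j.+1 = m)%N by lia.
  have -> : (j.-1.+1 * (n - j.-1) = j.-1.+1 * (m + (j - j.-1).+1))%N by congr (_ * _)%N; lia.
  case: m En => [|m] En; [have -> : (j.+1 < n)%N = false by lia|have -> : (j.+1 < n)%N = true by
    lia].
    by case: j ltj En => [|j] ltj En /=; rewrite ?subSnn; lia.
  by case: j ltj En => [|j] ltj En /=; rewrite ?subSnn; nia.
- have E (i : 'I_n) : two_rho (TypeD n) i * cartan (TypeD n) i j =
      two_rho (TypeD n) i * ((i : nat) == j)%:Z * 2
      - two_rho (TypeD n) i * ((i : nat) == j.-1)%:Z * ((0 < j) && (j < n.-1))%N%:Z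
      - two_rho (TypeD n) i * ((i : nat) == (n - 3)%N)%:Z * (j == n.-1 :> nat)%:Z
      - two_rho (TypeD n) i * ((i : nat) == j.+1)%:Z * (j.+1 < n.-1)%N%:Z
      - two_rho (TypeD n) i * ((i : nat) == n.-1)%:Z * (j == (n - 3)%N :> nat)%:Z.
    rewrite -!mulrA -!mulrBr; congr (_ * _); rewrite /cartan -val_eqE /=.
    exact: typeD_edges.
  rewrite (eq_bigr _ (fun i _ => E i)) !sumrB -!mulr_suml !sum_delta /=.
  exact: typeD_sum.
- exact: typeE_sum.
Qed.
End Diagrams.

Section Involution.
Variables (t : ade) (nv : ade_valid t) (tau : 'I_(rank t) -> 'I_(rank t)).
Hypothesis htau : diagram_involution tau.

Lemma tau_inv : involutive tau. Proof. by case: htau. Qed.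
Lemma tau_inj : injective tau. Proof. exact: inv_inj tau_inv. Qed.

Lemma cartan_tau i j : cartan t (tau i) (tau j) = cartan t i j.
Proof. by case: htau. Qed.

Lemma adjacent_tau i j : adjacent (tau i) (tau j) = adjacent i j.
Proof. by rewrite -!cartan_adjacent cartan_tau. Qed.

(* If tau fixes a node, then it preserves the two classes of the bipartition. *)
Lemma bipartite_not_adjacent (col : 'I_(rank t) -> bool) z : tau z = z ->
  (forall i j, adjacent i j -> col i != col j) ->
  (forall f : 'I_(rank t) -> bool, (forall i j, adjacent i j -> f i = f j) -> forall i, f i = f
    z) ->
  forall j, ~~ adjacent j (tau j).
Proof.
move=> tz hc conn j; apply/negP => /hc; apply/negP; rewrite negbK.
have : col (tau j) (+) col j = col (tau z) (+) col z.
  apply: (conn (fun i => col (tau i) (+) col i)) => i k ik.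
  have := hc _ _ ik; have := hc (tau i) (tau k); rewrite adjacent_tau => /(_ ik).
  by do 4 case: (col _).
by rewrite tz addbb; do 2 case: (col _).
Qed.

End Involution.

(** Adjacent nodes go to adjacent nodes and injectivity forbids turning back, so tau is affine with
    slope 1 or -1. Slope 1 would be the identity. *)
Lemma tau_typeA n (tau : 'I_n -> 'I_n) : diagram_involution (t := TypeA n) tau ->
  forall i, tau i = (n.-1 - i)%N :> nat.
Proof.
move=> htau.
case: n tau htau => [|[|n]] tau htau i; [by case: i | by have := ltn_ord (tau i);
  have := ltn_ord i; lia|].
have step (a b : 'I_n.+2) : b = a.+1 :> nat ->
    (tau b == (tau a).+1 :> nat) || (tau a == (tau b).+1 :> nat).
  move=> ab; have : adjacent (t := TypeA n.+2) (tau a) (tau b).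
    by rewrite adjacent_tau // /adjacent -val_eqE /=; apply/andP; split; lia.
  by rewrite /adjacent /= => /andP[_].
have {}step2 (a b d : 'I_n.+2) : b = a.+1 :> nat -> d = b.+1 :> nat ->
    (tau d + tau a = (tau b).*2)%N.
  move=> ab bd; have := step _ _ ab; have := step _ _ bd.
  have : tau a != tau d.
    apply: contra_neq (@tau_inj (TypeA n.+2) _ htau a d) _.
    by apply/eqP => E; move: ab bd; rewrite E; lia.
  by rewrite -val_eqE /=; lia.
pose T k := (tau (inord k) : nat)%:Z.
have T2 k : (k.+2 < n.+2)%N -> T k.+2 + T k = T k.+1 * 2.
  by move=> lk; have := @step2 (inord k) (inord k.+1) (inord k.+2); rewrite /T !inordK //; lia.
have TE k : (k.+1 < n.+2)%N -> T k = T 0%N + (T 1%N - T 0%N) * k%:Z /\ T k.+1 = T 0%N + (T 1%N -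
  T 0%N) * k.+1%:Z.
  elim: k => [|k IH] lk; first by lia.
  by have [] := IH ltac:(lia); have := T2 k lk; lia.
have Ti (k : 'I_n.+2) : (tau k : nat)%:Z = T 0%N + (T 1%N - T 0%N) * (k : nat)%:Z.
  have -> : (tau k : nat)%:Z = T k by rewrite /T inord_val.
  case: k => [[|k] /= lk]; [lia | by case: (TE k lk)].
have := step (inord 0) (inord 1); rewrite !inordK // => /(_ erefl) /orP[] /eqP d.
  have D1 : T 1%N - T 0%N = 1 by rewrite /T d; lia.
  have tid (k : 'I_n.+2) : tau k = k.
    apply/val_inj => /=; have := Ti k; have := Ti (inord n.+1); have := ltn_ord (tau (inord n.+1)).
    by rewrite D1 inordK // /T; lia.
  by case: htau => _ _ [k]; rewrite tid eqxx.
have D1 : T 1%N - T 0%N = -1 by rewrite /T d; lia.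
have := Ti i; have := Ti (inord n.+1); have := ltn_ord (tau (inord 0)); have := ltn_ord i.
by rewrite D1 inordK // /T; lia.
Qed.

Lemma A2n_rank t : is_A2n t -> rank t = (rank t)./2.*2.
Proof. by case: t => //= m; lia. Qed.

Lemma A2n_tau t (tau : 'I_(rank t) -> 'I_(rank t)) i :
  diagram_involution tau -> is_A2n t -> tau i = ((rank t).-1 - i)%N :> nat.
Proof. by case: t tau i => //= m tau' i htau _; apply: tau_typeA. Qed.

Lemma A2n_adjacent t (tau : 'I_(rank t) -> 'I_(rank t)) j :
  diagram_involution tau -> is_A2n t ->
  tau j != j /\ adjacent j (tau j) = (j.+1 == (rank t)./2) || (j == (rank t)./2 :> nat).
Proof.
case: t tau j => // n tau j htau /= n2; rewrite /adjacent -!val_eqE /= !(tau_typeA htau).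
by case: j => j /= ltj; split; lia.
Qed.

(** The images of a, b, d are three distinct neighbours of tau z, and z is the only node with three
    neighbours. *)
Lemma trivalent_node t (tau : 'I_(rank t) -> 'I_(rank t)) (a b d z : 'I_(rank t)) :
  diagram_involution tau -> a != b -> a != d -> b != d ->
  adjacent a z -> adjacent b z -> adjacent d z ->
  (forall a' b' d' z' : 'I_(rank t), a' != b' -> a' != d' -> b' != d' ->
    adjacent a' z' -> adjacent b' z' -> adjacent d' z' -> z' = z) -> tau z = z.
Proof.
move=> htau ab ad bd az bz dz; move=> /(_ (tau a) (tau b) (tau d)); apply;
  rewrite ?(adjacent_tau htau) //.
- by rewrite (inj_eq (tau_inj htau)); apply: ab.
- by rewrite (inj_eq (tau_inj htau)); apply: ad.
- by rewrite (inj_eq (tau_inj htau)); apply: bd.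
Qed.

(** In type A of odd rank, j and n - 1 - j have equal parity. In types D and E the branch node is
    fixed, and the explicit 2-colouring of the tree feeds [bipartite_not_adjacent]. *)
Lemma tau_not_adjacent t (tau : 'I_(rank t) -> 'I_(rank t)) j : ade_valid t ->
  diagram_involution tau -> ~~ is_A2n t -> ~~ adjacent j (tau j).
Proof.
case: t tau j => n tau j /= nv htau nA.
- rewrite /adjacent -val_eqE /= !(tau_typeA htau); case: j => j /= ?; lia.
- have [m En] : exists m, n = m.+4 by exists (n - 4)%N; lia.
  subst n; have zP : (m.+1 < m.+4)%N by lia.
  pose z : 'I_(rank (TypeD m.+4)) := Ordinal zP.
  apply: (@bipartite_not_adjacent _ _ htau (fun i : 'I_m.+4 => if i == m.+3 :> nat then odd m
    else odd i) z).
  + apply: (@trivalent_node (TypeD m.+4) tau (inord m) (inord m.+2) (inord m.+3) z) => //;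
      rewrite /adjacent -?val_eqE /= ?inordK //; try lia.
    move=> [a la] [b lb] [d ld] [e le]; rewrite /= in la lb ld le *.
    rewrite -!val_eqE /=.
    by move=> ab ad bd ae be de; apply/val_inj => /=; lia.
  + move=> [a la] [b lb]; rewrite /= in la lb *; rewrite /adjacent -val_eqE /= => ab.
    by case: (a =P m.+3) => ?; case: (b =P m.+3) => ?; apply/eqP; lia.
  + move=> f fadj.
    have up k : forall a b : 'I_m.+4, b = (a + k)%N :> nat -> (b < m.+3)%N -> f a = f b.
      elim: k => [|k IH] a b ab lb; first by congr f; apply/val_inj => /=; lia.
      have := ltn_ord a; have := ltn_ord b => *.
      rewrite (IH a (inord (a + k))) ?inordK //; try lia.
      by apply: fadj; rewrite /adjacent -val_eqE /= inordK; lia.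
    move=> [i li]; have li' : (i < m.+4)%N := li; have [im|im] := ltnP i m.+3; last first.
      by apply: fadj; rewrite /adjacent -val_eqE /=; lia.
    have [iz|zi] := leqP i m.+1; first by apply: (up (m.+1 - i)%N) => /=; lia.
    by apply/esym/(up (i - m.+1)%N) => /=; lia.
- have zP : (3 < n)%N by lia.
  pose z : 'I_(rank (TypeE n)) := Ordinal zP.
  have [m En] : exists m, n = m.+1 by exists n.-1; lia.
  apply: (@bipartite_not_adjacent _ _ htau (fun i : 'I_n => if (i < 2)%N then ~~ odd i else odd
    i) z).
  + subst n; apply: (@trivalent_node (TypeE m.+1) tau (inord 1) (inord 2) (inord 4) z) => //;
      rewrite /adjacent -?val_eqE /= ?inordK //; try lia.
    move=> [a la] [b lb] [d ld] [e le]; rewrite /= in la lb ld le *.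
    rewrite -!val_eqE /=.
    by move=> ab ad bd ae be de; apply/val_inj => /=; lia.
  + move=> [a la] [b lb]; rewrite /= in la lb *; rewrite /adjacent -val_eqE /= => ab.
    by case: (ltnP a 2) => ?; case: (ltnP b 2) => ?; apply/eqP; lia.
  + subst n; move=> f fadj.
    have up k : forall a b : 'I_m.+1, b = (a + k)%N :> nat -> (1 < a)%N -> f a = f b.
      elim: k => [|k IH] a b ab lb; first by congr f; apply/val_inj => /=; lia.
      have := ltn_ord a; have := ltn_ord b => *.
      rewrite (IH a (inord (a + k))) ?inordK //; try lia.
      by apply: fadj; rewrite /adjacent -val_eqE /= inordK; lia.
    have up2 (i : 'I_m.+1) : (1 < i)%N -> f i = f z.
      move=> i1; have [iz|zi] := leqP i z; first by apply: (up (z - i)%N); rewrite /= in iz *; lia.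
      by apply/esym/(up (i - z)%N); rewrite /= in zi *; lia.
    move=> [i li]; have li' : (i < m.+1)%N := li; have [i2|i1] := ltnP 1 i; first exact: up2.
    rewrite -(up2 (inord i.+2)); last by rewrite inordK; lia.
    by apply: fadj; rewrite /adjacent -val_eqE /= inordK; lia.
Qed.

(** * Relations in presented algebras *)

Section Morphisms.
Variables (K : fieldType) (P : presentation K).
Local Notation ppi := (@ppi K P).
Implicit Types p q : free_alg K (gens P).

Lemma ppi_lie p q : ppi (lie p q) = lie (ppi p) (ppi q).
Proof. exact: etrans (raddfB _ _ _) (congr2 (fun a b => a - b) (ppiM p q) (ppiM q p)). Qed.
Lemma ppi_anti p q : ppi (anti p q) = anti (ppi p) (ppi q).
Proof. exact: etrans (raddfD _ _ _) (congr2 +%R (ppiM p q) (ppiM q p)). Qed.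
Lemma ppi_scale k p : ppi (k *: p) = k *: ppi p.
Proof. exact: linearZ. Qed.
Lemma ppi_add p q : ppi (p + q) = ppi p + ppi q.
Proof. exact: rmorphD. Qed.
Lemma ppi_sub p q : ppi (p - q) = ppi p - ppi q.
Proof. exact: rmorphB. Qed.
Let sub_congr p q x y : ppi p = x -> ppi q = y -> ppi (p - q) = x - y.
Proof. by move=> <- <-; apply: ppi_sub. Qed.
Let add_congr p q x y : ppi p = x -> ppi q = y -> ppi (p + q) = x + y.
Proof. by move=> <- <-; apply: ppi_add. Qed.
Let scale_congr k p x : ppi p = x -> ppi (k *: p) = k *: x.
Proof. by move=> <-; apply: ppi_scale. Qed.

Lemma ppi_lie_rel p q k r : ppi (lie p q - k *: r) = 0 -> lie (ppi p) (ppi q) = k *: ppi r.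
Proof. by rewrite (sub_congr (ppi_lie p q) (ppi_scale k r)) => /subr0_eq. Qed.

Lemma ppi_lie2_rel p q p' q' k r r' : ppi (lie p q - lie p' q' - k *: anti r r') = 0 ->
  lie (ppi p) (ppi q) - lie (ppi p') (ppi q') = k *: anti (ppi r) (ppi r').
Proof.
rewrite (sub_congr (sub_congr (ppi_lie p q) (ppi_lie p' q')) (scale_congr k (ppi_anti r r'))).
by move/subr0_eq.
Qed.

Lemma ppi_lie_rel2 p q k l w r r' : ppi (lie p q - (k *: w + l *: anti r r')) = 0 ->
  lie (ppi p) (ppi q) = k *: ppi w + l *: anti (ppi r) (ppi r').
Proof.
rewrite (sub_congr (ppi_lie p q) (add_congr (ppi_scale k w) (scale_congr l (ppi_anti r r')))).
by move/subr0_eq.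
Qed.

Lemma ppi_lie2_rel2 p q p' q' k l w r r' :
  ppi (lie p q - lie p' q' - (k *: anti r r' - l *: w)) = 0 ->
  lie (ppi p) (ppi q) - lie (ppi p') (ppi q') = k *: anti (ppi r) (ppi r') - l *: ppi w.
Proof.
rewrite (sub_congr (sub_congr (ppi_lie p q) (ppi_lie p' q'))
  (sub_congr (scale_congr k (ppi_anti r r')) (ppi_scale l w))).
by move/subr0_eq.
Qed.
End Morphisms.

Section Images.
Variables (K : fieldType) (B A : algType K) (phi : {lrmorphism B -> A}).
Implicit Types p q r w : B.

Lemma map_lie p q : phi (lie p q) = lie (phi p) (phi q).
Proof. by rewrite /lie rmorphB !rmorphM. Qed.
Lemma map_anti p q : phi (anti p q) = anti (phi p) (phi q).
Proof. by rewrite /anti rmorphD !rmorphM. Qed.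

Lemma map_lie_rel p q k r : lie p q = k *: r -> lie (phi p) (phi q) = k *: phi r.
Proof. by rewrite -map_lie -linearZ => ->. Qed.
Lemma map_lie_rel2 p q k l w r r' : lie p q = k *: w + l *: anti r r' ->
  lie (phi p) (phi q) = k *: phi w + l *: anti (phi r) (phi r').
Proof. by rewrite -map_lie -map_anti -!linearZ -raddfD => ->. Qed.
Lemma map_lie2_rel2 p q p' q' k l w r r' :
  lie p q - lie p' q' = k *: anti r r' - l *: w ->
  lie (phi p) (phi q) - lie (phi p') (phi q') = k *: anti (phi r) (phi r') - l *: phi w.
Proof. by rewrite -!map_lie -map_anti -!linearZ -!raddfB => ->. Qed.
Let rearrange (k : K) (b1 b0 bs bs' hs : A) :
  lie b1 bs - lie b0 bs' = k *: anti b0 bs - (2 * 1 * 1) *: hs ->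
  2 *: hs = k *: (b0 * bs + bs * b0) - (b1 * bs - bs * b1) + (b0 * bs' - bs' * b0).
Proof.
rewrite !mulr1 /lie /anti; move: (b1 * bs - _) (b0 * bs' - _) (_ *: (_ + _)) (2 *: hs) => p q r t E.
by rewrite addrC addrA [q + r]addrC -addrA -opprB E opprB addrC subrK.
Qed.
Lemma map_current_rel (k : K) (b1 b0 bs bs' hs : B) :
  lie b1 bs - lie b0 bs' = k *: anti b0 bs - (2 * 1 * 1) *: hs ->
  2 *: phi hs = k *: (phi b0 * phi bs + phi bs * phi b0)
    - (phi b1 * phi bs - phi bs * phi b1) + (phi b0 * phi bs' - phi bs' * phi b0).
Proof. by move/map_lie2_rel2/rearrange. Qed.
End Images.

Section Relations.
Variables (K : numFieldType) (n : nat) (c : 'I_n -> 'I_n -> int).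
Local Notation yrel r := (@ppi_rel _ (yangian_pres K c) _ r).

Lemma yangian_is_rep : yangian_rep c (yx K c) (yxi K c).
Proof.
split.
- move=> i j r s; exact (etrans (esym (ppi_lie _ _)) (yrel (@yr_xi_xi K n c i j r s))).
- move=> e i j s; exact (ppi_lie_rel (yrel (@yr_xi0_x K n c i j e s))).
- move=> i j r s; exact (ppi_lie_rel (yrel (@yr_xp_xm K n c i j r s))).
- move=> e i j r s; exact (ppi_lie2_rel (yrel (@yr_xi_x K n c i j e r s))).
- move=> e i j r s; exact (ppi_lie2_rel (yrel (@yr_x_x K n c i j e r s))).
Qed.

(** For c_ij = 0 the Serre sum consists of equal brackets, one for each permutation, and their
    number is invertible in characteristic 0. *)
Lemma yangian_commute i j : i != j -> c i j = 0 ->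
  yx K c false i 0 * yx K c false j 0 = yx K c false j 0 * yx K c false i 0.
Proof.
move=> ij cij; have /= := @ppi_rel _ (yangian_pres K c) _ (@yr_serre K n c i j false (fun _ =>
  0%N) 0 ij).
rewrite raddf_sum /= => S.
have m1 : `|1 - c i j|%N = 1%N by rewrite cij.
pose y := yx K c false i 0; pose z := yx K c false j 0.
have : \sum_(sg : 'S_(`|1 - c i j|)) lie y z = 0.
  rewrite -[RHS]S; apply: eq_bigr => sg _.
  (* The index type depends on [c i j], so the fold is evaluated through the length of the
     enumeration instead of replacing the type by ['I_1]. *)
  have foldE (s : seq 'I_(`|1 - c i j|)) : size s = 1%N -> forall F : _ -> nat,
     ppi (P := yangian_pres K c) (foldr (fun k => lie (fgen K (inl (false, i, F k)))) (fgen K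
       (inl (false, j, 0%N))) s) =
     lie (ppi (P := yangian_pres K c) (fgen K (inl (false, i, F (head (cast_ord (esym m1) ord0)
       s))))) z.
    by case: s => [|a [|]] //= _ F; rewrite ppi_lie.
  by rewrite foldE // size_enum_ord.
rewrite sumr_const => /eqP; rewrite -scaler_nat scaler_eq0 => /orP[|/eqP].
  by rewrite pnatr_eq0 eqn0Ngt => /negP[]; apply/card_gt0P; exists 1%g.
by rewrite /lie => /subr0_eq E; exact E.
Qed.

Variables (tau : 'I_n -> 'I_n) (A : algType K) (phi : {lrmorphism iyangian K c tau -> A}).
Local Notation h i r := (phi (ih K c tau i r)).
Local Notation b i r := (phi (ib K c tau i r)).

Local Notation irel r := (@ppi_rel _ (iyangian_pres K c tau) _ r).

Lemma coideal_h0_b i j r :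
  lie (h i 0) (b j r) = ((c i j)%:~R - (c (tau i) j)%:~R) *: b j r.
Proof.
exact (map_lie_rel phi (ppi_lie_rel (irel (@ir_h0_b K n c tau i j r)))).
Qed.

Lemma coideal_h1_b i j r :
  lie (h i 1) (b j r) = ((c i j)%:~R + (c (tau i) j)%:~R) *: b j r.+1
    + (((c i j)%:~R - (c (tau i) j)%:~R) / 2) *: anti (h i 0) (b j r).
Proof.
exact (map_lie_rel2 phi (ppi_lie_rel2 (irel (@ir_h1_b K n c tau i j r)))).
Qed.

Lemma coideal_b_b j s : involutive tau ->
  2 *: h j s.+1 = ((c (tau j) j)%:~R / 2) *: (b (tau j) 0 * b j s + b j s * b (tau j) 0)
    - (b (tau j) 1 * b j s - b j s * b (tau j) 1)
    + (b (tau j) 0 * b j s.+1 - b j s.+1 * b (tau j) 0).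
Proof.
move=> tauK; have E := ppi_lie2_rel2 (irel (@ir_b_b K n c tau (tau j) j 0 s)).
by rewrite tauK eqxx in E; exact (map_current_rel phi E).
Qed.
End Relations.

(** * Root vectors and the leading term of h_(j,1) *)

Section Rho.
Variables (K : numFieldType) (t : ade) (nv : ade_valid t) (A : algType K).
Variables (x : bool -> 'I_(rank t) -> nat -> A) (xi : 'I_(rank t) -> nat -> A).
Hypothesis rep : yangian_rep (cartan t) x xi.

Definition rho_element : A := \sum_(i < rank t) ((two_rho t i)%:~R / 2) *: xi i 0.

(** By symmetry of the Cartan matrix and [two_rhoP], pairing rho with a weight gives the sum of its
    coefficients, its height. *)
Lemma rho_homog (f : 'I_(rank t) -> int) a :
  (forall i, xi i 0 * a - a * xi i 0 = (\sum_k f k * cartan t k i)%:~R *: a) ->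
  homog rho_element (\sum_k f k) a.
Proof.
move=> fa; rewrite /homog /rho_element mulr_suml mulr_sumr -sumrB.
under eq_bigr => i _ do rewrite -scalerAl -scalerAr -scalerBr fa scalerA.
rewrite -scaler_suml; congr (_ *: _).
have two : (2 : K) != 0 by rewrite pnatr_eq0.
apply: (mulIf two); rewrite mulr_suml.
under eq_bigr => i _ do rewrite mulrAC divfK // -intrM.
rewrite -[2]/((2%:Z)%:~R) -intrM -mulrz_sumr; congr (_%:~R).
transitivity (\sum_(i < rank t) \sum_k f k * (two_rho t i * cartan t i k)).
  by apply: eq_bigr => i _; rewrite mulr_sumr; apply: eq_bigr => k _; rewrite mulrCA cartan_sym.
rewrite exchange_big mulr_suml; apply: eq_bigr => k _.
by rewrite -mulr_sumr two_rhoP.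
Qed.

Lemma rho_element_xi i r : homog rho_element 0 (xi i r).
Proof.
have := @rho_homog (fun=> 0) (xi i r); rewrite big1 //; apply => k.
by rewrite big1 ?scale0r => [|l _]; [apply: (yr_comm rep)|rewrite mul0r].
Qed.

Lemma rho_element_x e i r : homog rho_element (if e then -1 else 1) (x e i r).
Proof.
have := @rho_homog (fun k => (if e then -1 else 1) * (k == i)%:Z) (x e i r).
have sumE (F : 'I_(rank t) -> int) : \sum_k (k == i)%:Z * F k = F i.
  rewrite (bigD1 i) //= eqxx mul1r big1 ?addr0 // => k /negPf ->.
  by rewrite mul0r.
have -> : \sum_k (if e then -1 else 1) * (k == i)%:Z = (if e then -1 else 1) :> int.
  by rewrite -mulr_sumr; under eq_bigr => k _ do rewrite -[_%:Z]mulr1; rewrite sumE mulr1.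
apply=> k; under eq_bigr => l _ do rewrite -mulrA.
rewrite -mulr_sumr sumE; apply: etrans (yr_weight rep e k i r) _; congr (_ *: _).
by rewrite intrM cartan_sym /pm; case: e.
Qed.
End Rho.

Section RootSystem.
Variables (K : numClosedFieldType) (t : ade).
Variables (tau : 'I_(rank t) -> 'I_(rank t)) (htau : diagram_involution tau).
Variables (g : chevalley_lie K t) (X : root_vectors tau g).

Lemma simple_root_form a i : root_form a (simple_root i) = \sum_k a k * cartan t k i.
Proof.
apply: eq_bigr => k _; rewrite (bigD1 i) //= ffunE eqxx mulr1 big1 ?addr0 // => j /negPf ji.
by rewrite ffunE ji mulr0 mul0r.
Qed.

Lemma simple_root_inj : injective (@simple_root t).
Proof.
move=> i k /ffunP /(_ i); rewrite !ffunE eqxx.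
by case: eqVneq.
Qed.

Lemma cx_neq0 i : cx g false i != 0.
Proof.
apply/eqP => E; have := cform_norm g i; rewrite E.
have := cform_linearl (cx g true i) 1 0 0; rewrite scaler0 addr0 mul1r.
move=> /(congr1 (fun s => s - cform 0 (cx g true i))); rewrite addrK subrr => <- /eqP.
by rewrite eq_sym oner_eq0.
Qed.

Lemma simple_root_pos i : simple_root i \in posroots X.
Proof.
apply/posrootsP; split=> [|k]; last by rewrite ffunE.
split; first by apply/eqP => /ffunP /(_ i); rewrite !ffunE eqxx.
exists (cx g false i); first exact: cx_neq0.
move=> k; rewrite cxi_cx /pm expr0 mul1r simple_root_form; congr (_%:~R *: _).
rewrite (bigD1 i) //= ffunE eqxx mul1r big1 ?addr0 1?cartan_sym // => j /negPf ji.
by rewrite ffunE ji mul0r.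
Qed.

Lemma posroot_ge0 a i : a \in posroots X -> 0 <= a i.
Proof. by move=> /posrootsP [_]. Qed.

Lemma posroot_neq0 a : a \in posroots X -> a != 0.
Proof. by move=> /posrootsP [[]]. Qed.

Lemma height_ge1 a : a \in posroots X -> 1 <= \sum_i a i.
Proof.
move=> pa; have /existsP [i ai] : [exists i, a i != 0].
  rewrite -negb_forall; apply: contra (posroot_neq0 pa) => /forallP a0.
  by apply/eqP/ffunP => i; rewrite ffunE (eqP (a0 i)).
rewrite (bigD1 i) //=; have := posroot_ge0 i pa.
have : 0 <= \sum_(j | j != i) a j by apply: sumr_ge0 => j _; apply: posroot_ge0.
by move: (\sum_(j | j != i) a j) (a i) ai => S ai; lia.
Qed.

Lemma height_ge2 a : a \in posroots X -> (forall i, a != simple_root i) -> 2 <= \sum_i a i.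
Proof.
move=> pa na; have := height_ge1 pa; rewrite le_eqVlt => /orP[/eqP h1|]; last by lia.
have /existsP [i ai] : [exists i, a i != 0].
  rewrite -negb_forall; apply: contra (posroot_neq0 pa) => /forallP a0.
  by apply/eqP/ffunP => i; rewrite ffunE (eqP (a0 i)).
case/negP: (na i); apply/eqP/ffunP => k; rewrite ffunE.
have := h1; rewrite (bigD1 i) //=; have := posroot_ge0 i pa.
have [-> | ki] := eqVneq k i.
  have : 0 <= \sum_(j | j != i) a j by apply: sumr_ge0 => j _; apply: posroot_ge0.
  by move: (\sum_(j | j != i) a j) (a i) ai => S y; lia.
rewrite (bigD1 k) //=; have := posroot_ge0 k pa.
have : 0 <= \sum_(j | (j != i) && (j != k)) a j by apply: sumr_ge0 => j _; apply: posroot_ge0.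
by move: (\sum_(j | (j != i) && (j != k)) a j) (a i) ai (a k) => S y ? z; lia.
Qed.

Lemma tau_root_simple i : tau_root tau (simple_root i) = simple_root (tau i).
Proof.
apply/ffunP => k; rewrite !ffunE; congr (_%:Z).
by rewrite -(inj_eq (tau_inj htau)) (tau_inv htau).
Qed.

Lemma tau_root_sum a : \sum_i tau_root tau a i = \sum_i a i.
Proof.
rewrite [RHS](reindex_inj (tau_inj htau)); by apply: eq_bigr => i _; rewrite ffunE.
Qed.

(** The vectors fixed by the square form a subalgebra containing the Chevalley generators.
    Injectivity of [tau_lie] then lets tau act on the positive roots. *)
Lemma tau_lieK x : tau_lie X (tau_lie X x) = x.
Proof.
pose f := (linfun (tau_lie X) \o linfun (tau_lie X) - \1)%VF.
have fE y : f y = tau_lie X (tau_lie X y) - y.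
  by rewrite /f add_lfunE opp_lfunE comp_lfunE id_lfunE !lfunE.
have kerE y : (y \in lker f) = (tau_lie X (tau_lie X y) == y).
  by rewrite memv_ker fE subr_eq0.
have : lker f = fullv.
  apply: (cx_generate (c := g)) => [e i | y z]; rewrite !kerE.
    by rewrite !tau_lie_cx (tau_inv htau).
  by rewrite !tau_lie_br => /eqP -> /eqP ->.
by move=> kf; apply/eqP; rewrite -kerE kf memvf.
Qed.

Lemma tau_root_pos a : a \in posroots X -> tau_root tau a \in posroots X.
Proof.
move=> /posrootsP [[a0 [x x0 xa]] ga]; apply/posrootsP; split; last by move=> i; rewrite ffunE.
split.
  apply: contra a0 => /eqP E; apply/eqP/ffunP => i.
  by have /ffunP /(_ (tau i)) := E; rewrite !ffunE (tau_inv htau).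
exists (tau_lie X x).
  apply: contra x0 => /eqP E; by rewrite -(tau_lieK x) E linear0.
move=> i; have -> : cxi g i = tau_lie X (cxi g (tau i)).
  by rewrite /cxi tau_lie_br !tau_lie_cx (tau_inv htau).
rewrite -tau_lie_br xa linearZ; congr (_%:~R *: _).
rewrite !simple_root_form [LHS](reindex_inj (tau_inj htau)); apply: eq_bigr => k _.
by rewrite ffunE (cartan_tau htau).
Qed.

Lemma posroots_split (V : zmodType) (F : root_lattice t -> V) :
  \sum_(a <- posroots X) F a = \sum_k F (simple_root k)
    + \sum_(a <- posroots X | [forall i, a != simple_root i]) F a.
Proof.
rewrite (bigID (fun a => [forall i, a != simple_root i])) /= addrC; congr (_ + _).
rewrite -big_filter.
transitivity (\sum_(a <- [seq simple_root i | i <- enum 'I_(rank t)]) F a); last first.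
  by rewrite big_map big_enum.
apply: perm_big; apply: uniq_perm; first exact/filter_uniq/posroots_uniq.
  by rewrite map_inj_uniq ?enum_uniq //; apply: simple_root_inj.
move=> a; rewrite mem_filter negb_forall; apply/andP/mapP => [[/existsP [k]]|[k _ ->]].
  by rewrite negbK => /eqP -> _; exists k; rewrite ?mem_enum.
by split; [apply/existsP; exists k; rewrite negbK eqxx|apply: simple_root_pos].
Qed.
End RootSystem.

Lemma bigD2 (V : zmodType) n (F : 'I_n -> V) j k : j != k ->
  \sum_i F i = F j + F k + \sum_(i | (i != j) && (i != k)) F i.
Proof. by move=> jk; rewrite (bigD1 j) //= (bigD1 k) ?addrA // eq_sym. Qed.

Section Decomposition.
Variables (K : numClosedFieldType) (t : ade) (nv : ade_valid t).
Variables (tau : 'I_(rank t) -> 'I_(rank t)) (htau : diagram_involution tau).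
Variables (g : chevalley_lie K t) (X : root_vectors tau g) (A : algType K).
Variables (x : bool -> 'I_(rank t) -> nat -> A) (xi : 'I_(rank t) -> nat -> A).
Hypothesis rep : yangian_rep (cartan t) x xi.
Variable iota : {linear g -> A}.
Hypotheses (iota_br : forall u v, iota (lbr u v) = lie (iota u) (iota v))
  (iota_cx : forall e i, iota (cx g e i) = x e i 0).
Local Notation rho := (rho_element xi).
Local Notation ge := (ge_degree rho).
Local Notation N := (rank t)./2.

Lemma iota_cxi i : iota (cxi g i) = xi i 0.
Proof. by rewrite /cxi iota_br !iota_cx (yr_ef rep) eqxx scale1r. Qed.

Lemma root_space_homog a v : root_space a v -> homog rho (\sum_k a k) (iota v).
Proof.
move=> va; apply: (rho_homog nv) => i.
by rewrite -iota_cxi -/(lie _ _) -iota_br va linearZ simple_root_form.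
Qed.

Lemma rv_homog a : a \in posroots X -> homog rho (\sum_k a k) (iota (rv X false a)).
Proof. by move=> pa; apply: root_space_homog; apply: (@rv_root_space _ _ _ _ X false). Qed.

Lemma rv_simple_root k : iota (rv X false (simple_root k)) = x false k 0.
Proof. by rewrite rv_simple iota_cx. Qed.

Lemma x_ge i r : ge 1 (x false i r).
Proof. exact: ge_homog (rho_element_x nv rep false i r). Qed.

Lemma y_ge i r : ge (-1) (x true i r).
Proof. exact: ge_homog (rho_element_x nv rep true i r). Qed.

Definition negligible (k : 'I_(rank t)) (a : A) : Prop :=
  ge 2 a /\ forall r, ge 2 (a * x true k r - x true k r * a).

Lemma negligible0 k : negligible k 0.
Proof. by split=> [|r]; rewrite ?mul0r ?mulr0 ?subr0; apply: ge_degree0. Qed.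

Lemma negligibleD k a b : negligible k a -> negligible k b -> negligible k (a + b).
Proof.
move=> [a2 ka] [b2 kb]; split=> [|r]; first exact: ge_degreeD.
have -> : (a + b) * x true k r - x true k r * (a + b) =
  (a * x true k r - x true k r * a) + (b * x true k r - x true k r * b) by ncring.
exact: ge_degreeD.
Qed.

Lemma negligibleZ k s a : negligible k a -> negligible k (s *: a).
Proof.
move=> [a2 ka]; split=> [|r]; first exact: ge_degreeZ.
by rewrite -scalerAl -scalerAr -scalerBr; apply: ge_degreeZ.
Qed.

Lemma negligibleN k a : negligible k a -> negligible k (- a).
Proof. by rewrite -scaleN1r; apply: negligibleZ. Qed.

Lemma negligible_sum k I (r : seq I) (P : pred I) (F : I -> A) :
  (forall i, P i -> negligible k (F i)) -> negligible k (\sum_(i <- r | P i) F i).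
Proof. by move=> hF; apply: big_ind => //; [exact: negligible0|exact: negligibleD]. Qed.

Lemma negligible_ge3 k a : ge 3 a -> negligible k a.
Proof.
move=> a3; split=> [|r]; first exact: ge_degreeW a3.
exact: ge_degree_comm a3 (y_ge k r) _.
Qed.

Lemma negligible_raise k i j : i != k -> j != k -> negligible k (x false i 0 * x false j 0).
Proof.
move=> ik jk; split=> [|r]; first exact: ge_degree_mul (x_ge i 0) (x_ge j 0) _.
have comm l : l != k -> x false l 0 * x true k r = x true k r * x false l 0.
  by move=> lk; apply: subr0_eq; have := yr_ef rep l k 0 r; rewrite (negPf lk) scale0r.
by rewrite -mulrA (comm j) // mulrA (comm i) // mulrA subrr; apply: ge_degree0.
Qed.

Lemma negligible_anti k i j : i != k -> j != k ->
  negligible k (anti (x false i 0) (x false j 0)).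
Proof. by move=> ik jk; apply: negligibleD; apply: negligible_raise. Qed.

Let tau_eq i j : (tau i == j) = (i == tau j).
Proof. by rewrite -(inj_eq (tau_inj htau)) (tau_inv htau). Qed.

(** A non-simple root has height at least 2 and its image under tau at least 1, so these terms have
    degree at least 3 and stay of degree at least 2 after one lowering. *)
Let high_part j k : negligible k (\sum_(a <- posroots X | [forall i, a != simple_root i])
  (root_form a (simple_root j))%:~R *:
     anti (iota (rv X false a)) (iota (rv X false (tau_root tau a)))).
Proof.
rewrite big_seq_cond; apply: negligible_sum => a /andP[pa /forallP na].
apply/negligibleZ/negligible_ge3.
have ga := ge_homog (height_ge2 pa na) (rv_homog pa).
have := rv_homog (tau_root_pos htau pa); rewrite (tau_root_sum htau) => /(ge_homog (height_ge1
  pa)) gt.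
by apply: ge_degreeD; [apply: ge_degree_mul ga gt _|apply: ge_degree_mul gt ga _].
Qed.

Definition root_sum j : A := \sum_(a <- posroots X)
  (root_form a (simple_root j))%:~R *:
     anti (iota (rv X false a)) (iota (rv X false (tau_root tau a))).

Let simple_part j : \sum_k (root_form (simple_root k) (simple_root j))%:~R *:
     anti (iota (rv X false (simple_root k))) (iota (rv X false (tau_root tau (simple_root k)))) =
  \sum_k (cartan t k j)%:~R *: anti (x false k 0) (x false (tau k) 0).
Proof.
apply: eq_bigr => k _; rewrite tau_root_simple // !rv_simple_root; congr (_%:~R *: _).
rewrite simple_root_form (bigD1 k) //= ffunE eqxx mul1r big1 ?addr0 // => l /negPf lk.
by rewrite ffunE lk mul0r.
Qed.

Lemma root_sum_fixed j : tau j = j -> exists2 Rm, negligible j Rm &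
  root_sum j = (4 : K) *: (x false j 0 * x false j 0) + Rm.
Proof.
move=> tj; pose R1 := \sum_(k | k != j) (cartan t k j)%:~R *: anti (x false k 0) (x false (tau k)
  0).
exists (R1 + \sum_(a <- posroots X | [forall i, a != simple_root i])
  (root_form a (simple_root j))%:~R *:
     anti (iota (rv X false a)) (iota (rv X false (tau_root tau a)))).
  apply: negligibleD (high_part j j); apply: negligible_sum => k kj; apply: negligibleZ.
  by apply: negligible_anti; rewrite ?tau_eq ?tj.
rewrite /root_sum (posroots_split X) simple_part (bigD1 j) //= tj cartan_diag addrA.
congr (_ + _ + _); rewrite /anti -mulr2n -[2%:~R]/(2%:R : K) -scaler_nat scalerA.
by rewrite -natrM.
Qed.

Lemma root_sum_moved j : tau j != j -> exists2 Rm, negligible (tau j) Rm &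
  root_sum j = (2 + (cartan t j (tau j))%:~R : K) *: anti (x false j 0) (x false (tau j) 0) + Rm.
Proof.
move=> tj; pose R1 := \sum_(k | (k != j) && (k != tau j))
  (cartan t k j)%:~R *: anti (x false k 0) (x false (tau k) 0).
exists (R1 + \sum_(a <- posroots X | [forall i, a != simple_root i])
  (root_form a (simple_root j))%:~R *:
     anti (iota (rv X false a)) (iota (rv X false (tau_root tau a)))).
  apply: negligibleD (high_part j (tau j)); apply: negligible_sum => k /andP[kj ktj].
  by apply/negligibleZ/negligible_anti; rewrite // tau_eq (tau_inv htau).
rewrite /root_sum (posroots_split X) simple_part (@bigD2 _ _ _ j (tau j)); last by rewrite eq_sym.
rewrite cartan_diag (tau_inv htau) addrA (cartan_sym (tau j)); congr (_ + _ + _).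
by rewrite [RHS]scalerDl [anti (x _ (tau j) _) _]addrC.
Qed.

End Decomposition.

Section ThetaPart.
Variables (K : numClosedFieldType) (t : ade) (nv : ade_valid t).
Variables (tau : 'I_(rank t) -> 'I_(rank t)) (htau : diagram_involution tau).
Variables (g : chevalley_lie K t) (X : root_vectors tau g) (A : algType K).
Variables (x : bool -> 'I_(rank t) -> nat -> A) (xi : 'I_(rank t) -> nat -> A).
Hypothesis rep : yangian_rep (cartan t) x xi.
Variable iota : {linear g -> A}.
Hypotheses (iota_br : forall u v, iota (lbr u v) = lie (iota u) (iota v))
  (iota_cx : forall e i, iota (cx g e i) = x e i 0).
Local Notation rho := (rho_element xi).
Local Notation ge := (ge_degree rho).
Local Notation N := (rank t)./2.
Hypothesis A2n : is_A2n t.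

Let rankE := A2n_rank A2n.
Let tauE i := A2n_tau i htau A2n.

Lemma eps_diff_simple (k : 'I_(rank t)) : eps_diff t k k.+1 = simple_root k.
Proof. by apply/ffunP => l; rewrite !ffunE -val_eqE /=; congr (_%:Z); lia. Qed.

Lemma tau_root_eps_diff k : (k < N)%N -> tau_root tau (eps_diff t k N) = eps_diff t N (rank t - k).
Proof.
move=> kN; apply/ffunP => l; rewrite !ffunE tauE; congr (_%:Z).
by have := ltn_ord l; lia.
Qed.

(** The factor ['i] matches the powers of the square root of -1 in the matrix units. Writing root
    vectors as iterated brackets of simple ones gives the degrees occurring in Theta. *)
Lemma rv_eps_diff i j : (i < j)%N -> (j < rank t)%N ->
  rv X false (eps_diff t i j.+1)
  = 'i *: lbr (rv X false (eps_diff t i j)) (rv X false (eps_diff t j j.+1)).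
Proof.
move=> ij jn; have [psi [psi_inj _ psi_br psiE]] := rv_A2n X A2n.
apply: psi_inj; rewrite linearZ psi_br.
have P a b : (a < b)%N -> (b < (rank t).+1)%N -> psi (rv X false (eps_diff t a b)) =
    ('i ^ (b%:Z - a%:Z - 1)) *: delta_mx (inord a) (inord b).
  move=> ab bn; have [] := psiE (inord a) (inord b); rewrite !inordK //; lia.
rewrite !P; try lia.
rewrite /lie -!scalerAl -!scalerAr !scalerA -!mulmxE !mul_delta_mx_cond eqxx /=.
have -> : (inord j.+1 == inord i :> 'I_(rank t).+1) = false.
  by rewrite -val_eqE /= !inordK; lia.
rewrite scaler0 subr0 mulr1n scalerA; congr (_ *: _).
have i0 : 'i != 0 :> K by apply: neq0Ci.
have -> : (j.+1%:Z - j%:Z - 1 = 0)%R by lia.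
rewrite expr0z mulr1 -[X in X * _]expr1z -expfzDr //; congr (_ ^ _); lia.
Qed.

Lemma rv_eps_diff_homog i j : (i < j <= rank t)%N ->
  homog rho (j%:Z - i%:Z) (iota (rv X false (eps_diff t i j))).
Proof.
move=> /andP[ij]; have [d ->] : exists d, j = (i.+1 + d)%N by exists (j - i.+1)%N; lia.
elim: d => [|d IH] jn.
  have in_ : (i < rank t)%N by lia.
  rewrite addn0 (eps_diff_simple (Ordinal in_)) rv_simple iota_cx.
  have -> : (i.+1%:Z - i%:Z = 1)%R by lia.
  exact: (rho_element_x nv rep false).
rewrite addnS rv_eps_diff; try lia.
rewrite linearZ iota_br; apply: homogZ.
have jn' : (i.+1 + d < rank t)%N by lia.
rewrite (eps_diff_simple (Ordinal jn')) rv_simple iota_cx.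
have h1 := rho_element_x nv rep false (Ordinal jn') 0.
have h2 := IH ltac:(lia).
have -> : ((i.+1 + d).+1%:Z - i%:Z = (i.+1 + d)%N%:Z - i%:Z + 1)%R by lia.
by apply: homogD; [apply: homogM|apply: homogN; rewrite addrC; apply: homogM].
Qed.

Let T k := lbr (rv X false (eps_diff t k N)) (rv X false (tau_root tau (eps_diff t k N))).

(** For k + 1 < N the bracket has degree 2(N - k), at least 4. For k + 1 = N it involves only the
    two middle nodes, both different from tau j. *)
Let T_negligible (j : 'I_(rank t)) k : j.+1 != N -> j != N :> nat -> (k < N)%N ->
  negligible x xi (tau j) (iota (T k)).
Proof.
move=> j1 j2 kN; rewrite /T iota_br tau_root_eps_diff //.
have [k1|k1] := ltnP k.+1 N.
  apply: (negligible_ge3 nv rep).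
  have h1 : homog rho (N%:Z - k%:Z) (iota (rv X false (eps_diff t k N))).
    by apply: rv_eps_diff_homog; lia.
  have h2 : homog rho ((rank t - k)%N%:Z - N%:Z) (iota (rv X false (eps_diff t N (rank t - k)))).
    by apply: rv_eps_diff_homog; lia.
  apply: (@ge_homog _ _ _ ((N%:Z - k%:Z) + ((rank t - k)%N%:Z - N%:Z))); first by lia.
  by apply: homogD; [apply: homogM|apply: homogN; rewrite addrC; apply: homogM].
have kE : k.+1 = N by lia.
have [ln kn] : (N < rank t)%N /\ (k < rank t)%N by lia.
have -> : (rank t - k = N.+1)%N by lia.
rewrite -{1}kE (eps_diff_simple (Ordinal kn)) (eps_diff_simple (Ordinal ln)) !rv_simple !iota_cx.
have ne1 : Ordinal kn != tau j by rewrite -val_eqE /= tauE; have := ltn_ord j; lia.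
have ne2 : Ordinal ln != tau j by rewrite -val_eqE /= tauE; have := ltn_ord j; lia.
by apply: negligibleD; [|apply: negligibleN]; apply: (negligible_raise nv rep).
Qed.

Lemma Theta_negligible (j : 'I_(rank t)) : j.+1 != N -> j != N :> nat ->
  negligible x xi (tau j) (iota (Theta X j)).
Proof.
move=> j1 j2; rewrite /Theta A2n /= (negPf j1); have ltj := ltn_ord j.
case: ltnP => [jN|jN]; last (have -> : (N < j)%N by lia);
  rewrite linearD linearN; apply: negligibleD; [apply: negligibleN|..|apply: negligibleN|];
  apply: T_negligible => //; lia.
Qed.

Lemma Theta_left (j : 'I_(rank t)) : j.+1 = N ->
  iota (Theta X j) = 2^-1 *: (xi j 0 - xi (tau j) 0) - lie (x false j 0) (x false (tau j) 0).
Proof.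
move=> j1; rewrite /Theta A2n /= j1 eqxx ltnn.
have -> : (N < j)%N = false by lia.
by rewrite linearB linearZ linearB !(iota_cxi rep iota_br iota_cx) iota_br !iota_cx.
Qed.

Lemma Theta_right (j : 'I_(rank t)) : j = N :> nat ->
  iota (Theta X j) = 2^-1 *: (xi (tau j) 0 - xi j 0) - lie (x false (tau j) 0) (x false j 0).
Proof.
move=> j1; rewrite /Theta A2n /= j1 ltnn.
have -> : (N.+1 < N)%N = false by lia.
have -> : (N.+1 == N)%N = false by lia.
by rewrite linearB linearZ linearB !(iota_cxi rep iota_br iota_cx) iota_br !iota_cx.
Qed.
End ThetaPart.

(** * The leading terms of b_(j,r) and h_(j,r) *)

Section Triangularity.
Variables (K : numClosedFieldType) (t : ade) (nv : ade_valid t).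
Variables (tau : 'I_(rank t) -> 'I_(rank t)) (htau : diagram_involution tau).
Variables (g : chevalley_lie K t) (X : root_vectors tau g) (A : algType K).
Variables (x : bool -> 'I_(rank t) -> nat -> A) (xi : 'I_(rank t) -> nat -> A).
Hypothesis rep : yangian_rep (cartan t) x xi.
Hypothesis x_comm : forall i j, i != j -> cartan t i j = 0 ->
  x false i 0 * x false j 0 = x false j 0 * x false i 0.
Variable iota : {linear g -> A}.
Hypotheses (iota_br : forall u v, iota (lbr u v) = lie (iota u) (iota v))
  (iota_cx : forall e i, iota (cx g e i) = x e i 0).
Variables (h b : 'I_(rank t) -> nat -> A).
Local Notation w j := (wp K j / 4 : K).
Local Notation c i j := ((cartan t i j)%:~R : K).
Hypotheses (h0 : forall j, h j 0 = xi j 0 - xi (tau j) 0 + (w j)%:A)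
  (b0 : forall j, b j 0 = x false j 0 - x true (tau j) 0)
  (h1 : forall j, h j 1 = xi j 1 + xi (tau j) 1 - xi j 0 * xi (tau j) 0
     + 2^-1 *: root_sum X iota j + 2^-1 *: iota (Theta X j)).
Hypotheses (h0_b : forall j r, lie (h j 0) (b j r) = (c j j - c (tau j) j) *: b j r)
  (h1_b : forall j r, lie (h j 1) (b j r) = (c j j + c (tau j) j) *: b j r.+1
    + ((c j j - c (tau j) j) / 2) *: anti (h j 0) (b j r))
  (b_b : forall j s, 2 *: h j s.+1 =
    (c (tau j) j / 2) *: (b (tau j) 0 * b j s + b j s * b (tau j) 0)
    - (b (tau j) 1 * b j s - b j s * b (tau j) 1)
    + (b (tau j) 0 * b j s.+1 - b j s.+1 * b (tau j) 0)).
Local Notation rho := (rho_element xi).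
Local Notation ge := (ge_degree rho).
Local Notation psge := (psge_degree rho).
Local Notation E i := (raising_series x i).
Local Notation Ph i := (lowering_flip x i).
Local Notation Mf i := (cartan_flip xi i).
Local Notation C := (@psC A).
Local Notation N := (rank t)./2.
Local Notation eta j := (xi j 0 - xi (tau j) 0).
Local Notation s j := ((cartan t j j + cartan t (tau j) j)%:~R : K).

(* The constant term makes the part of degree 0 of this element equal to
   [theta xi j (tau j)]. *)
Definition step_element j : A :=
  h j 1 - 2^-1 *: (h j 0 * h j 0) + (2^-1 * (w j * w j))%:A.

(** The bracket of h_(j,0)^2 with b is a multiple of the anticommutator of h_(j,0) and b, so
    subtracting half the square cancels the last term of [h1_b]. *)
Lemma step_element_b j r :
  s j *: b j r.+1 = step_element j * b j r - b j r * step_element j.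
Proof.
have := h1_b j r; have := h0_b j r; rewrite /step_element intrD.
move: (h j 1) (h j 0) (b j r) (_ + _ : K) (_ - _ : K) (b j r.+1) => H1 H0 B S D B1 E0 E1.
have E2 : H0 * H0 * B - B * (H0 * H0) = D *: anti H0 B.
  transitivity (H0 * lie H0 B + lie H0 B * H0); first by rewrite /lie; ncring.
  by rewrite E0 -scalerAr -scalerAl -scalerDr.
have -> : S *: B1 = lie H1 B - 2^-1 *: (H0 * H0 * B - B * (H0 * H0)).
  by rewrite E1 E2 scalerA mulrC addrK.
by rewrite /lie; ncalg.
Qed.

Definition step_excess j : A :=
  2^-1 *: root_sum X iota j + 2^-1 *: iota (Theta X j) - w j *: eta j.

(** With p = xi_(j,0) and q = xi_(tau j,0), -pq - (p - q)^2/2 = -(p^2 + q^2)/2 produces the two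
    terms [cartan_t]. The cross term of (p - q + w)^2 is the last term of [step_excess]. *)
Lemma step_elementE j : step_element j = theta xi j (tau j) + step_excess j.
Proof.
rewrite /step_element h1 h0 /step_excess /theta /cartan_t.
have := yr_comm rep j (tau j) 0 0; rewrite /lie.
move: (xi j 0) (xi (tau j) 0) (xi j 1) (xi (tau j) 1) (2^-1 *: root_sum _ _ _) (2^-1 *: iota _).
move=> p q p1 q1 R1 R2 pq.
have -> : (p - q + (w j)%:A) * (p - q + (w j)%:A) =
  p * p + q * q - (p * q) *+ 2 + (p * q - q * p) + (w j *: (p - q)) *+ 2 + (w j * w j)%:A.
  rewrite -scalerA -[w j *: (w j)%:A]mulr_algl -[w j *: (p - q)]mulr_algl.
  by ncring_mod [:: (w j)%:A : A] (conj (@in_alg_central K A (w j)) I).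
rewrite pq addr0.
have half2 (V : lmodType K) (v : V) : 2^-1 *: (v *+ 2) = v.
  by rewrite -scaler_nat scalerA mulVf ?scale1r // pnatr_eq0.
have distr (a q2 P W : A) : 2^-1 *: (a - q2 *+ 2 + P *+ 2 + W) = 2^-1 *: a - q2 + P + 2^-1 *: W.
  by rewrite scalerDr scalerDr scalerBr !half2.
rewrite -[(2^-1 * _)%:A]scalerA distr scalerDr.
by move: (2^-1 *: _%:A) (_ *: (p - q)) => W P; ncalg.
Qed.

Let cartan_tau_cases j : tau j = j \/ tau j != j.
Proof. by case: (eqVneq (tau j) j); [left|right]. Qed.

Let ge_G i j : ge 2 (x false i 0 * x false j 0).
Proof. exact: ge_degree_mul (x_ge nv rep i 0) (x_ge nv rep j 0) _. Qed.

Let psge_E i : psge 1 (E i).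
Proof. by move=> [|r]; [exact: ge_degree0|apply: (x_ge nv rep)]. Qed.
Let ge_1 : ge 0 1.
Proof. by apply: (@ge_homog _ _ _ 0) => //; rewrite /homog scale0r; ncring. Qed.
Let psge_Mf i : psge 0 (Mf i).
Proof.
by move=> [|r]; apply: ge_degreeZ; [exact: ge_1|exact/(ge_homog _ (rho_element_xi nv rep i r))].
Qed.

Lemma step_scalar_neq0 j : s j != 0.
Proof. by rewrite intr_eq0 cartan_diag; have [[_ ->]|->|->] := cartan_cases (tau j) j. Qed.

Let EM1 i k : (E i * Mf k) 1%N = x false i 0.
Proof.
rewrite psM !big_ord_recl big_ord0 addr0 mul0r add0r /cartan_flip /psflip.
by rewrite expr0 scale1r mulr1.
Qed.
Let ME1 i k : (Mf k * E i) 1%N = x false i 0.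
Proof.
rewrite psM !big_ord_recl big_ord0 addr0 mulr0 addr0 /cartan_flip /psflip.
by rewrite expr0 scale1r mul1r.
Qed.

Lemma coideal_current_left j : tau j != j ->
  (exists2 Rm, negligible x xi (tau j) Rm &
    step_excess j = s j *: (x false (tau j) 0 * x false j 0) + Rm) ->
  forall r, ge 2 (b j r - (Ph (tau j) + Mf (tau j) * E j) r.+1).
Proof.
move=> tj [Rm [R2 Rx] RE]; have jt : j != tau j by rewrite eq_sym.
apply: (coideal_current_step rep (@cartan_diag t) (@cartan_sym t) (rho_element_xi nv rep)
  (step_scalar_neq0 j) (b0 j) (step_element_b j) _ R2 Rx (ge_G _ _)).
- by rewrite step_elementE RE addrA.
- exact: psge_degreeM (psge_Mf _) (psge_E _) _.
- exact: ME1.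
- by move=> r; apply: step_left rep _ _ _ jt.
Qed.

Lemma coideal_current_right j : tau j != j ->
  (exists2 Rm, negligible x xi (tau j) Rm &
    step_excess j = s j *: (x false j 0 * x false (tau j) 0) + Rm) ->
  forall r, ge 2 (b j r - (Ph (tau j) + E j * Mf (tau j)) r.+1).
Proof.
move=> tj [Rm [R2 Rx] RE]; have jt : j != tau j by rewrite eq_sym.
apply: (coideal_current_step rep (@cartan_diag t) (@cartan_sym t) (rho_element_xi nv rep)
  (step_scalar_neq0 j) (b0 j) (step_element_b j) _ R2 Rx (ge_G _ _)).
- by rewrite step_elementE RE addrA.
- exact: psge_degreeM (psge_E _) (psge_Mf _) _.
- exact: EM1.
- by move=> r; apply: step_right rep _ _ _ jt.
Qed.

Lemma coideal_current_self j : tau j = j ->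
  (exists2 Rm, negligible x xi (tau j) Rm &
    step_excess j = s j *: (2^-1 *: (x false j 0 * x false j 0)) + Rm) ->
  forall r, ge 2 (b j r - (Ph (tau j) + C (2^-1)%:A * (E j * Mf (tau j) + Mf (tau j) * E j)) r.+1).
Proof.
move=> tj [Rm [R2 Rx] RE].
have CE r : (C (2^-1)%:A * (E j * Mf (tau j) + Mf (tau j) * E j)) r =
   2^-1 *: (E j * Mf (tau j) + Mf (tau j) * E j) r by rewrite psCMl mulr_algl.
apply: (coideal_current_step rep (@cartan_diag t) (@cartan_sym t) (rho_element_xi nv rep)
  (step_scalar_neq0 j) (b0 j) (step_element_b j) _ R2 Rx (ge_degreeZ _ (ge_G _ _))).
- by rewrite step_elementE RE addrA.
- move=> r; rewrite CE; apply: ge_degreeZ; rewrite psD.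
  by apply: ge_degreeD; [apply: psge_degreeM (psge_E _) (psge_Mf _) _ _|
    apply: psge_degreeM (psge_Mf _) (psge_E _) _ _].
- rewrite CE psD EM1 ME1 -mulr2n -scaler_nat scalerA mulVf ?scale1r //.
  by rewrite pnatr_eq0.
- by move=> r; rewrite !CE; apply: step_self rep _ _ _ (esym tj).
Qed.

Let wp_eq0 j : adjacent j (tau j) = false -> wp K j = 0.
Proof.
rewrite /wp; case: (boolP (is_A2n t)) => //= A2n; have [_ ->] := A2n_adjacent j htau A2n.
by case: eqP => //= _; case: eqP.
Qed.

Let Theta_nonadjacent j : adjacent j (tau j) = false ->
  negligible x xi (tau j) (iota (Theta X j)).
Proof.
case: (boolP (is_A2n t)) => A2n.
  have [_ ->] := A2n_adjacent j htau A2n; move/negbT; rewrite negb_or => /andP[].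
  exact: Theta_negligible.
by rewrite /Theta A2n /= linear0 => _; apply: negligible0.
Qed.

Lemma step_excess_fixed j : tau j = j -> exists2 Rm, negligible x xi (tau j) Rm &
  step_excess j = s j *: (2^-1 *: (x false j 0 * x false j 0)) + Rm.
Proof.
move=> tj; have nadj : adjacent j (tau j) = false by rewrite tj /adjacent eqxx.
have [Rm R2 RE] := root_sum_fixed nv htau X rep iota_br iota_cx tj.
exists (2^-1 *: Rm + 2^-1 *: iota (Theta X j)).
  by apply: negligibleD; apply: negligibleZ; [rewrite tj|apply: Theta_nonadjacent].
rewrite /step_excess RE wp_eq0 // mul0r scale0r subr0 scalerDr addrA; congr (_ + _ + _).
by rewrite tj cartan_diag !scalerA; congr (_ *: _); rewrite mulrC.
Qed.

Lemma step_excess_orthogonal j : tau j != j -> cartan t j (tau j) = 0 ->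
  exists2 Rm, negligible x xi (tau j) Rm &
    step_excess j = s j *: (x false j 0 * x false (tau j) 0) + Rm.
Proof.
move=> tj cj; have nadj : adjacent j (tau j) = false by rewrite -cartan_adjacent cj.
have [Rm R2 RE] := root_sum_moved nv htau X rep iota_br iota_cx tj.
exists (2^-1 *: Rm + 2^-1 *: iota (Theta X j)).
  by apply: negligibleD; apply: negligibleZ; [|apply: Theta_nonadjacent].
rewrite /step_excess RE wp_eq0 // mul0r scale0r subr0 scalerDr addrA; congr (_ + _ + _).
rewrite cartan_diag cj cartan_sym cj !addr0 scalerA mulVf ?pnatr_eq0 // scale1r /anti.
rewrite -(x_comm _ cj); last by rewrite eq_sym.
by rewrite -mulr2n -scaler_nat.
Qed.

(** Half the anticommutator from the root sum minus half the commutator in Theta leaves the single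
    product x_(tau j)^+ x_j^+; the Cartan part of Theta cancels against -w(xi_j - xi_(tau j)). *)
Lemma step_excess_left (j : 'I_(rank t)) : is_A2n t -> j.+1 = N ->
  exists2 Rm, negligible x xi (tau j) Rm &
    step_excess j = s j *: (x false (tau j) 0 * x false j 0) + Rm.
Proof.
move=> A2n jN; have [tj] := A2n_adjacent j htau A2n; rewrite jN eqxx /= -cartan_adjacent => /eqP cj.
have [Rm R2 RE] := root_sum_moved nv htau X rep iota_br iota_cx tj.
exists (2^-1 *: Rm); first exact: negligibleZ.
rewrite /step_excess RE (Theta_left nv X rep iota_br iota_cx A2n jN).
rewrite cartan_diag cj cartan_sym cj /wp A2n jN eqxx /=.
have -> : (2 + (-1)%:~R = 1 :> K)%R by rewrite mulrN1z -[2]/(1 + 1) addrK.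
have -> : ((2 - 1)%:~R = 1 :> K)%R by [].
rewrite !scale1r /anti /lie; set p := x _ j _ * _; set q := x _ (tau j) _ * _; set e := eta j.
have -> : 1 / 4 = 2^-1 * 2^-1 :> K by rewrite -invfM -natrM mul1r.
have dbl : q = 2^-1 *: (q + q) by rewrite -mulr2n -scaler_nat scalerA mulVf ?scale1r // pnatr_eq0.
by rewrite [in RHS]dbl -scalerA; ncalg.
Qed.

Lemma step_excess_right (j : 'I_(rank t)) : is_A2n t -> j = N :> nat ->
  exists2 Rm, negligible x xi (tau j) Rm &
    step_excess j = s j *: (x false j 0 * x false (tau j) 0) + Rm.
Proof.
move=> A2n jN; have [tj adjE] := A2n_adjacent j htau A2n.
have cj : cartan t j (tau j) = -1 by apply/eqP; rewrite cartan_adjacent adjE jN eqxx orbT.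
have [Rm R2 RE] := root_sum_moved nv htau X rep iota_br iota_cx tj.
exists (2^-1 *: Rm); first exact: negligibleZ.
rewrite /step_excess RE (Theta_right nv X rep iota_br iota_cx A2n jN).
rewrite cartan_diag cj cartan_sym cj /wp A2n jN eqxx eqn_leq ltnn /=.
have -> : (2 + (-1)%:~R = 1 :> K)%R by rewrite mulrN1z -[2]/(1 + 1) addrK.
have -> : ((2 - 1)%:~R = 1 :> K)%R by [].
rewrite !scale1r /anti /lie -[xi (tau j) 0 - _]opprB.
set p := x _ j _ * _; set q := x _ (tau j) _ * _; set e := eta j.
have -> : -1 / 4 = - (2^-1 * 2^-1) :> K by rewrite -invfM -natrM mulN1r.
have dbl : p = 2^-1 *: (p + p) by rewrite -mulr2n -scaler_nat scalerA mulVf ?scale1r // pnatr_eq0.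
by rewrite [in RHS]dbl scaleNr -scalerA; ncalg.
Qed.

(** A node fixed by tau has the symmetrized correction. If c_(j, tau j) = 0, then x_j^+ and x_(tau
    j)^+ commute, both orders are available and w = 0. Otherwise j is one of the middle nodes n, n+1
    of type A_2n; the element G is x_(n+1)^+ x_n^+ for both, hence the order M E at n and E M at
    n+1. *)
Theorem coideal_cartan_triangular j r :
  ge 1 (h j r - coideal_cartan_series xi j (tau j) (w j) r.+1).
Proof.
have tK := tau_inv htau.
have h0' : h j 0 = xi j 0 - xi (tau j) 0 + (w j)%:A := h0 j.
have bb := b_b j; move: r.
have rx := rho_element_x nv rep; have rxi := rho_element_xi nv rep.
have [tj|tj] := cartan_tau_cases j.
  have nadj : adjacent j (tau j) = false by rewrite tj /adjacent eqxx.
  apply: (coideal_cartan_self rep (@cartan_diag t) (@cartan_sym t) rx rxi bb h0' (esym tj));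
    first by rewrite wp_eq0 // mul0r.
  - by apply: coideal_current_self => //; apply: step_excess_fixed.
  - have := @coideal_current_self (tau j); rewrite tK; apply; first exact: esym tj.
    by have := @step_excess_fixed (tau j); rewrite tK; apply; exact: esym tj.
have tj' : tau (tau j) != tau j by rewrite tK eq_sym.
case: (cartan_cases j (tau j)) => [[jt _]|cj|cj]; first by rewrite -jt eqxx in tj.
  have cj' : cartan t (tau j) (tau (tau j)) = 0 by rewrite tK cartan_sym.
  apply: (coideal_cartan_left rep (@cartan_sym t) rx rxi bb h0').
  - rewrite cartan_sym cj oppr0 mul0r wp_eq0 ?mul0r //.
    by rewrite -cartan_adjacent cj.
  - apply: coideal_current_left => //; have [Rm R2 RE] := step_excess_orthogonal tj cj.
    by exists Rm => //; rewrite RE (x_comm _ cj) // eq_sym.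
  - have := @coideal_current_right (tau j) tj'; rewrite tK; apply.
    by have := step_excess_orthogonal tj' cj'; rewrite tK.
have adj : adjacent j (tau j) by rewrite -cartan_adjacent cj.
have A2n : is_A2n t by apply: contraLR adj; apply: tau_not_adjacent.
have := adj; have [_ ->] := A2n_adjacent j htau A2n => /orP[/eqP jN|/eqP jN].
  have tjN : tau j = N :> nat by rewrite (A2n_tau _ htau A2n); have := A2n_rank A2n; lia.
  apply: (coideal_cartan_left rep (@cartan_sym t) rx rxi bb h0').
  - by rewrite cartan_sym cj /wp A2n jN eqxx /= mulrN1z opprK.
  - by apply: coideal_current_left => //; apply: step_excess_left.
  - have := @coideal_current_right (tau j) tj'; rewrite tK; apply.
    by have := step_excess_right A2n tjN; rewrite tK.
have tjN : (tau j).+1 = N by rewrite (A2n_tau _ htau A2n); have := A2n_rank A2n;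
  have := ltn_ord j; lia.
apply: (coideal_cartan_right rep (@cartan_sym t) rx rxi bb h0').
- by rewrite cartan_sym cj /wp A2n jN eqxx eqn_leq ltnn /= mulrN1z.
- by apply: coideal_current_right => //; apply: step_excess_right.
- have := @coideal_current_left (tau j) tj'; rewrite tK; apply.
  by have := step_excess_left A2n tjN; rewrite tK.
Qed.
End Triangularity.

(** * Expansions of rational functions *)

Section Expansion.
Variable K : fieldType.
Implicit Types (P Q : {poly K}) (S : pser K) (s : seq K).

Definition rootprod s : {poly K} := \prod_(a <- s) ('X - a%:P).

(* The series of P(u) / u^d, in powers of 1/u. *)
Definition psrev d P : pser K := fun n => if (n <= d)%N then P`_(d - n) else 0.

Lemma size_rootprod s : size (rootprod s) = (size s).+1.
Proof. exact: size_prod_XsubC. Qed.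

Lemma psrev_XsubC d P a : (size P <= d.+1)%N ->
  psrev d.+1 (P * ('X - a%:P)) = psrev d P * pslin a.
Proof.
move=> sP; apply: funext => n; rewrite /pslin [in RHS]mulrBr mulr1 psB.
have -> : psrev d P * (psX * psC a) = psX * (psC a * psrev d P) by rewrite mulrC -mulrA.
rewrite psXM /psrev mulrBr coefB coefMX coefMC.
case: n => [|n]; first by rewrite !leq0n !subn0 /= (nth_default 0 sP) mul0r.
rewrite psCMl subSS ltnS; have [nd|dn|<-] := ltngtP n d.
- have -> : (d - n = (d - n.+1).+1)%N by lia.
  by rewrite /= mulrC.
- by rewrite mulr0 subrr.
- by rewrite subnn /= mulrC.
Qed.

Lemma psrev_rootprod s : psrev (size s) (rootprod s) = \prod_(a <- s) pslin a.
Proof.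
rewrite /rootprod; elim: s => [|a s IH].
  by apply: funext => -[|n]; rewrite !big_nil /psrev ?coef1 // ps1.
rewrite !big_cons /= mulrC psrev_XsubC; last by rewrite -/(rootprod s) size_rootprod.
by rewrite IH mulrC.
Qed.

Lemma expansion_psrev d P Q S : (size Q <= d.+1)%N -> (size P <= d.+1)%N ->
  psrev d Q * S = psrev d P -> forall k : int,
  \sum_(j < size Q) Q`_j * laurent_coef S (k - j%:Z) = poly_coef P k.
Proof.
move=> sQ sP E k.
have -> : \sum_(j < size Q) Q`_j * laurent_coef S (k - j%:Z) =
          \sum_(j < d.+1) Q`_j * laurent_coef S (k - j%:Z).
  rewrite (big_ord_widen _ (fun j => Q`_j * laurent_coef S (k - j%:Z)) sQ) big_mkcond.
  apply: eq_bigr => j _; case: ltnP => // sj; by rewrite (nth_default 0 sj) mul0r.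
have [kd|dk] := lerP k d%:Z; last first.
  rewrite big1 => [|j _].
    by rewrite /poly_coef nth_default ?if_same //; apply: leq_trans sP _; lia.
  rewrite /laurent_coef; have -> : (k - j%:Z <= 0) = false by have := ltn_ord j; lia.
  by rewrite mulr0.
pose n := `|d%:Z - k|%N; have nE : n%:Z = d%:Z - k by rewrite /n; lia.
have -> : poly_coef P k = psrev d P n.
  rewrite /poly_coef /psrev; have -> : (0 <= k) = (n <= d)%N by lia.
  by case: ifP => // nd; congr (P`_ _); lia.
rewrite -E psM (reindex_inj rev_ord_inj) /=.
pose F i := if (i <= d)%N && (i <= n)%N then Q`_(d - i) * S (n - i)%N else 0.
(* One sum is cut off at d, the other at n = d - k; as F vanishes beyond either bound, both extend
   to the range up to d + n. *)
transitivity (\sum_(i < (d + n).+1) F i).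
  have le1 : (d.+1 <= (d + n).+1)%N by rewrite ltnS leq_addr.
  rewrite (big_ord_widen _ (fun i => Q`_(d.+1 - i.+1) * laurent_coef S (k - (d.+1 - i.+1)%N%:Z))
    le1).
  rewrite big_mkcond; apply: eq_bigr => i _; rewrite /F ltnS subSS.
  case: leqP => //= id; rewrite /laurent_coef.
  have -> : (k - (d - i)%N%:Z <= 0) = (i <= n)%N by lia.
  by case: leqP => [i_n|]; rewrite ?mulr0 //; congr (_ * S _); lia.
have le2 : (n.+1 <= (d + n).+1)%N by rewrite ltnS leq_addl.
rewrite (big_ord_widen _ (fun i => psrev d Q i * S (n - i)%N) le2) [RHS]big_mkcond.
apply: eq_bigr => i _; rewrite /F /psrev ltnS andbC.
by case: (i <= n)%N => //=; case: (i <= d)%N => //=; rewrite mul0r.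
Qed.

Lemma poly_shift_rootprod s a : poly_shift (rootprod s) a = rootprod [seq b - a | b <- s].
Proof.
rewrite /poly_shift /rootprod big_map rmorph_prod; apply: eq_bigr => b _.
by rewrite /= comp_polyB comp_polyX comp_polyC polyCB opprB addrA.
Qed.

Lemma poly_minus_rootprod s : poly_minus (rootprod s) = rootprod [seq - b | b <- s].
Proof.
rewrite /poly_minus size_rootprod /= /rootprod big_map rmorph_prod.
elim: s => [|b s IH]; first by rewrite !big_nil expr0 scale1r.
rewrite !big_cons -IH /= exprS -scalerA scaleN1r comp_polyB comp_polyX comp_polyC polyCN opprK.
by rewrite -scalerN -mulNr opprB opprK addrC -scalerAr.
Qed.

(* The factor 1 + w/u is a quotient of two more linear factors, with roots [- w] and 0. *)
Lemma expansion_rootprod (A B : seq K) w S : size A = size B ->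
  S * \prod_(b <- B) pslin b = (1 + psX * psC w) * \prod_(a <- A) pslin a ->
  expansion_at_infinity ((1 + w%:P%:F / 'X%:F) * ((rootprod A)%:F / (rootprod B)%:F)) S.
Proof.
move=> sAB E; exists (rootprod (- w :: A)), (rootprod (0 :: B)); split.
- by rewrite -size_poly_eq0 size_rootprod.
- rewrite /rootprod !big_cons -!/(rootprod _) subr0 polyCN opprK !tofracM tofracD.
  have X0 : 'X%:F != 0 :> {fraction {poly K}} by rewrite tofrac_eq0 polyX_eq0.
  by rewrite -[1]/(1 : {fraction {poly K}}) -(divff X0) -mulrDl mulrACA -invfM.
- apply: (@expansion_psrev (size (0 :: B))); rewrite ?size_rootprod //= ?sAB //.
  rewrite -[in RHS]sAB -/(size (- w :: A)) -/(size (0 :: B)) !psrev_rootprod !big_cons.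
  rewrite [in RHS]/pslin [pslin 0]/pslin rmorph0 mulr0 subr0 mul1r rmorphN mulrN opprK -E.
  by rewrite mulrC.
Qed.
End Expansion.

Section Reflection.
Variable K : numFieldType.
Implicit Types mu : pser K.

Lemma psnegM (a b : pser K) : psneg (a * b) = psneg a * psneg b.
Proof.
apply: funext => n; rewrite /psneg !psM mulr_sumr; apply: eq_bigr => i _.
have -> : (-1) ^+ n = (-1) ^+ i * (-1) ^+ (n - i) :> K by rewrite -exprD subnKC // -ltnS.
by rewrite mulrACA.
Qed.

Lemma psneg_prod I (r : seq I) (F : I -> pser K) :
  psneg (\prod_(i <- r) F i) = \prod_(i <- r) psneg (F i).
Proof.
elim: r => [|i r IH]; last by rewrite !big_cons psnegM IH.
by rewrite !big_nil; apply: funext => -[|n]; rewrite /psneg ps1 ?expr0 ?mulr1 ?mulr0.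
Qed.

Lemma psneg_pslin (c : K) : psneg (pslin c) = pslin (- c).
Proof.
apply: funext => -[|[|n]]; rewrite /psneg /pslin !psB !ps1 !psXM /=.
- by rewrite expr0 mul1r.
- by rewrite expr1 !sub0r mulN1r opprK.
- by rewrite subr0 mulr0.
Qed.

(** With mu_j the shift quotient of Q_j/R_j, reflection u -> -u exchanges the two shifts, so the
    denominator R_(tau j) moves to the numerator side. Taking Xi_j = Q_j R_(tau j)^- therefore gives
    a polynomial although Q_j/R_j need not be one; [L] lists its roots. *)
Lemma shift_quotient_reflect qs rs qs' rs' mu mu' :
  shift_quotient qs rs mu -> shift_quotient qs' rs' mu' ->
  let L := qs ++ [seq - b | b <- rs'] in let L' := qs' ++ [seq - b | b <- rs] in
  mu * psneg mu' * \prod_(a <- [seq a - - (1 / 2) | a <- L] ++ [seq - a - 1 / 2 | a <- L']) pslin a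
  = \prod_(a <- [seq a - 1 / 2 | a <- L] ++ [seq - a - - (1 / 2) | a <- L']) pslin a.
Proof.
move=> E /(congr1 (@psneg K)); rewrite !psnegM !psneg_prod => E' L L'.
rewrite /L /L' !map_cat !big_cat /= !big_map.
have fold (I : seq K) (F G : K -> K) : F =1 G ->
  \prod_(i <- I) pslin (F i) = \prod_(i <- I) pslin (G i) by move=> FG; apply: eq_bigr => i _;
    rewrite FG.
have foldN (I : seq K) (F G : K -> K) : (forall i, F i = - G i) ->
  \prod_(i <- I) pslin (F i) = \prod_(i <- I) psneg (pslin (G i)).
  by move=> FG; apply: eq_bigr => i _; rewrite FG psneg_pslin.
rewrite (fold qs _ (fun a => a + 2^-1)) => [|a]; last by rewrite opprK mul1r.
rewrite (foldN rs' _ (fun b => b - 2^-1)) => [|a]; last by rewrite opprK mul1r opprB addrC.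
rewrite (foldN qs' _ (fun a => a + 2^-1)) => [|a]; last by rewrite mul1r opprD.
rewrite (fold rs _ (fun b => b - 2^-1)) => [|a]; last by rewrite mul1r opprK.
rewrite [in RHS](fold qs _ (fun a => a - 2^-1)) => [|a]; last by rewrite mul1r.
rewrite [in RHS](foldN rs' _ (fun b => b + 2^-1)) => [|a]; last by rewrite mul1r opprD.
rewrite [in RHS](foldN qs' _ (fun a => a - 2^-1)) => [|a]; last by rewrite mul1r opprK opprB addrC.
rewrite [in RHS](fold rs _ (fun b => b + 2^-1)) => [|a]; last by rewrite mul1r !opprK.
move: E E'; set q1 := \prod_(a <- qs) _; set r1 := \prod_(b <- rs) _.
set q2 := \prod_(a <- qs) _; set r2 := \prod_(b <- rs) _.
set p1 := \prod_(a <- qs') _; set s1 := \prod_(b <- rs') _.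
set p2 := \prod_(a <- qs') _; set s2 := \prod_(b <- rs') _ => E E'.
have AC (R : comPzRingType) (m m' q s p r : R) :
  m * m' * (q * s * (p * r)) = m * (q * r) * (m' * (p * s)) by ring.
have AC' (R : comPzRingType) (q s p r : R) : q * s * (p * r) = q * r * (p * s) by ring.
by rewrite AC E E' AC'.
Qed.
End Reflection.

Lemma shift_quotient_expansion (K : numClosedFieldType) n (tau : 'I_n -> 'I_n)
    (w : 'I_n -> K) (mu : 'I_n -> pser K) (lam : 'I_n -> nat -> K) : involutive tau ->
  (forall i, exists qs rs, shift_quotient qs rs (mu i)) ->
  (forall j, (ilseries (lam j) : pser K) =
     (1 + psX * psC (w j)) * (mu j * psneg (mu (tau j)))) ->
  exists Xi : 'I_n -> {poly K}, (forall i, Xi i \is monic) /\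
    forall i, expansion_at_infinity
      ((1 + (w i)%:P%:F / 'X%:F) *
       ((poly_shift (Xi i) (1 / 2) * poly_shift (poly_minus (Xi (tau i))) (- (1 / 2)))%:F /
        (poly_shift (Xi i) (- (1 / 2)) * poly_shift (poly_minus (Xi (tau i))) (1 / 2))%:F))
      (ilseries (lam i)).
Proof.
move=> tauK /choice[qs] /choice[rs] muE lamE.
pose L i := qs i ++ [seq - b | b <- rs (tau i)].
exists (fun i => rootprod (L i)); split=> [i|i]; first exact: monic_prod_XsubC.
rewrite !poly_minus_rootprod !poly_shift_rootprod -!big_cat -!/(rootprod _) -!map_comp.
apply: expansion_rootprod; first by rewrite !size_cat !size_map.
rewrite lamE -mulrA; congr (_ * _).
by have /= := shift_quotient_reflect (muE i) (muE (tau i)); rewrite /L tauK.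
Qed.

Lemma map_shiftX (K : fieldType) (A B : algType K) (f : {lrmorphism A -> B}) a k p :
  f ((a - k%:A) ^+ p) = (f a - k%:A) ^+ p.
Proof.
have f1 : f 1 = 1 := rmorph1 f.
have fk : f k%:A = k *: f 1 by apply: linearZ.
by rewrite -[in RHS]f1 -fk -rmorphB -rmorphXn.
Qed.

Theorem corollary3p6 (R : realType) (t : ade) (ht : ade_valid t)
    (tau : 'I_(rank t) -> 'I_(rank t)) (htau : diagram_involution tau)
    (g : chevalley_lie R[i] t) (X : root_vectors tau g)
    (iota : {linear g -> yangian R[i] (cartan t)}) (hiota : lie_inclusion iota)
    (phi : {lrmorphism iyangian R[i] (cartan t) tau ->
                       yangian R[i] (cartan t)})
    (hphi : iyangian_embedding X iota phi)
    (V : fd_module (yangian R[i] (cartan t)))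
    (lam : 'I_(rank t) -> nat -> R[i])
    (hlam : is_ilweight (restrict_along phi V) lam) :
  exists Xi : 'I_(rank t) -> {poly R[i]},
    (forall i, Xi i \is monic) /\
    forall i,
      expansion_at_infinity
        ((1 + (wp R[i] i / 4)%:P%:F / 'X%:F) *
         ((poly_shift (Xi i) (1 / 2) *
           poly_shift (poly_minus (Xi (tau i))) (- (1 / 2)))%:F /
          (poly_shift (Xi i) (- (1 / 2)) *
           poly_shift (poly_minus (Xi (tau i))) (1 / 2))%:F))
        (ilseries (lam i)).
Proof.
have rep := @yangian_is_rep R[i] _ (cartan t).
have [_ iota_br iota_cx] := hiota; have [_ h0 b0 h1] := hphi.
pose h j r := phi (ih R[i] (cartan t) tau j r); pose b j r := phi (ib R[i] (cartan t) tau j r).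
have hE j r := coideal_cartan_triangular (h := h) (b := b) ht htau rep (@yangian_commute R[i] _
  (cartan t))
  iota_br iota_cx h0 b0 h1 (fun j r => coideal_h0_b phi j j r) (fun j r => coideal_h1_b phi j j r)
  (fun j s => coideal_b_b phi j s (tau_inv htau)) j r.
have [v v0 vlam] := hlam.
have hv j r : exists p,
    fd_act V ((phi (ih R[i] (cartan t) tau j r) - (lam j r)%:A) ^+ p) v = 0.
  have [p _ pv] := vlam j r; exists p.
  exact (etrans (congr1 (fun a => fd_act V a v) (esym (map_shiftX phi _ _ _))) pv).
have T := @triangular_cartan_eigenvalues R[i] (rank t) (cartan t)
  (yangian R[i] (cartan t)) _ _ rep (@cartan_diag t) _ V (rho_element_xi ht rep) tau
  (fun j => wp R[i] j / 4) h hE lam v v0 hv.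
have [mu [muq muE]] := T.
exact: shift_quotient_expansion (tau_inv htau) muq muE.
Qed.
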